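(* Let $X$ be an arbitrary topological space and let $\mathcal A\colon X\to\mathcal R_K^1(H)$ be a Riesz continuous map. Then the following three conditions are equivalent: (1) $\mathcal A$ has a $\mathrm{Cl}(1)$ spectral section; (2) $\mathcal A$ has a generalized $\mathrm{Cl}(1)$ spectral section; (3) $\mathcal A$ is homotopic, via a Riesz continuous homotopy $X\times[0,1]\to\mathcal R_K^1(H)$, to a family of invertible operators. Moreover, if $P$ is a generalized $\mathrm{Cl}(1)$ spectral section for $\mathcal A$ and $\varepsilon>0$, then a $\mathrm{Cl}(1)$ spectral section $Q$ for $\mathcal A$ can be chosen so that $\|Q-P\|_\infty=\sup_{x\in X}\|Q_x-P_x\|<\varepsilon$ and $Q$ is homotopic to $P$ as a generalized $\mathrm{Cl}(1)$ spectral section (that is, through a norm continuous homotopy each stage of which is a generalized $\mathrm{Cl}(1)$ spectral section for $\mathcal A$).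
   Context: $H=H^0\oplus H^1$ is a $\mathbb Z_2$-graded separable complex Hilbert space with $H^0,H^1$ both infinite-dimensional, and $\sigma=\begin{pmatrix}1&0\\0&-1\end{pmatrix}\in\mathcal B(H)$ is the symmetry defining the grading. An operator is odd if it anticommutes with $\sigma$. $\mathcal R_K^{\mathrm{sa}}(H)$ is the set of regular (closed densely defined) self-adjoint operators $A$ on $H$ with compact resolvents, i.e. with $(A+i)^{-1}$ compact, and $\mathcal R_K^1(H)$ is its subset of odd operators. The bounded transform is $f(A)=A(1+A^*A)^{-1/2}$; the Riesz topology is the topology induced by $f$ from the norm topology on $\mathcal B(H)$; Riesz continuous means continuous with respect to it. Projection means orthogonal projection. $\mathbb 1_S$ is the characteristic function of $S\subset\mathbb R$; $\mathbb R_+=(0,\infty)$. For $r>0$, a projection $P$ is an $r$-spectral section for $A$ if $\mathbb 1_{[r,+\infty)}(A)\le P\le\mathbb 1_{(-r,+\infty)}(A)$. A spectral section for a family $\mathcal A=(\mathcal A_x)$ is a norm continuous family $P=(P_x)$ of projections for which there is a continuous $r\colon X\to\mathbb R_+$ (the cut-off function) such that $P_x$ is an $r_x$-spectral section for $\mathcal A_x$ for all $x\in X$. A generalized spectral section for $\mathcal A$ is a norm continuous family $P=(P_x)$ of projections such that $P_x-\mathbb 1_{[0,+\infty)}(\mathcal A_x)$ is compact for all $x\in X$. A (generalized) $\mathrm{Cl}(1)$ spectral section for $\mathcal A$ is a (generalized) spectral section $P$ for $\mathcal A$ such that $\sigma P_x\sigma^{-1}=1-P_x$ for all $x\in X$.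 *)

(* Defs.v *)
From HB Require Import structures.
From mathcomp Require Import all_boot all_order all_algebra.
From mathcomp Require Export complex.
From mathcomp Require Import all_classical all_reals all_analysis.
Import Order.TTheory GRing.Theory Num.Theory Num.Def.
Import numFieldNormedType.Exports.

Set Implicit Arguments.
Unset Strict Implicit.
Unset Printing Implicit Defensive.

Local Open Scope classical_set_scope.
Local Open Scope ring_scope.
Local Open Scope complex_scope.

(* Conventions: the scalars are R[i] for R : realType, and a Hilbert space is a
   complete normed module H over R[i] together with a positive definite
   hermitian form (linear in its first argument, antilinear in its second one)
   inducing the norm of H. A bounded operator is a function H -> H; an
   unbounded operator is identified with its graph, a subset of H * H. *)

Section hilbert.
Context {R : realType} {H : completeNormedModType R[i]}.
Variable form : {dot H for conjC}.
Local Notation "''[' u , v ]" := (form u v) : ring_scope.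

Definition induces_norm := forall u : H, `|u| ^+ 2 = '[u, u].

Definition separable_space := exists2 D : set H, countable D & dense D.

Definition closed_subspace (V : set H) :=
  [/\ closed V, V 0 & forall (a : R[i]) u v, V u -> V v -> V (a *: u + v)].

Definition infinite_dimensional (V : set H) :=
  forall n (e : 'I_n -> H), exists2 v, V v &
    forall c : 'I_n -> R[i], v != \sum_(i < n) c i *: e i.

(* s is the matrix diag(1, -1) in the decomposition of H as the orthogonal
   sum of H0 and H1. *)
Record grading (H0 H1 : set H) (s : H -> H) : Prop := Grading {
  grading_closed0 : closed_subspace H0 ;
  grading_closed1 : closed_subspace H1 ;
  grading_ortho : forall u v, H0 u -> H1 v -> '[u, v] = 0 ;
  grading_sum : forall u, exists v w, [/\ H0 v, H1 w & u = v + w] ;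
  grading_symm : forall v w, H0 v -> H1 w -> s (v + w) = v - w }.

(* The norm of H is valued in R[i]; this is its real value. *)
Definition rnorm (u : H) : R := complex.Re `|u|.

Definition opnorm (T : H -> H) : \bar R :=
  ereal_sup [set (rnorm (T u))%:E | u in [set u | rnorm u <= 1]].

Definition bounded_op (T : H -> H) := linear T /\ (opnorm T < +oo)%E.

Definition selfadjoint_bounded (T : H -> H) :=
  bounded_op T /\ forall u v, '[T u, v] = '[u, T v].

Definition positive_bounded (T : H -> H) :=
  selfadjoint_bounded T /\ forall u, 0 <= '[T u, u].

Definition projection (P : H -> H) := selfadjoint_bounded P /\ P \o P = P.

Definition op_le (S T : H -> H) := forall u, '[S u, u] <= '[T u, u].

Definition op_sub (S T : H -> H) : H -> H := fun u => S u - T u.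

Definition compact_op (T : H -> H) :=
  bounded_op T /\ compact (closure (T @` [set u | rnorm u <= 1])).

Definition norm_continuous (Y : topologicalType) (D : set Y)
    (T : Y -> H -> H) :=
  forall y, D y -> forall e : R, 0 < e ->
    \forall z \near within D (nbhs y), (opnorm (op_sub (T z) (T y)) < e%:E)%E.

Definition graph (T : H -> H) : set (H * H) := [set p | p.2 = T p.1].

Definition gdom (A : set (H * H)) : set H := [set u | exists v, A (u, v)].

Definition gadd (A B : set (H * H)) : set (H * H) :=
  [set p | exists v w, [/\ A (p.1, v), B (p.1, w) & p.2 = v + w]].

Definition gcomp (A B : set (H * H)) : set (H * H) :=
  [set p | exists2 w, B (p.1, w) & A (w, p.2)].

Definition ginv (A : set (H * H)) : set (H * H) := [set p | A (p.2, p.1)].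

Definition adjoint (A : set (H * H)) : set (H * H) :=
  [set p | forall u v, A (u, v) -> '[v, p.1] = '[u, p.2]].

Definition linear_operator (A : set (H * H)) :=
  (forall u v w, A (u, v) -> A (u, w) -> v = w) /\
  (forall (a : R[i]) u v u' v', A (u, v) -> A (u', v') ->
     A (a *: u + u', a *: v + v')).

Definition regular (A : set (H * H)) :=
  [/\ linear_operator A, closed A & dense (gdom A)].

Definition compact_resolvent (A : set (H * H)) :=
  exists2 K, compact_op K & ginv (gadd A (graph (fun u => 'i *: u))) = graph K.

Definition RKsa : set (set (H * H)) :=
  [set A | [/\ regular A, adjoint A = A & compact_resolvent A]].

Definition odd_operator (s : H -> H) (A : set (H * H)) :=
  gcomp A (graph s) = gcomp (graph (fun u => - s u)) A.

Definition RK1 (s : H -> H) : set (set (H * H)) :=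
  [set A | RKsa A /\ odd_operator s A].

Definition invertible (A : set (H * H)) :=
  exists2 K, bounded_op K & ginv A = graph K.

(* F = A (1 + A^* A)^(-1/2), where (1 + A^* A)^(-1/2) is the positive square
   root B of (1 + A^* A)^-1. *)
Definition is_bounded_transform (A : set (H * H)) (F : H -> H) :=
  exists B, [/\ positive_bounded B,
    ginv (gadd (graph id) (gcomp (adjoint A) A)) = graph (B \o B) &
    gcomp A (graph B) = graph F].

Definition bounded_transform (A : set (H * H)) : H -> H :=
  get [set F : H -> H | is_bounded_transform A F].

Definition Riesz_continuous (Y : topologicalType) (D : set Y)
    (A : Y -> set (H * H)) :=
  norm_continuous D (fun y => bounded_transform (A y)).

(* E is the projection-valued measure of the spectral theorem for the
   self-adjoint operator A, i.e. A is the integral of t with respect to E: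
   writing mu u for the measure S |-> '[E S u, u], the domain of A is the set
   of the u such that t is square integrable with respect to mu u, and then
   '[A u, u] and `|A u|^2 are the integrals of t and t^2. (The last condition
   is a consequence of the other ones.) *)
Definition is_spectral_measure (A : set (H * H)) (E : set R -> H -> H) :=
  [/\ forall S : set (measurableTypeR R), measurable S -> projection (E S),
      E setT = id &
      exists mu : H -> {measure set (measurableTypeR R) -> \bar R},
        [/\ forall u S, measurable S -> mu u S = (complex.Re '[E S u, u])%:E,
            forall u, gdom A u <-> (\int[mu u]_t (t ^+ 2)%:E < +oo)%E,
            forall u v, A (u, v) -> '[v, u] = (\int[mu u]_t t)%:C &
            forall u v, A (u, v) -> '[v, v] = (\int[mu u]_t (t ^+ 2))%:C]].

Definition spectral_measure (A : set (H * H)) : set R -> H -> H :=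
  get [set E : set R -> H -> H | is_spectral_measure A E].

(* 1_S(A) *)
Definition spectral_projection (S : set R) (A : set (H * H)) : H -> H :=
  spectral_measure A S.

Definition r_spectral_section (r : R) (A : set (H * H)) (P : H -> H) :=
  [/\ projection P, op_le (spectral_projection `[r, +oo[ A) P &
      op_le P (spectral_projection `]- r, +oo[ A)].

Section families.
Context {X : topologicalType}.
Implicit Types (A : X -> set (H * H)) (P : X -> H -> H).

Definition projection_family P :=
  (forall x, projection (P x)) /\ norm_continuous setT P.

Definition spectral_section A P :=
  projection_family P /\
  exists r : X -> R, [/\ continuous r, forall x, 0 < r x &
    forall x, r_spectral_section (r x) (A x) (P x)].

Definition generalized_spectral_section A P :=
  projection_family P /\
  forall x,
    compact_op (op_sub (P x) (spectral_projection `[0, +oo[ (A x))).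

(* s P_x s^-1 = 1 - P_x, where s^-1 = s *)
Definition Cl1_symmetric (s : H -> H) P :=
  forall x u, s (P x (s u)) = u - P x u.

Definition Cl1_spectral_section (s : H -> H) A P :=
  spectral_section A P /\ Cl1_symmetric s P.

Definition generalized_Cl1_spectral_section (s : H -> H) A P :=
  generalized_spectral_section A P /\ Cl1_symmetric s P.

Definition unit_cylinder : set (X * R) := setT `*` `[0, 1].

Definition RK1_homotopic (s : H -> H) A0 A1 :=
  exists h : X * R -> set (H * H),
    [/\ forall p, unit_cylinder p -> RK1 s (h p),
        Riesz_continuous unit_cylinder h,
        forall x, h (x, 0) = A0 x & forall x, h (x, 1) = A1 x].

Definition homotopic_generalized_Cl1 (s : H -> H) A P0 P1 :=
  exists h : X * R -> H -> H,
    [/\ norm_continuous unit_cylinder h,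
        forall t, 0 <= t <= 1 ->
          generalized_Cl1_spectral_section s A (fun x => h (x, t)),
        forall x, h (x, 0) = P0 x & forall x, h (x, 1) = P1 x].

Definition sup_dist P Q : \bar R :=
  ereal_sup [set opnorm (op_sub (P x) (Q x)) | x in [set: X]].

End families.
End hilbert.

(* Main.v *)
Require Import Defs.
From HB Require Import structures.
From mathcomp Require Import all_boot all_order all_algebra complex.
From mathcomp Require Import all_classical all_reals all_analysis.
From mathcomp Require Import measurable_realfun.
From mathcomp Require Import ring lra zify.
Import Order.TTheory GRing.Theory Num.Theory Num.Def.
Import numFieldNormedType.Exports.

(** For [A] in [RK1] let [F] be its bounded transform: an odd self-adjoint
strict contraction whose defect [1 - F^2 = (1 + A^2)^-1] is compact and
injective, and which determines [A]. Riesz continuity of a family is norm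
continuity of its transforms, so the theorem is about norm continuous families
of such [F].

A projection [P] is replaced by the symmetry [p = 2 P - 1]. Then [P] is
[Cl(1)] symmetric exactly when [p] is odd. On an eigenvector the difference
between the sign of [A] and [F] is at most [1 - F^2], hence
[2 1_[0, oo[(A) - 1 - F] is compact, and a generalized [Cl(1)] spectral
section is a norm continuous family of odd symmetries [p_x] with [p_x - F_x]
compact ([odd_symmetry]). The one tool for producing such symmetries is the
sign ([op_sgn]): if [q] is self-adjoint and odd, close to a symmetry, and
[q - F] is compact, then [sgn q] is an odd symmetry with [sgn q - F] compact,
which depends norm continuously on [q] ([op_sgn_odd_symmetry], [op_sgn_cvg]).

Spectral sections are generalized ones. If [P] is an [r]-spectral section,
[P - 1_[0, oo[(A)] kills the eigenvectors with eigenvalue at least [r] in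
absolute value, so it factors through [1 - F^2] and is compact
([section_compact]).

Generalized sections are close to spectral sections. Let [k = p - F], a
compact operator, and let [chi] be a cut-off of [1 - F^2], that vanishes where
[1 - F^2 <= delta] and is the identity where [1 - F^2 >= 2 delta]. For small
[delta] the operator [q = F + chi k chi] is close to [F + k = p], because
[1 - F^2] has dense range and [k] is compact. It coincides with [F] on the
eigenvectors of [A] whose eigenvalue is at least [1 / delta] in absolute
value, so that the projection onto the positive part of [q] is a
[1 / delta]-spectral section. The signs of the segment from [q] to [p] form
the homotopy. Since [X] is arbitrary, partitions of unity cannot be used to
choose [delta] continuously in [x]; instead [continuous_gauge] takes a
supremum of admissible radii that is Lipschitz with respect to the norms of
the operators involved.

From generalized sections to invertible families. The operators
[(1 - c) F + c p] with [0 <= c < 1] are strict contractions with compact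
defect, so they are bounded transforms of operators in [RK1]
([inverse_transform_RK1], [inverse_transformK]). For [c = 7 / 8] they are at
distance at most [1 / 4] from a symmetry, which makes the operators invertible
([RK1_defect_invertible]).

From invertible families to generalized sections. Let [F_(x, t)] be the
transforms of the homotopy. At [t = 1] they are invertible, and [sgn F_(x, 1)]
is an odd symmetry equal to [F_(x, 1)] up to a compact operator. It is carried
back to [t = 0] by [p |-> sgn (p + F_(x, t') - F_(x, t))], with steps from [t]
to [t'] that are so short that [F_(x, t)] moves by at most [1 / 4]. The length
of the steps is again chosen by [continuous_gauge]; the number of steps does
not matter, as nothing changes once [t = 0] is reached ([transported_stable]),
whence the continuity.

The eigenvectors come from the spectral theorem for the compact operator
[(1 + A^2)^-1]: an eigenvector [v] of it yields the eigenvectors [n v + A v]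
and [n v - A v] of [A], or is itself one ([RK1_eigenbasis]). In an orthonormal
basis of eigenvectors, the bounded transform and the spectral measure are
computed from their defining properties ([bounded_transformE],
[spectral_projectionE]). *)

Set Implicit Arguments.
Unset Strict Implicit.
Unset Printing Implicit Defensive.

Local Open Scope classical_set_scope.
Local Open Scope ring_scope.
Local Open Scope complex_scope.

(** * The real inner product *)

Section hilbert.
Context {R : realType} {H : completeNormedModType R[i]}.
Variable form : {dot H for conjC}.
Hypothesis form_norm : induces_norm form.

(** The real part of the inner product. Norms, adjoints and orthogonal
expansions only see the underlying real Hilbert space; a complex linear
operator is self-adjoint as soon as it is symmetric for [ip]. *)
Definition ip (u v : H) : R := complex.Re (form u v).

Lemma form_conj u v : form v u = conjc (form u v).
Proof. by rewrite (hermC form) expr0 mul1r. Qed.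

Lemma ipC u v : ip u v = ip v u.
Proof. by rewrite /ip (form_conj v u); case: (form v u). Qed.

Lemma ipDl u v w : ip (u + v) w = ip u w + ip v w.
Proof. by rewrite /ip linearDl /=; case: (form u w); case: (form v w). Qed.

Lemma ipNl u w : ip (- u) w = - ip u w.
Proof. by rewrite /ip linearNl /=; case: (form u w). Qed.

Lemma ipBl u v w : ip (u - v) w = ip u w - ip v w.
Proof. by rewrite ipDl ipNl. Qed.

Lemma ip0l w : ip 0 w = 0.
Proof. by rewrite /ip linear0l. Qed.

Lemma ipZl (r : R) u w : ip (r%:C *: u) w = r * ip u w.
Proof.
rewrite /ip linearZl_LR /=; case: (form u w) => a b /=.
by rewrite mul0r subr0.
Qed.

Lemma ipDr u v w : ip w (u + v) = ip w u + ip w v.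
Proof. by rewrite ipC ipDl ![ip _ w]ipC. Qed.

Lemma ipNr u w : ip w (- u) = - ip w u.
Proof. by rewrite ipC ipNl ipC. Qed.

Lemma ipBr u v w : ip w (u - v) = ip w u - ip w v.
Proof. by rewrite ipDr ipNr. Qed.

Lemma ip0r w : ip w 0 = 0.
Proof. by rewrite ipC ip0l. Qed.

Lemma ipZr (r : R) u w : ip w (r%:C *: u) = r * ip w u.
Proof. by rewrite ipC ipZl ipC. Qed.

Definition ipE := (ipDl, ipBl, ipNl, ipZl, ip0l, ipDr, ipBr, ipNr, ipZr, ip0r).

Lemma ip_sum I (s : seq I) (F : I -> H) w :
  ip (\sum_(i <- s) F i) w = \sum_(i <- s) ip (F i) w.
Proof.
elim: s => [|i s IH]; first by rewrite !big_nil ip0l.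
by rewrite !big_cons ipDl IH.
Qed.

Lemma form_ipE u v : form u v = Complex (ip u v) (ip u ('i *: v)).
Proof.
rewrite /ip linearZr_LR /=; case: (form u v) => a b /=.
by rewrite mul0r sub0r mulN1r opprK.
Qed.

Lemma ip_iM u v : ip ('i *: u) ('i *: v) = ip u v.
Proof.
rewrite /ip linearZr_LR /= linearZl_LR /=; case: (form u v) => a b /=.
ring.
Qed.

Lemma ip_i u : ip u ('i *: u) = 0.
Proof.
have := form_conj u u; rewrite form_ipE => /eqP; rewrite eq_complex /=.
by move=> /andP[_ /eqP h]; lra.
Qed.

Lemma normE (u : H) : `|u| = (rnorm u)%:C.
Proof. by rewrite /rnorm RRe_real // ger0_real. Qed.

Lemma ip_sqr u : ip u u = rnorm u ^+ 2.
Proof.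
have := form_norm u; rewrite normE /ip => <-.
by rewrite -rmorphXn.
Qed.

Lemma rnorm_ge0 (u : H) : 0 <= rnorm u.
Proof. by have := normr_ge0 u; rewrite normE lecR. Qed.

Lemma rnorm0 : rnorm (0 : H) = 0.
Proof. by rewrite /rnorm normr0. Qed.

Lemma rnorm_eq0 (u : H) : rnorm u = 0 -> u = 0.
Proof. by move=> h; apply/eqP; rewrite -normr_eq0 normE h. Qed.

Lemma rnormD (u v : H) : rnorm (u + v) <= rnorm u + rnorm v.
Proof. by have := ler_normD u v; rewrite !normE -rmorphD lecR. Qed.

Lemma rnormN (u : H) : rnorm (- u) = rnorm u.
Proof. by rewrite /rnorm normrN. Qed.

Lemma rnormB (u v : H) : rnorm (u - v) <= rnorm u + rnorm v.
Proof. by rewrite -(rnormN v) rnormD. Qed.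

Lemma rnorm_distC (u v : H) : rnorm (u - v) = rnorm (v - u).
Proof. by rewrite -rnormN opprB. Qed.

Lemma rnormZ (r : R) (u : H) : rnorm (r%:C *: u) = `|r| * rnorm u.
Proof.
rewrite /rnorm normrZ normc_def /= expr0n /= addr0 sqrtr_sqr normE /=.
by rewrite mul0r subr0.
Qed.

Lemma rnorm_iM (u : H) : rnorm ('i *: u) = rnorm u.
Proof.
by rewrite /rnorm normrZ normc_def /= expr0n expr1n /= add0r sqrtr1 mul1r.
Qed.

Lemma ip_ge0 u : 0 <= ip u u.
Proof. by rewrite ip_sqr sqr_ge0. Qed.

Lemma ip_eq0 u : ip u u = 0 -> u = 0.
Proof. by rewrite ip_sqr => /eqP; rewrite sqrf_eq0 => /eqP/rnorm_eq0. Qed.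

(** Equalities of vectors that are consequences of ring axioms are proved by
testing them against all vectors, which turns them into equations in [R]. *)
Lemma ip_inj u v : (forall w, ip u w = ip v w) -> u = v.
Proof.
by move=> h; apply/eqP; rewrite -subr_eq0; apply/eqP/ip_eq0; rewrite ipBl h subrr.
Qed.

Lemma rnorm_le u v : ip u u <= ip v v -> rnorm u <= rnorm v.
Proof. by rewrite !ip_sqr ler_pXn2r // ?nnegrE ?rnorm_ge0. Qed.

Lemma rnorm_sub u v : rnorm (u - v) ^+ 2 = rnorm u ^+ 2 - 2 * ip u v + rnorm v ^+ 2.
Proof. by rewrite -!ip_sqr !ipE [ip v u]ipC; ring. Qed.

Lemma CauchySchwarz_ip u v : ip u v <= rnorm u * rnorm v.
Proof.
have [/eqP v0|v0] := boolP (rnorm v == 0).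
  by rewrite (rnorm_eq0 v0) ip0r rnorm0 mulr0.
have vp : 0 < rnorm v by rewrite lt_def v0 rnorm_ge0.
have := ip_ge0 ((rnorm v ^+ 2)%:C *: u - (ip u v)%:C *: v).
rewrite !ipE [ip v u]ipC !ip_sqr => h.
have {}h : ip u v ^+ 2 <= (rnorm u * rnorm v) ^+ 2.
  rewrite -(ler_pM2r (exprn_gt0 2 vp)); lra.
have [p|p] := leP 0 (ip u v).
  by move: h; rewrite ler_pXn2r // nnegrE ?mulr_ge0 ?rnorm_ge0.
by rewrite (le_trans (ltW p)) // mulr_ge0 ?rnorm_ge0.
Qed.

Lemma CauchySchwarz_abs u v : `|ip u v| <= rnorm u * rnorm v.
Proof.
rewrite ler_norml CauchySchwarz_ip andbT lerNl -ipNl.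
by rewrite (le_trans (CauchySchwarz_ip _ _)) // rnormN.
Qed.

Lemma nbhs_rnorm (x : H) (S : set H) :
  nbhs x S <-> exists2 e : R, 0 < e & forall y, rnorm (y - x) < e -> S y.
Proof.
split.
  move=> /nbhs_normP[e /= e0 eS].
  exists (complex.Re e).
    by move: e0; rewrite ltcE => /andP[_].
  move=> y hy; apply: eS; rewrite /= distrC normE.
  by move: e0; rewrite !ltcE /= => /andP[/eqP -> _]; rewrite eqxx.
move=> [e e0 eS]; apply/nbhs_normP; exists e%:C; first by rewrite /= ltcR.
by move=> y /=; rewrite distrC normE ltcR => /eS.
Qed.

Lemma closure_rnorm (S : set H) x :
  closure S x <-> forall e : R, 0 < e -> exists2 y, S y & rnorm (y - x) < e.
Proof.
split=> [h e e0|h B /nbhs_rnorm[e e0 eB]].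
  have /h[y [Sy yB]] : nbhs x [set y | rnorm (y - x) < e].
    by apply/nbhs_rnorm; exists e.
  by exists y.
by have [y Sy /eB] := h _ e0; exists y.
Qed.

Definition seq_lim (u : nat -> H) (l : H) :=
  forall e : R, 0 < e -> exists N, forall n, (N <= n)%N -> rnorm (u n - l) < e.

Lemma rnorm_complete (u : nat -> H) :
  (forall e : R, 0 < e -> exists N, forall m n, (N <= m)%N -> (N <= n)%N ->
     rnorm (u m - u n) < e) -> exists l, seq_lim u l.
Proof.
move=> h.
have /cauchy_cvg/cvg_ex[l hl] : cauchy (u @ \oo).
  apply/cauchyP => e e0.
  have e0' : 0 < complex.Re e by move: e0; rewrite ltcE => /andP[_].
  have [N hN] := h _ e0'; exists (u N), N => // n /= Nn.
  rewrite -ball_normE /= normE.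
  by move: e0; rewrite !ltcE /= => /andP[/eqP -> _]; rewrite eqxx hN.
exists l => e e0.
have /hl[N _ hN] : nbhs l [set y | rnorm (y - l) < e].
  by apply/nbhs_rnorm; exists e.
by exists N => n /hN.
Qed.

(** * Bounded operators *)

Section linear_maps.
Variables (T : H -> H).
Hypothesis linT : linear T.

Lemma linD u v : T (u + v) = T u + T v.
Proof. by have := linT 1 u v; rewrite !scale1r. Qed.

Lemma lin0 : T 0 = 0.
Proof. by have := linD 0 0; rewrite addr0 => /eqP; rewrite -subr_eq subrr => /eqP. Qed.

Lemma linZ a u : T (a *: u) = a *: T u.
Proof. by have := linT a u 0; rewrite lin0 !addr0. Qed.

Lemma linN u : T (- u) = - T u.
Proof. by rewrite -scaleN1r linZ scaleN1r. Qed.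

Lemma linB u v : T (u - v) = T u - T v.
Proof. by rewrite linD linN. Qed.

End linear_maps.

Lemma linear_sub (S T : H -> H) : linear S -> linear T -> linear (op_sub S T).
Proof.
move=> lS lT a u v; rewrite /op_sub (linD lS) (linD lT) (linZ lS) (linZ lT).
by rewrite scalerBr opprD addrACA.
Qed.

Lemma linear_add (S T : H -> H) : linear S -> linear T ->
  linear (fun u => S u + T u).
Proof.
move=> lS lT a u v; rewrite (linD lS) (linD lT) (linZ lS) (linZ lT).
by rewrite scalerDr addrACA.
Qed.

Lemma linear_scale (r : R) (T : H -> H) : linear T ->
  linear (fun u => r%:C *: T u).
Proof.
by move=> lT a u v; rewrite (linD lT) (linZ lT) scalerDr !scalerA mulrC.
Qed.

Lemma linear_comp (S T : H -> H) : linear S -> linear T -> linear (S \o T).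
Proof.
by move=> lS lT a u v /=; rewrite (linD lT) (linZ lT) (linD lS) (linZ lS).
Qed.

Lemma linear_id : linear (@id H).
Proof. by []. Qed.

Lemma linear_zero : linear (fun _ : H => 0 : H).
Proof. by move=> a u v; rewrite scaler0 addr0. Qed.

(** The operator norm is compared with real numbers through this
inequality, which avoids extended reals. *)
Definition bnd (T : H -> H) (M : R) := forall u, rnorm (T u) <= M * rnorm u.

Definition bounded_linear (T : H -> H) := linear T /\ exists2 M, 0 <= M & bnd T M.

Lemma bnd_le T M N : M <= N -> bnd T M -> bnd T N.
Proof.
by move=> MN h u; rewrite (le_trans (h u)) // ler_wpM2r // rnorm_ge0.
Qed.

Lemma bnd_add S T M N : bnd S M -> bnd T N -> bnd (fun u => S u + T u) (M + N).
Proof.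
by move=> hS hT u; rewrite mulrDl (le_trans (rnormD _ _)) // lerD.
Qed.

Lemma bnd_sub S T M N : bnd S M -> bnd T N -> bnd (op_sub S T) (M + N).
Proof.
by move=> hS hT u; rewrite mulrDl (le_trans (rnormB _ _)) // lerD.
Qed.

Lemma bnd_comp S T M N : 0 <= M -> bnd S M -> bnd T N -> bnd (S \o T) (M * N).
Proof.
move=> M0 hS hT u; rewrite (le_trans (hS _)) // -mulrA ler_wpM2l //.
Qed.

Lemma bnd_scale r T M : bnd T M -> bnd (fun u => r%:C *: T u) (`|r| * M).
Proof. by move=> hT u; rewrite rnormZ -mulrA ler_wpM2l. Qed.

Lemma bnd_opnorm (T : H -> H) M : 0 <= M -> bnd T M -> (opnorm T <= M%:E)%E.
Proof.
move=> M0 h; apply: ge_ereal_sup => _ /= [u u1 <-].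
rewrite lee_fin (le_trans (h u)) // -[leRHS]mulr1 ler_wpM2l //.
Qed.

Lemma opnorm_bnd (T : H -> H) M : linear T -> (opnorm T <= M%:E)%E -> bnd T M.
Proof.
move=> lT h u.
have [/eqP u0|u0] := boolP (rnorm u == 0).
  by rewrite (rnorm_eq0 u0) (lin0 lT) rnorm0 mulr0.
have up : 0 < rnorm u by rewrite lt_def u0 rnorm_ge0.
have : ((rnorm (T ((rnorm u)^-1%:C *: u)))%:E <= M%:E)%E.
  apply: le_trans h; apply: ereal_sup_ubound; exists ((rnorm u)^-1%:C *: u) => //=.
  by rewrite rnormZ ger0_norm ?invr_ge0 ?rnorm_ge0 // mulVf.
rewrite lee_fin (linZ lT) rnormZ ger0_norm ?invr_ge0 ?rnorm_ge0 //.
by rewrite mulrC ler_pdivrMr.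
Qed.

Lemma opnorm_ge0 (T : H -> H) : linear T -> (0 <= opnorm T)%E.
Proof.
move=> lT; apply: ereal_sup_ubound; exists 0; first by rewrite /= rnorm0.
by rewrite (lin0 lT) rnorm0.
Qed.

Lemma bounded_opP (T : H -> H) : bounded_op T <-> bounded_linear T.
Proof.
split=> [[lT hT]|[lT [M M0 h]]]; last first.
  by split=> //; rewrite (le_lt_trans (bnd_opnorm M0 h)) // ltry.
split=> //; have h0 := opnorm_ge0 lT.
have hf : opnorm T \is a fin_num by rewrite ge0_fin_numE.
exists (fine (opnorm T)); first exact: fine_ge0.
by apply: opnorm_bnd => //; rewrite fineK.
Qed.

Lemma bounded_linear_id : bounded_linear id.
Proof. by split=> //; exists 1 => // u; rewrite mul1r. Qed.

Lemma bounded_linear_add S T : bounded_linear S -> bounded_linear T ->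
  bounded_linear (fun u => S u + T u).
Proof.
move=> [lS [M M0 hM]] [lT [N N0 hN]]; split; first exact: linear_add.
by exists (M + N); [exact: addr_ge0|exact: bnd_add].
Qed.

Lemma bounded_linear_sub S T : bounded_linear S -> bounded_linear T ->
  bounded_linear (op_sub S T).
Proof.
move=> [lS [M M0 hM]] [lT [N N0 hN]]; split; first exact: linear_sub.
by exists (M + N); [exact: addr_ge0|exact: bnd_sub].
Qed.

Lemma bounded_linear_comp S T : bounded_linear S -> bounded_linear T ->
  bounded_linear (S \o T).
Proof.
move=> [lS [M M0 hM]] [lT [N N0 hN]]; split; first exact: linear_comp.
by exists (M * N); [exact: mulr_ge0|exact: bnd_comp].
Qed.

Lemma bounded_linear_scale r T : bounded_linear T ->
  bounded_linear (fun u => r%:C *: T u).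
Proof.
move=> [lT [M M0 hM]]; split; first exact: linear_scale.
by exists (`|r| * M); [exact: mulr_ge0|exact: bnd_scale].
Qed.

Definition selfadj (T : H -> H) := forall u v, ip (T u) v = ip u (T v).

Lemma selfadj_formP T : linear T ->
  (selfadj T <-> forall u v, form (T u) v = form u (T v)).
Proof.
move=> lT; split=> h u v; last by rewrite /ip h.
by rewrite !form_ipE h -(linZ lT) h.
Qed.

Lemma selfadjoint_boundedP T :
  selfadjoint_bounded form T <-> bounded_linear T /\ selfadj T.
Proof.
split=> [[/bounded_opP b h]|[b h]].
  by split=> //; apply/selfadj_formP => //; case: b.
by split; [exact/bounded_opP|apply/selfadj_formP => //; case: b].
Qed.

Lemma selfadj_form_real T u : linear T -> selfadj T -> form (T u) u = (ip (T u) u)%:C.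
Proof.
move=> lT sT; rewrite form_ipE; congr Complex.
have := sT u ('i *: u); rewrite (linZ lT) => h.
have : ip (T u) ('i *: u) = - ip ('i *: T u) u.
  rewrite -[ip ('i *: T u) u]ip_iM scalerA -expr2 sqr_i scaleN1r ipNl opprK.
  done.
by rewrite [ip ('i *: T u) u]ipC; lra.
Qed.

Lemma op_leP S T : linear S -> selfadj S -> linear T -> selfadj T ->
  op_le form S T <-> forall u, ip (S u) u <= ip (T u) u.
Proof.
move=> lS sS lT sT; split=> h u; have := h u.
  by rewrite !selfadj_form_real // lecR.
by rewrite !selfadj_form_real // lecR.
Qed.

Lemma projectionP P : projection form P <->
  [/\ bounded_linear P, selfadj P & forall u, P (P u) = P u].
Proof.
split=> [[/selfadjoint_boundedP[b s] h]|[b s h]].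
  by split=> // u; have := congr1 (fun f => f u) h.
by split; [exact/selfadjoint_boundedP|apply/funext => u /=].
Qed.

(** Compactness of [T] in the form of total boundedness: the unit ball is cut
into finitely many classes, those of [f], on which [T] varies by less than [e].
Unlike the closure of an image, this is stable under algebraic operations by a
direct argument. *)
Definition totally_bounded_op (T : H -> H) := forall e : R, 0 < e ->
  exists (I : finType) (f : H -> I), forall u v, rnorm u <= 1 -> rnorm v <= 1 ->
    f u = f v -> rnorm (T u - T v) < e.

Lemma compact_totally_bounded (T : H -> H) :
  compact (closure (T @` [set u | rnorm u <= 1])) -> totally_bounded_op T.
Proof.
move=> + e e0; rewrite compact_cover.
move=> /(_ H setT (fun c => [set y | rnorm (y - c) < e / 2])) [].
- move=> c _; rewrite openE => y /= yc; apply/nbhs_rnorm.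
  exists (e / 2 - rnorm (y - c)); first by rewrite subr_gt0.
  move=> z hz; have := rnormD (z - y) (y - c).
  by rewrite addrA subrK => /le_lt_trans; apply; lra.
- move=> y /closure_rnorm /(_ (e / 2)) []; first lra.
  by move=> c _ hc; exists c => //=; rewrite rnorm_distC.
move=> D _ hD.
pose s : seq H := finmap.enum_fset D.
pose f u := find (fun c => rnorm (T u - c) < e / 2) s.
have fP u : rnorm u <= 1 -> rnorm (T u - nth 0 s (f u)) < e / 2.
  move=> u1; apply: (nth_find 0 (a := fun c => rnorm (T u - c) < e / 2)).
  have [|c Dc /= hc] := hD (T u); first by apply: subset_closure; exists u.
  by apply/hasP; exists c.
have fs u : (f u < (size s).+1)%N by rewrite ltnS find_size.
exists 'I_(size s).+1, (fun u => Ordinal (fs u)).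
move=> u v u1 v1 [fuv]; have := fP _ u1; have := fP _ v1; rewrite -fuv => h1 h2.
have := rnormB (T u - nth 0 s (f u)) (T v - nth 0 s (f u)).
by rewrite opprB addrA subrK => /le_lt_trans; apply; lra.
Qed.

Lemma ultra_bigcup (I : finType) (F : set_system H) (B : I -> set H) :
  UltraFilter F -> F (\bigcup_i B i) -> exists i, F (B i).
Proof.
move=> uF; suff : forall s : seq I, F (\bigcup_(i in [set` s]) B i) ->
    exists i, F (B i).
  move=> h hF; apply: (h (enum I)); apply: filterS hF => x [i _ Bi].
  by exists i => //=; rewrite mem_enum.
elim=> [|i s IH].
  by rewrite set_nil bigcup_set0 => /filter_not_empty.
move=> hF; have [|hB] := in_ultra_setVsetC (B i) uF; first by exists i.
apply: IH; apply: filterS (filterI hF hB) => x [[j /= js Bj] nB].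
exists j => //=; move: js; rewrite inE => /orP[/eqP ji|//].
by rewrite ji in Bj.
Qed.

(** By completeness: an ultrafilter on the closure of the image contains,
for each [e], the neighbourhood of one of the finitely many pieces of the
image, hence is a Cauchy filter. *)
Lemma totally_bounded_compact (T : H -> H) :
  totally_bounded_op T -> compact (closure (T @` [set u | rnorm u <= 1])).
Proof.
move=> tT; rewrite compact_ultra => F uF hF.
have /cauchy_cvg cF : cauchy F.
  apply: cauchy_exP => e e0.
  have e0' : 0 < complex.Re e by move: e0; rewrite ltcE => /andP[_].
  have [|I [f hf]] := tT (complex.Re e / 2); first lra.
  pose B i := [set y | exists u, [/\ rnorm u <= 1, f u = i & rnorm (y - T u) < complex.Re e / 2]].
  have [|i hi] := @ultra_bigcup I F B uF.
    apply: filterS hF => y /closure_rnorm /(_ (complex.Re e / 2)) [].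
      lra.
    move=> _ [u u1 <-] hu; exists (f u) => //; exists u; split=> //.
    by rewrite rnorm_distC.
  have [y [u [u1 fu _]]] := filter_ex hi.
  exists (T u); apply: filterS hi => z [v [v1 fv hv]].
  rewrite -ball_normE /= normE; move: e0; rewrite !ltcE /= => /andP[/eqP -> _].
  rewrite eqxx /=; have := hf u v u1 v1; rewrite fu fv => /(_ erefl) h.
  have := rnormB (T u - T v) (z - T v).
  by rewrite opprB addrA subrK => /le_lt_trans; apply; lra.
exists (lim F); split=> //.
apply: closed_closure => B hB.
have FB : F B by move: (cF : F `=>` nbhs (lim F)) => /(_ B hB).
exact: filter_ex (filterI hF FB).
Qed.

Lemma compact_opP (T : H -> H) : compact_op T <-> bounded_linear T /\ totally_bounded_op T.
Proof.
split=> [[/bounded_opP b /compact_totally_bounded t]|[b t]] //.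
by split; [exact/bounded_opP|exact: totally_bounded_compact].
Qed.

(** A domination principle: [S] is totally bounded when its oscillation is
controlled by those of [T1] and [T2]. *)
Lemma totally_bounded_dom2 (T1 T2 S : H -> H) :
  totally_bounded_op T1 -> totally_bounded_op T2 ->
  (forall e : R, 0 < e -> exists2 d : R, 0 < d & forall u v,
     rnorm u <= 1 -> rnorm v <= 1 ->
     rnorm (T1 u - T1 v) < d -> rnorm (T2 u - T2 v) < d ->
     rnorm (S u - S v) < e) ->
  totally_bounded_op S.
Proof.
move=> t1 t2 h e /h[d d0 hd].
have [I [f hf]] := t1 _ d0; have [J [g hg]] := t2 _ d0.
exists (I * J)%type, (fun u => (f u, g u)) => u v u1 v1 [fuv guv].
by apply: hd => //; [exact: hf|exact: hg].
Qed.

Lemma totally_bounded_dom (T S : H -> H) : totally_bounded_op T ->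
  (forall e : R, 0 < e -> exists2 d : R, 0 < d & forall u v,
     rnorm u <= 1 -> rnorm v <= 1 ->
     rnorm (T u - T v) < d -> rnorm (S u - S v) < e) ->
  totally_bounded_op S.
Proof.
move=> t h; apply: (totally_bounded_dom2 t t) => e /h[d d0 hd].
by exists d => // u v u1 v1 hu _; exact: hd.
Qed.

Lemma totally_bounded_le (T S : H -> H) M : linear T -> linear S ->
  (forall u, rnorm (S u) <= M * rnorm (T u)) ->
  totally_bounded_op T -> totally_bounded_op S.
Proof.
move=> lT lS h t; apply: (totally_bounded_dom t) => e e0.
have M1 : 0 < `|M| + 1 by have := normr_ge0 M; lra.
exists (e / (`|M| + 1)); first exact: divr_gt0.
move=> u v _ _; rewrite ltr_pdivlMr // => huv.
rewrite -(linB lS); apply: le_lt_trans (h _) (le_lt_trans _ huv).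
by rewrite (linB lT) mulrC ler_wpM2l ?rnorm_ge0 // (le_trans (ler_norm M)) // lerDl.
Qed.

Lemma totally_bounded_add (T1 T2 : H -> H) :
  totally_bounded_op T1 -> totally_bounded_op T2 ->
  totally_bounded_op (fun u => T1 u + T2 u).
Proof.
move=> t1 t2; apply: (totally_bounded_dom2 t1 t2) => e e0.
exists (e / 2); first lra.
move=> u v _ _ h1 h2; rewrite opprD addrACA.
by apply: le_lt_trans (rnormD _ _) _; lra.
Qed.

Lemma totally_bounded_sub (T1 T2 : H -> H) :
  totally_bounded_op T1 -> totally_bounded_op T2 ->
  totally_bounded_op (op_sub T1 T2).
Proof.
move=> t1 t2; apply: (totally_bounded_dom2 t1 t2) => e e0.
exists (e / 2); first lra.
move=> u v _ _ h1 h2; rewrite /op_sub.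
rewrite (_ : _ - _ = (T1 u - T1 v) - (T2 u - T2 v)).
  by apply: le_lt_trans (rnormB _ _) _; lra.
by apply: ip_inj => w; rewrite !ipE; ring.
Qed.

Lemma totally_bounded_compl (S T : H -> H) : bounded_linear S ->
  totally_bounded_op T -> totally_bounded_op (S \o T).
Proof.
move=> [lS [M M0 hS]] t; apply: (totally_bounded_dom t) => e e0.
have M1 : 0 < M + 1 by lra.
exists (e / (M + 1)); first exact: divr_gt0.
move=> u v _ _; rewrite ltr_pdivlMr // => huv.
rewrite /= -(linB lS); apply: le_lt_trans (hS _) (le_lt_trans _ huv).
by rewrite mulrC ler_wpM2l ?rnorm_ge0 //; lra.
Qed.

Lemma totally_bounded_scale r (T : H -> H) : totally_bounded_op T ->
  totally_bounded_op (fun u => r%:C *: T u).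
Proof.
move=> t; apply: (totally_bounded_compl _ t).
exact: (bounded_linear_scale r bounded_linear_id).
Qed.

Lemma totally_bounded_compr (S T : H -> H) : linear S -> bounded_linear T ->
  totally_bounded_op S -> totally_bounded_op (S \o T).
Proof.
move=> lS [lT [M M0 hT]] t e e0; have M1 : 0 < M + 1 by lra.
have [I [f hf]] := t _ (divr_gt0 e0 M1).
exists I, (fun u => f ((M + 1)^-1%:C *: T u)) => u v u1 v1 /hf.
have hM w : rnorm w <= 1 -> rnorm ((M + 1)^-1%:C *: T w) <= 1.
  move=> w1; rewrite rnormZ ger0_norm ?invr_ge0 ?(ltW M1) // mulrC.
  rewrite ler_pdivrMr // mul1r.
  apply: le_trans (hT _) _; apply: le_trans (_ : M * 1 <= _); last by lra.
  exact: ler_wpM2l.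
move=> /(_ (hM _ u1) (hM _ v1)); rewrite !(linZ lS) -scalerBr rnormZ.
by rewrite ger0_norm ?invr_ge0 ?(ltW M1) // mulrC ltr_pM2r ?invr_gt0.
Qed.

Lemma totally_bounded_lim (T : nat -> H -> H) (S : H -> H) :
  (forall e : R, 0 < e -> exists n, bnd (op_sub S (T n)) e) ->
  (forall n, totally_bounded_op (T n)) -> totally_bounded_op S.
Proof.
move=> h t e e0; have [|n hn] := h (e / 4); first lra.
have [|I [f hf]] := t n (e / 2); first lra.
exists I, f => u v u1 v1 /(hf _ _ u1 v1) huv.
have h' w : rnorm w <= 1 -> rnorm (S w - T n w) <= e / 4.
  move=> w1; apply: le_trans (hn _) _; rewrite -[leRHS]mulr1.
  by rewrite ler_wpM2l //; lra.
rewrite (_ : S u - S v = (S u - T n u) - (S v - T n v) + (T n u - T n v)); last first.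
  by apply: ip_inj => w; rewrite !ipE; ring.
apply: le_lt_trans (rnormD _ _) _.
have := rnormB (S u - T n u) (S v - T n v); have := h' _ u1; have := h' _ v1; lra.
Qed.

(** * Norm convergence of operators *)

Section op_convergence.
Context {Y : Type} (F : set_system Y) {FF : Filter F}.

Definition op_cvg (T : Y -> H -> H) (T0 : H -> H) := forall e : R, 0 < e ->
  \forall z \near F, bnd (op_sub (T z) T0) e.

Lemma op_cvg_cst T0 : op_cvg (fun _ => T0) T0.
Proof.
move=> e e0; apply: filterE => z u; rewrite /op_sub subrr rnorm0.
by rewrite mulr_ge0 ?rnorm_ge0 // ltW.
Qed.

Lemma op_cvg_near T S T0 : (\forall z \near F, T z = S z) ->
  op_cvg T T0 -> op_cvg S T0.
Proof.
by move=> h + e e0 => /(_ e e0); apply: filterS2 h => z <-.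
Qed.

Lemma op_cvg_add S T S0 T0 : op_cvg S S0 -> op_cvg T T0 ->
  op_cvg (fun z u => S z u + T z u) (fun u => S0 u + T0 u).
Proof.
move=> hS hT e e0; have e2 : 0 < e / 2 by lra.
apply: filterS2 (hS _ e2) (hT _ e2) => z h1 h2 u.
rewrite /op_sub opprD addrACA (le_trans (rnormD _ _)) //.
have := h1 u; have := h2 u; rewrite /op_sub; lra.
Qed.

Lemma op_cvg_scale (a : Y -> R) T (a0 : R) T0 : bounded_linear T0 -> a z @[z --> F] --> a0 ->
  op_cvg T T0 ->
  op_cvg (fun z u => (a z)%:C *: T z u) (fun u => a0%:C *: T0 u).
Proof.
move=> [lT [M M0 hM]] ha hT e e0.
pose A := `|a0| + 1; have A0 : 0 < A by have := normr_ge0 a0; rewrite /A; lra.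
have M1 : 0 < M + 1 by lra.
have e1 : 0 < e / 2 / A by rewrite !divr_gt0.
have e2 : 0 < Num.min 1 (e / 2 / (M + 1)) by rewrite lt_min ltr01 !divr_gt0.
have /cvgrPdist_lt ha' := ha.
apply: filterS2 (hT _ e1) (ha' _ e2) => z h1.
rewrite lt_min => /andP[h2 h3] u; rewrite /op_sub.
rewrite (_ : _ - _ = (a z)%:C *: op_sub (T z) T0 u + (a z - a0)%:C *: T0 u); last first.
  by apply: ip_inj => w; rewrite /op_sub !ipE; ring.
apply: le_trans (rnormD _ _) _; rewrite !rnormZ.
have haz : `|a z| <= A.
  by have := ler_normD a0 (a z - a0); rewrite subrKC distrC /A; lra.
have k1 : `|a z| * rnorm (op_sub (T z) T0 u) <= e / 2 * rnorm u.
  have -> : e / 2 * rnorm u = A * (e / 2 / A * rnorm u) by field; lra.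
  by apply: ler_pM => //; rewrite rnorm_ge0.
have k2 : `|a z - a0| * rnorm (T0 u) <= e / 2 * rnorm u.
  have -> : e / 2 * rnorm u = (e / 2 / (M + 1)) * ((M + 1) * rnorm u) by field; lra.
  apply: ler_pM => //; first exact: rnorm_ge0.
    by rewrite distrC ltW.
  by apply: le_trans (hM u) _; rewrite ler_wpM2r ?rnorm_ge0 //; lra.
lra.
Qed.

Lemma op_cvg_scale_cst (r : R) T T0 : bounded_linear T0 -> op_cvg T T0 ->
  op_cvg (fun z u => r%:C *: T z u) (fun u => r%:C *: T0 u).
Proof. by move=> b; apply: op_cvg_scale => //; exact: cvg_cst. Qed.

Lemma op_cvg_sub S T S0 T0 : op_cvg S S0 -> op_cvg T T0 ->
  op_cvg (fun z => op_sub (S z) (T z)) (op_sub S0 T0).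
Proof.
move=> hS hT e e0; have e2 : 0 < e / 2 by lra.
apply: filterS2 (hS _ e2) (hT _ e2) => z h1 h2 u.
rewrite /op_sub (_ : _ - _ = (S z u - S0 u) - (T z u - T0 u)); last first.
  by apply: ip_inj => w; rewrite !ipE; ring.
rewrite (le_trans (rnormB _ _)) //.
have := h1 u; have := h2 u; rewrite /op_sub; lra.
Qed.

Lemma op_cvg_comp S T S0 T0 : bounded_linear S0 -> bounded_linear T0 ->
  op_cvg S S0 -> op_cvg T T0 ->
  op_cvg (fun z => S z \o T z) (S0 \o T0).
Proof.
move=> [lS [M M0 hM]] [lT [N N0 hN]] hS hT e e0.
have M1 : 0 < M + 1 by lra.
have N1 : 0 < N + 1 by lra.
have e1 : 0 < e / 2 / (N + 1) by rewrite !divr_gt0.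
have e2 : 0 < Num.min 1 (e / 2 / (M + 1)) by rewrite lt_min ltr01 !divr_gt0.
apply: filterS2 (hS _ e1) (hT _ e2) => z h1 h2 u.
rewrite /op_sub /= (_ : _ - _ = (S z (T z u) - S0 (T z u)) + S0 (T z u - T0 u)); last first.
  by rewrite (linB lS) addrA subrK.
apply: le_trans (rnormD _ _) _.
have hTu : rnorm (T z u) <= (N + 1) * rnorm u.
  have := rnormD (T0 u) (T z u - T0 u); rewrite subrKC => /le_trans; apply.
  rewrite mulrDl lerD // (le_trans (h2 u)) // ler_wpM2r ?rnorm_ge0 //.
  by rewrite ge_min lexx.
have k1 : rnorm (S z (T z u) - S0 (T z u)) <= e / 2 * rnorm u.
  apply: le_trans (h1 _) _.
  have -> : e / 2 * rnorm u = (e / 2 / (N + 1)) * ((N + 1) * rnorm u) by field; lra.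
  by rewrite ler_wpM2l // ltW.
have k2 : rnorm (S0 (T z u - T0 u)) <= e / 2 * rnorm u.
  apply: le_trans (hM _) _.
  have -> : e / 2 * rnorm u = (M + 1) * (e / 2 / (M + 1) * rnorm u) by field; lra.
  apply: ler_pM => //; [exact: rnorm_ge0|lra|].
  apply: le_trans (h2 _) _; rewrite ler_wpM2r ?rnorm_ge0 //.
  by rewrite ge_min lexx orbT.
lra.
Qed.

Lemma op_cvg_unif (T : nat -> Y -> H -> H) (T0 : nat -> H -> H) S S0 :
  (forall n, op_cvg (T n) (T0 n)) ->
  (forall e : R, 0 < e -> exists n, (\forall z \near F, bnd (op_sub (S z) (T n z)) e) /\
     bnd (op_sub S0 (T0 n)) e) ->
  op_cvg S S0.
Proof.
move=> hT h e e0; have e3 : 0 < e / 3 by lra.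
have [n [h1 h2]] := h _ e3; apply: filterS2 h1 (hT n _ e3) => z k1 k2 u.
rewrite /op_sub.
rewrite (_ : _ - _ = (S z u - T n z u) + (T n z u - T0 n u) - (S0 u - T0 n u)); last first.
  by apply: ip_inj => w; rewrite !ipE; ring.
apply: le_trans (rnormB _ _) _.
have := rnormD (S z u - T n z u) (T n z u - T0 n u).
have := k1 u; have := k2 u; have := h2 u; rewrite /op_sub; lra.
Qed.

End op_convergence.

Lemma norm_continuousP (Y : topologicalType) (D : set Y) (T : Y -> H -> H) :
  (forall y, D y -> linear (T y)) ->
  Defs.norm_continuous D T <->
  (forall y, D y -> op_cvg (within D (nbhs y)) T (T y)).
Proof.
move=> lT; split=> h y Dy e e0.
  have /= := h y Dy e e0; rewrite !near_withinE; apply: filterS => z hz Dz.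
  apply: opnorm_bnd; last exact/ltW/hz.
  by apply: linear_sub; exact: lT.
have e2 : 0 < e / 2 by lra.
have := h y Dy _ e2; apply: filterS => z hz.
apply: le_lt_trans (bnd_opnorm (ltW e2) hz) _.
by rewrite lte_fin; lra.
Qed.

Lemma rnorm_small (u : H) : (forall e : R, 0 < e -> rnorm u <= e) -> u = 0.
Proof.
move=> h; apply: rnorm_eq0; apply/eqP; rewrite eq_le rnorm_ge0 andbT.
by apply/ler_addgt0Pr => e e0; rewrite add0r h.
Qed.

Lemma seq_lim_unique (u : nat -> H) (l m : H) : seq_lim u l -> seq_lim u m -> l = m.
Proof.
move=> hl hm; apply/eqP; rewrite -subr_eq0; apply/eqP/rnorm_small => e e0.
have [|N hN] := hl (e / 2); first lra.
have [|M hM] := hm (e / 2); first lra.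
have := hN _ (leq_maxl N M); have := hM _ (leq_maxr N M).
set k := maxn N M => h1 h2; have := rnormB (u k - m) (u k - l).
rewrite (_ : u k - m - (u k - l) = l - m); last by apply: ip_inj => w; rewrite !ipE; ring.
by lra.
Qed.

Lemma seq_lim_map (S : H -> H) (u : nat -> H) (l : H) : bounded_linear S ->
  seq_lim u l -> seq_lim (fun n => S (u n)) (S l).
Proof.
move=> [lS [M M0 hM]] h e e0; have M1 : 0 < M + 1 by lra.
have [N hN] := h _ (divr_gt0 e0 M1); exists N => n /hN.
rewrite ltr_pdivlMr // -(linB lS) => /(le_lt_trans _); apply.
apply: le_trans (hM _) _; rewrite mulrC ler_wpM2l ?rnorm_ge0 //; lra.
Qed.

Lemma seq_lim_ip (u v : nat -> H) (l m a b : H) : seq_lim u l -> seq_lim v m ->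
  (forall n, ip (u n) a = ip b (v n)) -> ip l a = ip b m.
Proof.
move=> hl hm h; apply/eqP; rewrite -subr_eq0 -normr_eq0 eq_le normr_ge0 andbT.
apply/ler_addgt0Pr => e e0; rewrite add0r.
have A1 : 0 < rnorm a + 1 by have := rnorm_ge0 a; lra.
have B1 : 0 < rnorm b + 1 by have := rnorm_ge0 b; lra.
have [|N hN] := hl (e / 2 / (rnorm a + 1)); first by rewrite !divr_gt0.
have [|M hM] := hm (e / 2 / (rnorm b + 1)); first by rewrite !divr_gt0.
have := hN _ (leq_maxl N M); have := hM _ (leq_maxr N M).
set k := maxn N M; rewrite !ltr_pdivlMr // => h1 h2.
rewrite (_ : _ - _ = ip b (v k - m) - ip (u k - l) a); last first.
  by rewrite !ipE h; ring.
apply: le_trans (ler_normB _ _) _.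
have := CauchySchwarz_abs b (v k - m); have := CauchySchwarz_abs (u k - l) a.
have := rnorm_ge0 (u k - l); have := rnorm_ge0 (v k - m).
have : rnorm b * rnorm (v k - m) <= rnorm (v k - m) * (rnorm b + 1).
  by rewrite mulrC ler_wpM2l ?rnorm_ge0 //; lra.
have : rnorm (u k - l) * rnorm a <= rnorm (u k - l) * (rnorm a + 1).
  by rewrite ler_wpM2l ?rnorm_ge0 //; lra.
lra.
Qed.

Definition op_lim (T : nat -> H -> H) (u : H) : H :=
  xget 0 [set l | seq_lim (fun n => T n u) l].

Section op_lim_theory.
Variables (T : nat -> H -> H) (r : nat -> R).
Hypothesis bT : forall n, bounded_linear (T n).
Hypothesis cT : forall m n, (n <= m)%N -> bnd (op_sub (T m) (T n)) (r n).
Hypothesis r0 : forall e : R, 0 < e -> exists N, forall n, (N <= n)%N -> r n < e.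

Lemma op_limP u : seq_lim (fun n => T n u) (op_lim T u).
Proof.
rewrite /op_lim; case: xgetP => // no.
have [l hl] : exists l, seq_lim (fun n => T n u) l; last by case: (no l).
apply: rnorm_complete => e e0.
have U1 : 0 < rnorm u + 1 by have := rnorm_ge0 u; lra.
have [N hN] := r0 (divr_gt0 e0 U1); exists N.
have h m n : (N <= n)%N -> (n <= m)%N -> rnorm (T m u - T n u) < e.
  move=> Nn nm; apply: le_lt_trans (cT nm u) _.
  have := hN _ Nn; rewrite ltr_pdivlMr // => hr.
  have [rp|rn] := leP 0 (r n).
    by apply: le_lt_trans hr; rewrite ler_wpM2l //; lra.
  by apply: le_lt_trans e0; rewrite nmulr_rle0 // rnorm_ge0.
move=> m n Nm Nn; case: (leqP n m) => [nm|/ltnW mn]; first exact: h.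
by rewrite rnorm_distC h.
Qed.

Lemma op_lim_bnd n : bnd (op_sub (op_lim T) (T n)) (r n).
Proof.
move=> u; apply/ler_addgt0Pr => e e0.
have [N hN] := op_limP u e0; rewrite /op_sub.
have := hN _ (leq_maxl N n); have := cT (leq_maxr N n) u; rewrite /op_sub.
set k := maxn N n => h1 h2; have := rnormB (T k u - T n u) (T k u - op_lim T u).
rewrite (_ : _ - _ - _ = op_lim T u - T n u); last by apply: ip_inj => w; rewrite !ipE; ring.
lra.
Qed.

Lemma op_lim_linear : linear (op_lim T).
Proof.
move=> a u v; apply: (@seq_lim_unique (fun n => T n (a *: u + v))).
  exact: op_limP.
have lS : bounded_linear ( *:%R a : H -> H).
  split; first by move=> b x y; rewrite scalerDr !scalerA mulrC.
  exists (complex.Re `|a|) => [|x].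
    by have := normr_ge0 a; rewrite lecE => /andP[].
  by rewrite {1}/rnorm normrZ (normE x) normc_def /= mul0r subr0.
have hu := seq_lim_map lS (op_limP u).
move=> e e0; have e2 : 0 < e / 2 by lra.
have [N hN] := hu _ e2; have [M hM] := op_limP v e2.
exists (maxn N M) => n; rewrite geq_max => /andP[/hN h1 /hM h2].
rewrite (linD (proj1 (bT n))) (linZ (proj1 (bT n))) opprD addrACA.
by apply: le_lt_trans (rnormD _ _) _; lra.
Qed.

Lemma op_lim_bounded_linear : bounded_linear (op_lim T).
Proof.
split; first exact: op_lim_linear.
have [lT [M M0 hM]] := bT 0%N; exists (`|r 0%N| + M); first by rewrite addr_ge0.
move=> u; have := rnormD (op_sub (op_lim T) (T 0%N) u) (T 0%N u).
rewrite /op_sub subrK => /le_trans; apply; rewrite mulrDl lerD //.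
by apply: le_trans (op_lim_bnd 0 u) _; rewrite ler_wpM2r ?rnorm_ge0 // ler_norm.
Qed.

Lemma op_lim_selfadj : (forall n, selfadj (T n)) -> selfadj (op_lim T).
Proof. by move=> h u v; apply: (seq_lim_ip (op_limP u) (op_limP v)) => n; exact: h. Qed.

Lemma op_lim_comm (S S' : H -> H) : bounded_linear S ->
  (forall n u, S (T n u) = T n (S' u)) -> forall u, S (op_lim T u) = op_lim T (S' u).
Proof.
move=> bS h u; apply: (@seq_lim_unique (fun n => S (T n u))).
  exact: seq_lim_map (op_limP u).
rewrite (_ : (fun n => _) = (fun n => T n (S' u))); first exact: op_limP.
by apply/funext => n; rewrite h.
Qed.

Lemma op_lim_sq u : seq_lim (fun n => T n (T n u)) (op_lim T (op_lim T u)).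
Proof.
have [N hN] := r0 ltr01.
have [lL [M M0 hM]] := op_lim_bounded_linear.
move=> e e0; have M1 : 0 < M + 1 by lra.
have [K hK] := op_limP u (divr_gt0 (divr_gt0 e0 (ltr0Sn R 1)) M1).
have [K' hK'] := op_limP (op_lim T u) (divr_gt0 e0 (ltr0Sn R 1)).
exists (maxn N (maxn K K')) => n; rewrite !geq_max => /and3P[/hN h1 /hK h2 /hK' h3].
move: h2; rewrite ltr_pdivlMr // => h2.
rewrite (_ : _ - _ = T n (T n u - op_lim T u) + (T n (op_lim T u) - op_lim T (op_lim T u))); last first.
  by rewrite (linB (proj1 (bT n))) addrA subrK.
apply: le_lt_trans (rnormD _ _) _.
suff : rnorm (T n (T n u - op_lim T u)) <= rnorm (T n u - op_lim T u) * (M + 1) by lra.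
set x := _ - _; have := rnormB (op_lim T x) (op_sub (op_lim T) (T n) x).
rewrite /op_sub subKr => /le_trans; apply; rewrite mulrDr mulr1 lerD //.
  by rewrite mulrC; apply: hM.
have := op_lim_bnd n x; rewrite /op_sub => /le_trans; apply.
by rewrite -[leRHS]mul1r ler_wpM2r ?rnorm_ge0 // ltW.
Qed.

End op_lim_theory.

(** * Square roots *)

(** A positive operator has no negative eigenvalue, and [T v - t v] would be
an eigenvector for [- t]. *)
Lemma positive_root_eigen (T : H -> H) (v : H) (t : R) : linear T ->
  (forall u, 0 <= ip (T u) u) -> 0 < t -> T (T v) = (t ^+ 2)%:C *: v -> T v = t%:C *: v.
Proof.
move=> lT T0 t0 sq; apply/eqP; rewrite -subr_eq0; apply/eqP; set w := _ - _.
have hw : T w = - (t%:C *: w).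
  by rewrite /w (linB lT) (linZ lT) sq; apply: ip_inj => x; rewrite !ipE; ring.
have := T0 w; rewrite hw ipNl ipZl => h.
apply: ip_eq0; apply/eqP; rewrite eq_le ip_ge0 andbT.
by rewrite -(ler_pM2l t0); lra.
Qed.

Section square_root.

Fixpoint sqrt_seq (n : nat) : R :=
  if n is n'.+1 then 2^-1 * (1 + sqrt_seq n' ^+ 2) else 0.

Lemma sqrt_seq_ge0 n : 0 <= sqrt_seq n.
Proof. by case: n => //= n; rewrite mulr_ge0 ?invr_ge0 // addr_ge0 ?sqr_ge0. Qed.

(** The fixed point [1] of [y |-> (1 + y^2) / 2] is neutral, so the convergence
is only of order [1 / n]. *)
Lemma sqrt_seq_lt1 n : sqrt_seq n < 1 /\ 1 - sqrt_seq n <= 2 / n.+2%:R.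
Proof.
elim: n => [|n [IH1 IH2]] /=; first by rewrite subr0 divff // ltr01.
have h0 := sqrt_seq_ge0 n; split; first by nra.
set y := sqrt_seq n in IH1 IH2 h0 *.
have N0 : 0 < n.+2%:R :> R by rewrite ltr0n.
have N1 : 0 < n.+3%:R :> R by rewrite ltr0n.
rewrite ler_pdivlMr // in IH2; rewrite ler_pdivlMr //.
rewrite -[n.+3]addn1 natrD in N1 *; move: N0 IH2 {N1}; set N := n.+2%:R => N0 IH2.
have N2 : 2 <= N by rewrite /N ler_nat.
set w := 1 - y in IH2.
have w1 : w <= 1 by rewrite /w; lra.
have w0 : 0 < w by rewrite /w; lra.
have -> : 1 - 2^-1 * (1 + y ^+ 2) = w - w ^+ 2 / 2 by rewrite /w; field.
have h : N * (w * N * (1 - w / 2)) <= N * 2 * (1 - N^-1).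
  have -> : N * 2 * (1 - N^-1) = 2 * (N - 1) by field; lra.
  have : (2 - w * N) * (N * 2 - 2 - w * N) >= 0 by apply: mulr_ge0; lra.
  by nra.
have : (w - w ^+ 2 / 2) * (N + 1) * (N * N) <= 2 * (N * N); last first.
  by rewrite ler_pM2r // mulr_gt0.
have -> : (w - w ^+ 2 / 2) * (N + 1) * (N * N) = N * (w * N * (1 - w / 2)) * (N + 1) by field.
apply: (@le_trans _ _ (N * 2 * (1 - N^-1) * (N + 1))).
  by rewrite ler_wpM2r //; lra.
have -> : N * 2 * (1 - N^-1) * (N + 1) = 2 * (N * N - 1) by field; lra.
lra.
Qed.

Lemma sqrt_seq_le n m : (n <= m)%N -> sqrt_seq n <= sqrt_seq m.
Proof.
move=> /subnK <-; elim: (m - n)%N => [//|k IH] /=; apply: le_trans IH _.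
by have := sqr_ge0 (sqrt_seq (k + n) - 1); nra.
Qed.

Lemma sqrt_seq_cvg (e : R) : 0 < e ->
  exists N, forall n, (N <= n)%N -> 1 - sqrt_seq n < e.
Proof.
move=> e0; exists (truncn (2 / e)) => n hn.
apply: le_lt_trans (proj2 (sqrt_seq_lt1 n)) _.
rewrite ltr_pdivrMr ?ltr0n // mulrC -ltr_pdivrMr //.
apply: lt_le_trans (truncnS_gt _) _; by rewrite ler_nat ltnS leqW.
Qed.

Variable C : H -> H.

(** Successive approximations of [Y = 1 - sqrt (1 - C)], which is the solution
of [Y = (C + Y^2) / 2]. For a contraction [C] they are dominated term by term
by the scalar sequence [sqrt_seq], that is, by the case [C = 1]. *)
Fixpoint sqrt_iter (n : nat) : H -> H :=
  if n is n'.+1 then fun u => 2^-1%:C *: (C u + sqrt_iter n' (sqrt_iter n' u))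
  else fun _ => 0.

Definition sqrt1B (u : H) := u - op_lim sqrt_iter u.

Hypothesis lC : linear C.
Hypothesis C1 : bnd C 1.

Lemma sqrt_iter_bnd n : bnd (sqrt_iter n) (sqrt_seq n).
Proof.
elim: n => [|n IH] u /=; first by rewrite rnorm0 mul0r.
rewrite rnormZ ger0_norm ?invr_ge0 // -mulrA ler_wpM2l ?invr_ge0 //.
apply: le_trans (rnormD _ _) _; rewrite mulrDl lerD ?mul1r //.
  by have := C1 u; rewrite mul1r.
by rewrite expr2; apply: (bnd_comp (sqrt_seq_ge0 n) IH IH).
Qed.

Lemma sqrt_iter_bounded n : bounded_linear (sqrt_iter n).
Proof.
split; last by exists (sqrt_seq n); [exact: sqrt_seq_ge0|exact: sqrt_iter_bnd].
elim: n => [|n IH]; first exact: linear_zero.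
by apply: (linear_scale 2^-1 (linear_add lC (linear_comp IH IH))).
Qed.

(** The next increment is [(T (T - S) + (T - S) S) / 2] for two consecutive
iterates [S] and [T], so that induction bounds it by the increment of the scalar
sequence. *)
Lemma sqrt_iter_step n :
  bnd (op_sub (sqrt_iter n.+1) (sqrt_iter n)) (sqrt_seq n.+1 - sqrt_seq n).
Proof.
elim: n => [|n IH] u.
  rewrite /op_sub /= addr0 subr0 rnormZ ger0_norm ?invr_ge0 //.
  have := C1 u; have := rnorm_ge0 u; lra.
rewrite /op_sub; set T := sqrt_iter n.+1; set S := sqrt_iter n.
rewrite (_ : _ - _ = 2^-1%:C *: (T (T u - S u) + (T (S u) - S (S u)))); last first.
  have lT : linear T by case: (sqrt_iter_bounded n.+1).
  rewrite (linB lT) addrA subrK.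
  rewrite (_ : sqrt_iter n.+2 u = 2^-1%:C *: (C u + T (T u))) //.
  rewrite {3}/T /= -/S; apply: ip_inj => w; rewrite !ipE; ring.
rewrite rnormZ ger0_norm ?invr_ge0 //.
have h1 := sqrt_iter_bnd n.+1 (T u - S u); have h2 := IH u; have h3 := IH (S u).
rewrite /op_sub -/T -/S in h1 h2 h3.
have h4 := sqrt_iter_bnd n u; rewrite -/S in h4.
have k0 := sqrt_seq_ge0 n.+1; have kn := sqrt_seq_le (leqnSn n).
set a := sqrt_seq n.+1 in h1 h2 h3 k0 kn *; set b := sqrt_seq n in h1 h2 h3 h4 kn *.
have -> : sqrt_seq n.+2 - a = 2^-1 * (a * (a - b) + (a - b) * b).
  by rewrite (_ : sqrt_seq n.+2 = 2^-1 * (1 + a ^+ 2)) // {2}/a /= -/b; ring.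
rewrite -mulrA ler_wpM2l ?invr_ge0 //; apply: le_trans (rnormD _ _) _.
rewrite mulrDl lerD //.
  by apply: le_trans h1 _; rewrite -mulrA ler_wpM2l.
by apply: le_trans h3 _; rewrite -mulrA ler_wpM2l // subr_ge0.
Qed.

Lemma sqrt_iter_diff m n : (n <= m)%N ->
  bnd (op_sub (sqrt_iter m) (sqrt_iter n)) (1 - sqrt_seq n).
Proof.
move=> /subnK <-; set k := (m - n)%N.
suff h : bnd (op_sub (sqrt_iter (k + n)) (sqrt_iter n)) (sqrt_seq (k + n) - sqrt_seq n).
  by apply: bnd_le h; rewrite lerB // ltW // (proj1 (sqrt_seq_lt1 _)).
elim: k => [|k IH] u; first by rewrite /op_sub !subrr rnorm0 mul0r.
rewrite /op_sub (_ : _ - _ = op_sub (sqrt_iter (k + n).+1) (sqrt_iter (k + n)) u +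
  op_sub (sqrt_iter (k + n)) (sqrt_iter n) u); last first.
  by rewrite /op_sub addrA subrK.
apply: le_trans (rnormD _ _) _.
by have := sqrt_iter_step (k + n) u; have := IH u; rewrite addSn; lra.
Qed.

Let Y := op_lim sqrt_iter.

Lemma sqrt1B_bounded : bounded_linear sqrt1B.
Proof.
apply: bounded_linear_sub; first exact: bounded_linear_id.
exact: (op_lim_bounded_linear sqrt_iter_bounded sqrt_iter_diff sqrt_seq_cvg).
Qed.

Lemma sqrt1B_approx n :
  bnd (op_sub sqrt1B (fun u => u - sqrt_iter n u)) (1 - sqrt_seq n).
Proof.
move=> u; rewrite /op_sub /sqrt1B opprB addrC addrA subrK rnorm_distC.
exact: (op_lim_bnd sqrt_iter_diff sqrt_seq_cvg).
Qed.

Lemma sqrt1B_sq u : sqrt1B (sqrt1B u) = u - C u.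
Proof.
have [lY _] := op_lim_bounded_linear sqrt_iter_bounded sqrt_iter_diff sqrt_seq_cvg.
rewrite /sqrt1B (linB lY) -/Y.
suff : Y u + Y u = C u + Y (Y u).
  move=> h; rewrite (_ : _ - _ - _ = u - (Y u + Y u) + Y (Y u)).
    by rewrite h; apply: ip_inj => w; rewrite !ipE; ring.
  by apply: ip_inj => w; rewrite !ipE; ring.
have h1 := op_limP sqrt_iter_diff sqrt_seq_cvg u.
have h2 := op_lim_sq sqrt_iter_bounded sqrt_iter_diff sqrt_seq_cvg u.
apply: (@seq_lim_unique (fun n => sqrt_iter n.+1 u + sqrt_iter n.+1 u)).
  move=> e e0; have [|N hN] := h1 (e / 2); first lra.
  exists N => n Nn; rewrite opprD addrACA; apply: le_lt_trans (rnormD _ _) _.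
  have := hN n.+1; rewrite ltnW // => /(_ isT); rewrite -/Y; lra.
move=> e e0; have [N hN] := h2 _ e0; exists N => n /hN; rewrite -/Y /=.
by congr (rnorm _ < _); apply: ip_inj => w; rewrite !ipE; field.
Qed.

Lemma sqrt1B_comm (S : H -> H) : bounded_linear S ->
  (forall u, S (C u) = C (S u)) -> forall u, S (sqrt1B u) = sqrt1B (S u).
Proof.
move=> bS h u; have [lS _] := bS; rewrite /sqrt1B (linB lS); congr (_ - _).
apply: (op_lim_comm sqrt_iter_diff sqrt_seq_cvg (S' := S)) => //.
elim=> [|n IH] v /=; first by rewrite (lin0 lS).
by rewrite (linZ lS) (linD lS) h !IH.
Qed.

Hypothesis sC : selfadj C.

Lemma sqrt_iter_selfadj n : selfadj (sqrt_iter n).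
Proof.
elim: n => [|n IH] u v /=; first by rewrite !ipE.
by rewrite !ipE sC !IH.
Qed.

Lemma sqrt1B_selfadj : selfadj sqrt1B.
Proof.
move=> u v; rewrite /sqrt1B !ipE; congr (_ - _).
exact: (op_lim_selfadj sqrt_iter_diff sqrt_seq_cvg sqrt_iter_selfadj).
Qed.

Lemma sqrt1B_ge0 u : 0 <= ip (sqrt1B u) u.
Proof.
have h : rnorm (Y u) <= rnorm u.
  apply/ler_addgt0Pr => e e0.
  have [N hN] := op_limP sqrt_iter_diff sqrt_seq_cvg u e0.
  have := hN _ (leqnn N); rewrite -/Y => h.
  have := sqrt_iter_bnd N u; have := proj1 (sqrt_seq_lt1 N).
  have := rnormB (sqrt_iter N u) (sqrt_iter N u - Y u); rewrite subKr.
  have := rnorm_ge0 u; nra.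
rewrite /sqrt1B ipBl ip_sqr; have := CauchySchwarz_ip (Y u) u.
rewrite -/Y; have := rnorm_ge0 u; nra.
Qed.

Lemma sqrt1B_eigen e (t : R) : 0 <= t -> C e = (1 - t ^+ 2)%:C *: e ->
  sqrt1B e = t%:C *: e.
Proof.
move=> t0 hC; have [lS _] := sqrt1B_bounded.
have sq : sqrt1B (sqrt1B e) = (t ^+ 2)%:C *: e.
  by rewrite sqrt1B_sq hC; apply: ip_inj => w; rewrite !ipE; ring.
have [tz|tn] := eqVneq t 0.
  rewrite tz scale0r; apply: ip_eq0; rewrite sqrt1B_selfadj sq tz.
  by rewrite expr0n /= scale0r ip0r.
by apply: (positive_root_eigen lS sqrt1B_ge0) => //; rewrite lt_def tn.
Qed.

End square_root.

Lemma sqrt_iter_cvg (Y : Type) (F : set_system Y) (FF : Filter F)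
    (C : Y -> H -> H) (C0 : H -> H) n :
  linear C0 -> bnd C0 1 -> op_cvg F C C0 ->
  op_cvg F (fun z => sqrt_iter (C z) n) (sqrt_iter C0 n).
Proof.
move=> lC C1 h; elim: n => [|n IH]; first exact: op_cvg_cst.
have b := sqrt_iter_bounded lC C1 n.
apply: op_cvg_scale_cst.
  apply: bounded_linear_add; last exact: bounded_linear_comp.
  by split=> //; exists 1.
apply: op_cvg_add => //; exact: (op_cvg_comp b b IH IH).
Qed.

Lemma sqrt1B_cvg (Y : Type) (F : set_system Y) (FF : Filter F)
    (C : Y -> H -> H) (C0 : H -> H) :
  (\forall z \near F, linear (C z) /\ bnd (C z) 1) -> linear C0 -> bnd C0 1 ->
  op_cvg F C C0 -> op_cvg F (fun z => sqrt1B (C z)) (sqrt1B C0).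
Proof.
move=> hC lC0 bC0 h.
apply: (op_cvg_unif (T := fun n z u => u - sqrt_iter (C z) n u)
                    (T0 := fun n u => u - sqrt_iter C0 n u)).
  move=> n; apply: (op_cvg_sub (S := fun _ => id)); first exact: op_cvg_cst.
  exact: sqrt_iter_cvg.
move=> e e0; have [N hN] := sqrt_seq_cvg e0; exists N.
have eN := ltW (hN _ (leqnn N)); split.
  apply: filterS hC => z [lz bz]; apply: bnd_le eN _; exact: sqrt1B_approx.
by apply: bnd_le eN _; exact: sqrt1B_approx.
Qed.

(** * The sign of an operator that is almost an involution *)

Section sign.

(** The Newton step for [q^2 = 1] without inverses: on eigenvalues it moves [z] to
[(3 z - z^3) / 2], whose attracting fixed points are [1] and [-1]. *)
Definition newton (q : H -> H) (u : H) := (3 / 2)%:C *: q u - 2^-1%:C *: q (q (q u)).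

Definition newton_iter (q : H -> H) n := iter n newton q.

Definition op_sgn (q : H -> H) := op_lim (newton_iter q).

Definition defect (q : H -> H) (u : H) := u - q (q u).

(** The defect is essentially squared by a Newton step. *)
Lemma defect_newton q u : linear q ->
  defect (newton q) u =
  (3 / 4)%:C *: defect q (defect q u) + 4^-1%:C *: defect q (defect q (defect q u)).
Proof.
move=> lq; rewrite /defect /newton !(linB lq, linZ lq).
by apply: ip_inj => w; rewrite !ipE; field.
Qed.

Lemma newton_sub q u : linear q -> newton q u - q u = 2^-1%:C *: q (defect q u).
Proof.
move=> lq; rewrite /defect /newton !(linB lq, linZ lq).
by apply: ip_inj => w; rewrite !ipE; field.
Qed.

Lemma newton_linear q : linear q -> linear (newton q).
Proof.
move=> lq; apply: linear_sub; apply: linear_scale => //.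
exact: linear_comp lq (linear_comp lq lq).
Qed.

Lemma defect_linear q : linear q -> linear (defect q).
Proof. by move=> lq; apply: (linear_sub linear_id); exact: linear_comp. Qed.

Lemma newton_selfadj q : selfadj q -> selfadj (newton q).
Proof. by move=> sq u v; rewrite /newton !ipE !sq. Qed.

Lemma defect_bnd2 q c : selfadj q -> c <= 1 -> bnd (defect q) c -> bnd q 2.
Proof.
move=> sq c1 h u.
suff : rnorm (q u) ^+ 2 <= (2 * rnorm u) ^+ 2.
  by rewrite ler_pXn2r // nnegrE ?mulr_ge0 ?rnorm_ge0.
rewrite -ip_sqr sq (_ : q (q u) = u - defect q u); last by rewrite subKr.
rewrite ipBr ip_sqr; have := CauchySchwarz_abs u (defect q u).
rewrite ler_norml => /andP[h1 _]; have := h u; have := rnorm_ge0 u; nra.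
Qed.

Variables (q : H -> H) (c : R).
Hypothesis lq : linear q.
Hypothesis sq : selfadj q.
Hypothesis c0 : 0 <= c.
Hypothesis c1 : c < 1.
Hypothesis qc : bnd (defect q) c.

Let qn := newton_iter q.

Lemma newton_iter_linear n : linear (qn n).
Proof. by elim: n => [//|n IH]; exact: newton_linear. Qed.

Lemma newton_iter_selfadj n : selfadj (qn n).
Proof. by elim: n => [//|n IH]; exact: newton_selfadj. Qed.

Lemma defect_iter_bnd n : bnd (defect (qn n)) (c ^+ n.+1).
Proof.
elim: n => [|n IH]; first by rewrite expr1.
have cn0 : 0 <= c ^+ n.+1 by exact: exprn_ge0.
have cn1 : c ^+ n.+1 <= c by rewrite exprS ler_piMr // exprn_ile1 // ltW.
move=> u; rewrite /qn /newton_iter iterS defect_newton; last exact: newton_iter_linear.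
rewrite -/(newton_iter q n) -/qn; set D := defect (qn n) in IH *.
apply: le_trans (rnormD _ _) _; rewrite !rnormZ !ger0_norm; try lra.
have h1 := IH u; have h2 := IH (D u); have h3 := IH (D (D u)).
rewrite [c ^+ n.+2]exprS; set a := c ^+ n.+1 in cn0 cn1 h1 h2 h3 *.
have k2 : rnorm (D (D u)) <= c * a * rnorm u.
  have := rnorm_ge0 u; have := rnorm_ge0 (D u); have := rnorm_ge0 (D (D u)); nra.
have k3 : rnorm (D (D (D u))) <= rnorm (D (D u)).
  by apply: le_trans h3 _; rewrite ler_piMl ?rnorm_ge0 // (le_trans cn1) // ltW.
lra.
Qed.

Lemma newton_iter_bnd2 n : bnd (qn n) 2.
Proof.
apply: (defect_bnd2 (newton_iter_selfadj n) _ (defect_iter_bnd n)).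
by rewrite exprn_ile1 // ltW.
Qed.

Lemma newton_iter_bounded n : bounded_linear (qn n).
Proof.
split; first exact: newton_iter_linear.
by exists 2 => //; exact: newton_iter_bnd2.
Qed.

Lemma newton_iter_diff m n : (n <= m)%N ->
  bnd (op_sub (qn m) (qn n)) (c ^+ n.+1 / (1 - c)).
Proof.
move=> /subnK <-; set k := (m - n)%N.
suff h : bnd (op_sub (qn (k + n)) (qn n)) ((c ^+ n.+1 - c ^+ (k + n).+1) / (1 - c)).
  apply: bnd_le h; rewrite ler_pM2r ?invr_gt0 ?subr_gt0 //.
  by rewrite gerBl exprn_ge0.
elim: k => [|k IH] u; first by rewrite /op_sub !subrr rnorm0 !mul0r.
rewrite /op_sub (_ : _ - _ = (qn (k + n).+1 u - qn (k + n) u) +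
  op_sub (qn (k + n)) (qn n) u); last first.
  by rewrite /op_sub addrA subrK.
apply: le_trans (rnormD _ _) _.
rewrite {1}/qn /newton_iter iterS newton_sub; last exact: newton_iter_linear.
rewrite -/(newton_iter q (k + n)) -/qn rnormZ ger0_norm ?invr_ge0 //.
have h1 := IH u; have h2 := newton_iter_bnd2 (k + n) (defect (qn (k + n)) u).
have h3 := defect_iter_bnd (k + n) u.
have h4 : 2^-1 * rnorm (qn (k + n) (defect (qn (k + n)) u)) <= c ^+ (k + n).+1 * rnorm u.
  lra.
apply: le_trans (lerD h4 h1) _.
rewrite addSn [c ^+ (k + n).+2]exprS le_eqVlt; apply/orP; left; apply/eqP.
by field; rewrite subr_eq0 gt_eqF.
Qed.

Lemma geometric_small (e : R) : 0 < e ->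
  exists N, forall n, (N <= n)%N -> c ^+ n.+1 / (1 - c) < e.
Proof.
move=> e0; have ec : 0 < e * (1 - c) by rewrite mulr_gt0 // subr_gt0.
have /(@cvgrPdist_lt _ R^o) : (fun n => c ^+ n) @ \oo --> (0 : R).
  by apply: cvg_expr; rewrite ger0_norm.
move=> /(_ _ ec)[N _ hN]; exists N => n Nn.
rewrite ltr_pdivrMr ?subr_gt0 //; have /= := hN n.+1 (leqW Nn).
by rewrite sub0r normrN ger0_norm // exprn_ge0.
Qed.

Lemma geometric_le n : c ^+ n.+1 <= c ^+ n.+1 / (1 - c).
Proof.
have := exprn_ge0 n.+1 c0; rewrite ler_pdivlMr ?subr_gt0 //.
by have := c0; have := c1; nra.
Qed.

Lemma op_sgn_bounded : bounded_linear (op_sgn q).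
Proof. exact: (op_lim_bounded_linear newton_iter_bounded newton_iter_diff geometric_small). Qed.

Lemma op_sgn_selfadj : selfadj (op_sgn q).
Proof. exact: (op_lim_selfadj newton_iter_diff geometric_small newton_iter_selfadj). Qed.

Lemma op_sgn_approx n : bnd (op_sub (op_sgn q) (qn n)) (c ^+ n.+1 / (1 - c)).
Proof. exact: (op_lim_bnd newton_iter_diff geometric_small). Qed.

Lemma op_sgn_dist : bnd (op_sub (op_sgn q) q) (c / (1 - c)).
Proof. by have := op_sgn_approx 0; rewrite expr1. Qed.

Lemma op_sgn_sq u : op_sgn q (op_sgn q u) = u.
Proof.
have h := op_lim_sq newton_iter_bounded newton_iter_diff geometric_small u.
apply: seq_lim_unique h _ => e e0.
have U1 : 0 < rnorm u + 1 by have := rnorm_ge0 u; lra.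
have [N hN] := geometric_small (divr_gt0 e0 U1); exists N => n /hN.
rewrite ltr_pdivlMr // => k.
rewrite rnorm_distC -/(defect (qn n) u); apply: le_lt_trans (defect_iter_bnd n u) _.
have := geometric_le n.
have := exprn_ge0 n.+1 c0; have := rnorm_ge0 u; nra.
Qed.

Lemma op_sgn_anticomm (s : H -> H) : bounded_linear s ->
  (forall u, s (q u) = - q (s u)) -> forall u, s (op_sgn q u) = - op_sgn q (s u).
Proof.
move=> bs h u; have [ls _] := bs; have [lS _] := op_sgn_bounded.
rewrite -(linN lS).
apply: (op_lim_comm newton_iter_diff geometric_small (S' := fun v => - s v)) => //.
elim=> [|n IH] v /=; first by rewrite h (linN lq).
have lqn := newton_iter_linear n.
rewrite /newton (linB ls) !(linZ ls) -/(newton_iter q n) -/qn !IH.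
by rewrite !(linN lqn) !opprK.
Qed.

(** By induction the iterates have [e] as eigenvector, with eigenvalue [eps * b]
for positive [b]; the bound on the defects forces [b] to tend to [1]. *)
Lemma op_sgn_eigen e (a eps : R) : 0 < a -> eps ^+ 2 = 1 -> q e = (eps * a)%:C *: e ->
  op_sgn q e = eps%:C *: e.
Proof.
move=> a0 eps1 qe.
have [e0|/eqP e0] := eqVneq e 0.
  by have [lS _] := op_sgn_bounded; rewrite e0 (lin0 lS) scaler0.
have ep : 0 < rnorm e.
  by rewrite lt_def rnorm_ge0 andbT; apply/eqP => /rnorm_eq0.
have h n : exists b : R, [/\ 0 < b, qn n e = (eps * b)%:C *: e & `|1 - b| <= c ^+ n.+1].
  elim: n => [|n [b [b0 qb hb]]].
    exists a; split=> //; have := qc e; rewrite /defect qe (linZ lq) qe.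
    rewrite (_ : _ - _ = (1 - a ^+ 2)%:C *: e).
      rewrite rnormZ ler_pM2r // (_ : 1 - a ^+ 2 = (1 - a) * (1 + a)); last by ring.
      rewrite normrM [`|1 + a|]gtr0_norm; last lra.
      rewrite expr1; have := normr_ge0 (1 - a); nra.
    apply: ip_inj => w; rewrite !ipE.
    by rewrite (_ : a ^+ 2 = eps ^+ 2 * a ^+ 2); [ring|rewrite eps1 mul1r].
  have lqn := newton_iter_linear n.
  have b2 : b < 2.
    have := ler_norm (b - 1); rewrite distrC.
    have := exprn_ile1 n.+1 c0 (ltW c1).
    have : c ^+ n.+1 <= c by rewrite exprS ler_piMr // exprn_ile1 // ltW.
    have := c1; lra.
  have bb : 0 < 3 / 2 * b - 2^-1 * b ^+ 3.
    have h2 : b ^+ 2 < 3.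
      have := defect_iter_bnd n e; rewrite /defect qb (linZ lqn) qb.
      rewrite (_ : _ - _ = (1 - b ^+ 2)%:C *: e); last first.
        apply: ip_inj => w; rewrite !ipE.
        by rewrite (_ : b ^+ 2 = eps ^+ 2 * b ^+ 2); [ring|rewrite eps1 mul1r].
      rewrite rnormZ ler_pM2r //; have := exprn_ile1 n.+1 c0 (ltW c1).
      have := ler_norm (b ^+ 2 - 1); rewrite distrC; lra.
    by rewrite exprSr; nra.
  have qb' : qn n.+1 e = (eps * (3 / 2 * b - 2^-1 * b ^+ 3))%:C *: e.
    rewrite /qn /newton_iter iterS /newton -/(newton_iter q n) -/qn.
    rewrite qb !(linZ lqn) qb (linZ lqn) qb.
    apply: ip_inj => w; rewrite !ipE.
    rewrite (_ : eps * b * (eps * b * (eps * b * ip e w)) = eps ^+ 2 * (eps * b ^+ 3 * ip e w)); last by ring.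
    by rewrite eps1; ring.
  exists (3 / 2 * b - 2^-1 * b ^+ 3); split=> //.
  have := defect_iter_bnd n.+1 e; rewrite /defect qb' (linZ (newton_iter_linear n.+1)) qb'.
  set b' := 3 / 2 * b - _ in bb *.
  rewrite (_ : _ - _ = (1 - b' ^+ 2)%:C *: e).
    rewrite rnormZ ler_pM2r // (_ : 1 - b' ^+ 2 = (1 - b') * (1 + b')); last by ring.
    rewrite normrM [`|1 + b'|]gtr0_norm; last lra.
    have := normr_ge0 (1 - b'); nra.
  apply: ip_inj => w; rewrite !ipE.
  by rewrite (_ : b' ^+ 2 = eps ^+ 2 * b' ^+ 2); [ring|rewrite eps1 mul1r].
apply: seq_lim_unique (op_limP newton_iter_diff geometric_small e) _ => d d0.
have [N hN] := geometric_small (divr_gt0 d0 ep); exists N => n /hN.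
rewrite ltr_pdivlMr // => k; have [b [b0 -> hb]] := h n.
rewrite (_ : _ - _ = (eps * (b - 1))%:C *: e); last first.
  by apply: ip_inj => w; rewrite !ipE; ring.
have epsn : `|eps| = 1.
  by apply/eqP; rewrite -(@eqrXn2 _ 2) // expr1n real_normK ?num_real // eps1.
rewrite rnormZ normrM epsn mul1r distrC; apply: le_lt_trans k.
by rewrite ler_wpM2r ?rnorm_ge0 // (le_trans hb) // geometric_le.
Qed.

(** Each Newton step changes [q] by a multiple of its defect, and compactness
survives in the limit. *)
Lemma op_sgn_totally_bounded : totally_bounded_op (defect q) ->
  totally_bounded_op (op_sub (op_sgn q) q).
Proof.
move=> tq.
have tD n : totally_bounded_op (defect (qn n)).
  elim: n => [//|n IH].
  have lD := defect_linear (newton_iter_linear n).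
  have bD : bounded_linear (defect (qn n)).
    by split=> //; exists (c ^+ n.+1); [exact: exprn_ge0|exact: defect_iter_bnd].
  rewrite (_ : defect _ = fun u => (3 / 4)%:C *: defect (qn n) (defect (qn n) u) +
     4^-1%:C *: defect (qn n) (defect (qn n) (defect (qn n) u))); last first.
    by apply/funext => u; rewrite -defect_newton //; exact: newton_iter_linear.
  apply: totally_bounded_add; apply: totally_bounded_scale.
    exact: (totally_bounded_compl bD IH).
  exact: (totally_bounded_compl bD (totally_bounded_compl bD IH)).
have tn n : totally_bounded_op (op_sub (qn n) q).
  elim: n => [|n IH].
    apply: (totally_bounded_le (M := 0) (defect_linear lq) _ _ tq).
      exact: linear_sub.
    by move=> u; rewrite /op_sub subrr rnorm0 mul0r.
  rewrite (_ : op_sub _ _ = fun u => 2^-1%:C *: qn n (defect (qn n) u) + op_sub (qn n) q u).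
    apply: totally_bounded_add => //; apply: totally_bounded_scale.
    exact: totally_bounded_compl (newton_iter_bounded n) (tD n).
  apply/funext => u; rewrite /op_sub -newton_sub; last exact: newton_iter_linear.
  by rewrite addrA subrK.
apply: (totally_bounded_lim _ tn) => e e0.
have [N hN] := geometric_small e0; exists N.
apply: bnd_le (ltW (hN _ (leqnn N))) _ => u.
rewrite /op_sub opprB addrA subrK; exact: (op_sgn_approx N).
Qed.

End sign.

Lemma newton_fix q : (forall u, q (q u) = u) -> newton q = q.
Proof.
by move=> h; apply/funext => u; rewrite /newton h; apply: ip_inj => w; rewrite !ipE; field.
Qed.

Lemma op_sgn_fix q : linear q -> (forall u, q (q u) = u) -> op_sgn q = q.
Proof.
move=> lq h; have hn n : newton_iter q n = q.
  by elim: n => [//|n IH]; rewrite /newton_iter iterS -/(newton_iter q n) IH newton_fix.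
have D0 u : defect q u = 0 by rewrite /defect h subrr.
apply/funext => u; rewrite /op_sgn /op_lim; case: xgetP => [l _ /= hl|/(_ (q u)) []].
  apply: seq_lim_unique hl _ => e e0; exists 0%N => n _.
  by rewrite hn subrr rnorm0.
by move=> e e0; exists 0%N => n _; rewrite hn subrr rnorm0.
Qed.

Section sign_continuity.
Context {Y : Type} (F : set_system Y) {FF : Filter F}.
Variables (q : Y -> H -> H) (q0 : H -> H) (c : R).
Hypothesis lq : \forall z \near F, linear (q z) /\ selfadj (q z).
Hypothesis lq0 : linear q0.
Hypothesis sq0 : selfadj q0.
Hypothesis c0 : 0 <= c.
Hypothesis c1 : c < 1.
Hypothesis qc : bnd (defect q0) c.
Hypothesis hq : op_cvg F q q0.

Lemma newton_iter_cvg n :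
  op_cvg F (fun z => newton_iter (q z) n) (newton_iter q0 n).
Proof.
elim: n => [//|n IH]; have b := newton_iter_bounded lq0 sq0 c0 c1 qc n.
have b3 := bounded_linear_comp b (bounded_linear_comp b b).
apply: op_cvg_sub; first exact: op_cvg_scale_cst.
apply: op_cvg_scale_cst b3 _.
apply: (op_cvg_comp b (bounded_linear_comp b b) IH).
exact: (op_cvg_comp b b IH IH).
Qed.

Lemma op_sgn_cvg : op_cvg F (fun z => op_sgn (q z)) (op_sgn q0).
Proof.
have b : bounded_linear q0 by have := newton_iter_bounded lq0 sq0 c0 c1 qc 0.
have hD : op_cvg F (fun z => defect (q z)) (defect q0).
  apply: (op_cvg_sub (S := fun _ => id)); first exact: op_cvg_cst.
  exact: (op_cvg_comp b b hq hq).
have c0' := c0; have c1' := c1; pose c' := (1 + c) / 2.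
have c'0 : 0 <= c' by rewrite /c'; lra.
have c'1 : c' < 1 by rewrite /c'; lra.
have cc' : c <= c' by rewrite /c'; lra.
have hc : \forall z \near F, bnd (defect (q z)) c'.
  have e0 : 0 < (1 - c) / 2 by lra.
  apply: filterS (hD _ e0) => z hz u.
  have := rnormD (defect q0 u) (op_sub (defect (q z)) (defect q0) u).
  rewrite /op_sub subrKC => /le_trans; apply.
  have := hz u; have := qc u; rewrite /op_sub /c'; lra.
apply: (op_cvg_unif newton_iter_cvg) => e e0.
have [N hN] := geometric_small c'0 c'1 e0; exists N.
have eN := ltW (hN _ (leqnn N)); split.
  apply: filterS2 lq hc => z [lz sz] hz; apply: bnd_le eN _.
  exact: (op_sgn_approx lz sz c'0 c'1 hz).
apply: bnd_le eN _; apply: (op_sgn_approx lq0 sq0 c'0 c'1).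
exact: bnd_le qc.
Qed.

End sign_continuity.

(** * Orthonormal bases *)

(** An orthonormal basis for [ip], indexed by [nat] whatever the dimension:
missing vectors are zero. *)
Definition total_orthogonal (e : nat -> H) :=
  [/\ forall m n, m != n -> ip (e m) (e n) = 0,
      forall n, ip (e n) (e n) = 1 \/ e n = 0 &
      forall u, (forall n, ip u (e n) = 0) -> u = 0].

Section basis.
Variable e : nat -> H.
Hypothesis be : total_orthogonal e.

Lemma coef_unit u n : ip u (e n) * ip (e n) (e n) = ip u (e n).
Proof. by have [_ /(_ n)[->|->] _] := be; rewrite ?ip0r ?mulr1 ?mul0r. Qed.

Lemma coef_inj u v : (forall n, ip u (e n) = ip v (e n)) -> u = v.
Proof.
have [_ _ h] := be => huv; apply/eqP; rewrite -subr_eq0; apply/eqP/h => n.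
by rewrite ipBl huv subrr.
Qed.

Definition comb (a : nat -> R) N := \sum_(i < N) (a i)%:C *: e i.

Lemma ip_comb a N u : ip (comb a N) u = \sum_(i < N) a i * ip (e i) u.
Proof. by rewrite /comb ip_sum; apply: eq_bigr => i _; rewrite ipZl. Qed.

Lemma comb_coef a N k : (k < N)%N -> a k * ip (e k) (e k) = a k ->
  ip (comb a N) (e k) = a k.
Proof.
move=> kN ak; rewrite ip_comb (bigD1 (Ordinal kN)) //= ak big1 ?addr0 // => i.
have [h _ _] := be; rewrite -val_eqE /= => /h ->; by rewrite mulr0.
Qed.

Lemma comb_norm a m n : (forall k, a k * ip (e k) (e k) = a k) -> (n <= m)%N ->
  rnorm (comb a m - comb a n) ^+ 2 = \sum_(i < m) a i ^+ 2 - \sum_(i < n) a i ^+ 2.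
Proof.
move=> ha nm; rewrite -ip_sqr ipBl !ip_comb.
have h1 k : (k < m)%N -> ip (e k) (comb a m) = a k.
  by move=> km; rewrite ipC comb_coef.
have h2 k : (k < n)%N -> ip (e k) (comb a n) = a k.
  by move=> kn; rewrite ipC comb_coef.
have h3 k : (n <= k)%N -> ip (e k) (comb a n) = 0.
  move=> kn; rewrite ipC ip_comb big1 // => i _.
  have [h _ _] := be; rewrite h ?mulr0 //; apply/negP => /eqP ik.
  by have := ltn_ord i; rewrite ik ltnNge kn.
rewrite [X in _ - X]big1 ?subr0; last first.
  by move=> i _; rewrite ipBr h2 // h1 ?subrr ?mulr0 // (leq_trans (ltn_ord i)).
rewrite -!(big_mkord xpredT (fun i => a i ^+ 2)) (big_cat_nat (leq0n n) nm) /= addrAC subrr add0r.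
rewrite -(big_mkord xpredT (fun i => a i * ip (e i) (comb a m - comb a n))).
rewrite (big_cat_nat (leq0n n) nm) /= big_nat big1 ?add0r.
  by apply: eq_big_nat => i /andP[ni im]; rewrite ipBr h1 // h3 // subr0 expr2.
by move=> i /andP[_ ni]; rewrite ipBr h2 // h1 ?subrr ?mulr0 // (leq_trans ni).
Qed.

(** Riesz-Fischer. The condition [a k * ip (e k) (e k) = a k] says that [a]
vanishes where the basis vector is missing. *)
Lemma comb_cvg (a : nat -> R) M : (forall k, a k * ip (e k) (e k) = a k) ->
  (forall N, \sum_(i < N) a i ^+ 2 <= M) ->
  exists v, [/\ forall n, ip v (e n) = a n, seq_lim (comb a) v & rnorm v ^+ 2 <= M].
Proof.
move=> ha hM; pose S := range (fun N => \sum_(i < N) a i ^+ 2).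
have hS : has_sup S.
  split; first by exists (\sum_(i < 0) a i ^+ 2), 0%N.
  by exists M => _ [N _ <-].
have Sle N : \sum_(i < N) a i ^+ 2 <= sup S.
  by apply: sup_upper_bound => //; exists N.
have mono n m : (n <= m)%N -> \sum_(i < n) a i ^+ 2 <= \sum_(i < m) a i ^+ 2.
  by move=> nm; rewrite -subr_ge0 -comb_norm // sqr_ge0.
have [v hv] : exists v, seq_lim (comb a) v.
  apply: rnorm_complete => d d0; have d2 : 0 < d ^+ 2 by rewrite exprn_gt0.
  have [_ [N _ <-] hN] := sup_adherent d2 hS; exists N.
  have h m n : (N <= n)%N -> (n <= m)%N -> rnorm (comb a m - comb a n) < d.
    move=> Nn nm; rewrite -(@ltr_pXn2r _ 2) ?nnegrE ?rnorm_ge0 ?(ltW d0) //.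
    by rewrite comb_norm //; have := Sle m; have := mono _ _ Nn; lra.
  move=> m n Nm Nn; case: (leqP n m) => [nm|/ltnW mn]; first exact: h.
  by rewrite rnorm_distC h.
exists v; split=> //.
  move=> n; have := @seq_lim_ip (fun k => comb a (k + n.+1)) (fun=> e n) v (e n) (e n) ((a n)%:C *: e n).
  rewrite ipZl ha; apply.
  - by move=> d /hv[N hN]; exists N => k Nk; apply: hN; rewrite (leq_trans Nk) // leq_addr.
  - by move=> d d0; exists 0%N => k _; rewrite subrr rnorm0.
  - by move=> k; rewrite comb_coef // addnS ltnS leq_addl.
rewrite -ip_sqr; apply/ler_addgt0Pr => d d0.
have v1 : 0 < rnorm v + 1 by have := rnorm_ge0 v; lra.
have q0 : 0 < Num.min 1 (d / 3 / (rnorm v + 1)) by rewrite lt_min ltr01 !divr_gt0.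
have [N hN] := hv _ q0; have := hN _ (leqnn N).
rewrite lt_min => /andP[h1 h2]; rewrite ltr_pdivlMr // in h2.
have hc : rnorm (comb a N) ^+ 2 <= M.
  have := comb_norm ha (leq0n N); rewrite {1 2}/comb big_ord0 big_ord0 !subr0 => ->.
  exact: hM.
rewrite ip_sqr.
have : rnorm v <= rnorm (comb a N) + rnorm (comb a N - v).
  by have := rnormB (comb a N) (comb a N - v); rewrite subKr.
move: hc h1 h2 v1; have := rnorm_ge0 v; have := rnorm_ge0 (comb a N).
have := rnorm_ge0 (comb a N - v).
set x := rnorm v; set y := rnorm (comb a N); set z := rnorm _ => z0 y0 x0 hc h1 h2 v1 hx.
have [xy|/ltW yx] := leP x y; first by nra.
have : (x - y) * (x + y) <= z * (2 * x) by apply: ler_pM; lra.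
by nra.
Qed.

Lemma bessel u N : \sum_(i < N) ip u (e i) ^+ 2 <= rnorm u ^+ 2.
Proof.
pose a i := ip u (e i); have ha k : a k * ip (e k) (e k) = a k by exact: coef_unit.
have h1 : ip (comb a N) u = \sum_(i < N) ip u (e i) ^+ 2.
  by rewrite ip_comb; apply: eq_bigr => i _; rewrite [ip _ u]ipC expr2.
have h2 : rnorm (comb a N) ^+ 2 = \sum_(i < N) ip u (e i) ^+ 2.
  have := comb_norm ha (leq0n N); rewrite {1}/comb [X in comb _ _ - X]big_ord0.
  by rewrite big_ord0 !subr0.
have := sqr_ge0 (rnorm (comb a N - u)); rewrite rnorm_sub h1 h2; lra.
Qed.

Lemma comb_coef_cvg u : seq_lim (comb (fun i => ip u (e i))) u.
Proof.
have [v [vc vl _]] := comb_cvg (fun k => coef_unit u k) (bessel u).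
by have vu := coef_inj vc; rewrite vu in vl.
Qed.

Lemma parseval_le u M : (forall N, \sum_(i < N) ip u (e i) ^+ 2 <= M) ->
  rnorm u ^+ 2 <= M.
Proof.
move=> hM; have [v [vc _ vM]] := comb_cvg (fun k => coef_unit u k) hM.
by rewrite -(@coef_inj v u).
Qed.

Lemma coef_bnd u v M : 0 <= M -> (forall n, `|ip u (e n)| <= M * `|ip v (e n)|) ->
  rnorm u <= M * rnorm v.
Proof.
move=> M0 h; rewrite -(@ler_pXn2r _ 2) ?nnegrE ?mulr_ge0 ?rnorm_ge0 // exprMn.
apply: parseval_le => N; apply: le_trans (ler_wpM2l _ (bessel v N)); last exact: sqr_ge0.
rewrite mulr_sumr; apply: ler_sum => i _; rewrite -exprMn -real_normK ?num_real //.
rewrite -[leRHS]real_normK ?num_real // normrM (ger0_norm M0).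
by rewrite ler_pXn2r // nnegrE ?mulr_ge0.
Qed.

(** By Parseval it suffices to compare both sides term by term. *)
Lemma ip_coef_eq u v f g : (forall n, ip u (e n) * ip f (e n) = ip v (e n) * ip g (e n)) ->
  ip u f = ip v g.
Proof.
move=> h; rewrite ipC -(ipC g); rewrite [ip g v]ipC.
apply: (seq_lim_ip (comb_coef_cvg f) (comb_coef_cvg g)) => N.
rewrite [ip v _]ipC !ip_comb; apply: eq_bigr => i _.
by rewrite [ip _ u]ipC [ip _ v]ipC [LHS]mulrC [RHS]mulrC h.
Qed.

End basis.

(** Zorn's lemma gives a maximal orthonormal set of good vectors, total by
the hypothesis on orthogonal complements. It is countable because points of a
countable dense set at distance less than [1 / 2] from two distinct orthonormal
vectors are distinct. *)
Lemma exists_total_orthogonal (good : H -> Prop) : separable_space (H := H) ->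
  good 0 -> (forall (r : R) v, good v -> good (r%:C *: v)) ->
  (forall S : set H, S `<=` good ->
     (exists2 u, u != 0 & forall v, S v -> ip u v = 0) ->
     exists w, [/\ good w, w != 0 & forall v, S v -> ip w v = 0]) ->
  exists2 e, total_orthogonal e & forall n, good (e n).
Proof.
move=> [D cD dD] good0 goodZ hext.
pose P : set (set H) := [set S | [/\ S `<=` good, forall v, S v -> ip v v = 1 &
  forall u v, S u -> S v -> u != v -> ip u v = 0]].
have [F FP FF|S [[Sg S1 So] Smax]] := @Zorn_bigcup H P.
  split.
  - by move=> v [X FX Xv]; have [h _ _] := FP _ FX; exact: h.
  - by move=> v [X FX Xv]; have [_ h _] := FP _ FX; exact: h.
  - move=> u v [X FX Xu] [Z FZ Zv].
    have [XZ|ZX] := FF X Z FX FZ.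
      by have [_ _ h] := FP _ FZ; apply: h => //; exact: XZ.
    by have [_ _ h] := FP _ FX; apply: h => //; exact: ZX.
have Stot u : (forall v, S v -> ip u v = 0) -> u = 0.
  move=> hu; apply/eqP/negP => /negP u0.
  have [|w [gw w0 hw]] := hext S Sg; first by exists u.
  have wn : 0 < rnorm w.
    rewrite lt_def rnorm_ge0 andbT; apply/eqP => /rnorm_eq0 /eqP.
    exact/negP.
  pose w1 := ((rnorm w)^-1)%:C *: w.
  have w11 : ip w1 w1 = 1.
    by rewrite /w1 ipZl ipZr ip_sqr; field; rewrite gt_eqF.
  have w1v v : S v -> ip w1 v = 0 by move=> Sv; rewrite /w1 ipZl hw // mulr0.
  apply: (Smax (S `|` [set w1])).
    split; first by move=> x; left.
    move=> /(_ w1)/=; have nS : ~ S w1 by move=> /w1v; rewrite w11 => /eqP; rewrite oner_eq0.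
    by move=> h; apply: nS; apply: h; right.
  split.
  - by move=> x [/Sg//|->]; exact: goodZ.
  - by move=> x [/S1//|->].
  - move=> x y [Sx|->] [Sy|->]; [exact: So|by move=> _; rewrite ipC w1v|by rewrite w1v|].
    by rewrite eqxx.
have /countable_injP[f finj] := cD.
have hd v : exists d, D d /\ rnorm (d - v) < 2^-1.
  have [||d [hd Dd]] := dD (ball v (2^-1 : R)%:C).
  - by exists v; apply: ballxx; rewrite ltcR invr_gt0.
  - by apply: ball_open; rewrite ltcR invr_gt0.
  exists d; split=> //; move: hd; rewrite -ball_normE /= distrC normE ltcR.
  done.
have [d dP] := choice hd.
pose g v := f (d v).
have ginj u v : S u -> S v -> g u = g v -> u = v.
  move=> Su Sv /finj; rewrite !inE => /(_ (proj1 (dP u)) (proj1 (dP v))) duv.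
  apply/eqP/negP => /negP uv; have := So _ _ Su Sv uv => ouv.
  have := ip_sqr (u - v); rewrite !ipE (ipC v u) ouv !S1 //.
  have := rnormB (d u - v) (d u - u); have [_ hu] := dP u; have [_ hv] := dP v.
  rewrite -duv in hv; rewrite opprB addrC addrA subrK.
  have := rnorm_ge0 (u - v); nra.
exists (fun n => xget 0 [set v | S v /\ g v = n]).
  split.
  - move=> m n mn; case: xgetP => [x _ [Sx gx]|]; last by rewrite ip0l.
    case: xgetP => [y _ [Sy gy]|]; last by rewrite ip0r.
    by apply: So => //; apply: contra_neq mn => xy; rewrite -gx -gy xy.
  - by move=> n; case: xgetP => [x _ [Sx gx]|]; [left; exact: S1|right].
  - move=> u hu; apply: Stot => v Sv; have := hu (g v).
    by case: xgetP => [x _ [Sx /ginj ->]//|/(_ v)] [].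
by move=> n; case: xgetP => [x _ [/Sg]|].
Qed.

(** * Eigenvectors of compact operators *)

Lemma rnorm_continuous : continuous (@rnorm R H).
Proof.
move=> x; apply/cvgrPdist_lt => d d0.
suff : nbhs x [set y | rnorm (y - x) < d].
  apply: filterS => y /= h; apply: le_lt_trans h.
  rewrite ler_norml; have := rnormB y (y - x); have := rnormD x (y - x).
  by rewrite subKr subrKC; lra.
by apply/nbhs_rnorm; exists d.
Qed.

Section top_eigenvector.
Variable D : H -> H.
Hypothesis lD : linear D.
Hypothesis sD : selfadj D.
Hypothesis D0 : forall u, 0 <= ip (D u) u.
Hypothesis Dinj : forall u, D u = 0 -> u = 0.
Hypothesis Dc : compact_op D.

(** On the closure of the image of the unit ball of the orthogonal of [S], a
compact set, the norm has a maximum [M], attained at [v]. Then [M] is the norm of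
[D] on this orthogonal, and [D (D v) = M^2 v] by the equality case of the
Cauchy-Schwarz inequality. *)
Lemma exists_eigenvector_orthogonal (S : set H) (u0 : H) :
  (forall u, (forall v, S v -> ip u v = 0) -> forall v, S v -> ip (D u) v = 0) ->
  u0 != 0 -> (forall v, S v -> ip u0 v = 0) ->
  exists v m, [/\ v != 0, 0 < m, D v = m%:C *: v & forall x, S x -> ip v x = 0].
Proof.
move=> inv u00 u0S.
have [[_ [B B0 hB]] _] : bounded_linear D /\ totally_bounded_op D by apply/compact_opP.
pose W u := forall v, S v -> ip u v = 0.
pose K := closure (D @` [set u | rnorm u <= 1 /\ W u]).
have cK : compact K.
  have [_ cD] := Dc; apply: subclosed_compact cD _; first exact: closed_closure.
  apply: closureS => _ [u [u1 _] <-]; by exists u.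
have [v] : exists2 v, v \in K & forall t, t \in K -> rnorm t <= rnorm v.
  apply: compact_EVT_max => //; last exact: continuous_subspaceT rnorm_continuous.
  exists (D 0); apply: subset_closure; exists 0 => //=; rewrite rnorm0; split=> //.
  by move=> x _; rewrite ip0l.
rewrite inE => Kv vmax; set M := rnorm v in vmax.
have M0 : 0 <= M := rnorm_ge0 v.
have hM u : W u -> rnorm (D u) <= M * rnorm u.
  move=> Wu; have [/eqP un|un] := boolP (rnorm u == 0).
    by rewrite (rnorm_eq0 un) (lin0 lD) rnorm0 mulr0.
  have up : 0 < rnorm u by rewrite lt_def un rnorm_ge0.
  have := vmax (D ((rnorm u)^-1%:C *: u)); rewrite (linZ lD) rnormZ ger0_norm ?invr_ge0 ?rnorm_ge0 //.
  rewrite mulrC ler_pdivrMr //; apply.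
  rewrite inE -(linZ lD); apply: subset_closure; exists ((rnorm u)^-1%:C *: u) => //=; split.
    by rewrite rnormZ ger0_norm ?invr_ge0 ?rnorm_ge0 // mulVf.
  by move=> x Sx; rewrite ipZl Wu // mulr0.
have Mp : 0 < M.
  rewrite lt_def M0 andbT; apply/eqP => Mz; have := hM u0 u0S; rewrite Mz mul0r => h.
  have : rnorm (D u0) = 0 by apply/eqP; rewrite eq_le h rnorm_ge0.
  by move=> /rnorm_eq0/Dinj/eqP; exact/negP.
have Wv : W v.
  move=> x Sx; apply/eqP; rewrite -normr_eq0 eq_le normr_ge0 andbT.
  apply/ler_addgt0Pr => d d0; rewrite add0r.
  have x1 : 0 < rnorm x + 1 by have := rnorm_ge0 x; lra.
  have /closure_rnorm /(_ _ (divr_gt0 d0 x1)) [_ [u [_ Wu] <-]] := Kv.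
  rewrite ltr_pdivlMr // => h; have := CauchySchwarz_abs (D u - v) x.
  rewrite ipBl inv // sub0r normrN => /le_trans; apply.
  have := rnorm_ge0 (D u - v); lra.
(* Approximate v by D u; then |D v| is almost |D (D u)|, at least |D u|^2. *)
have hDv : M ^+ 2 <= rnorm (D v).
  rewrite leNgt; apply/negP => hlt; pose f := M ^+ 2 - rnorm (D v).
  have f0 : 0 < f by rewrite subr_gt0.
  have A0 : 0 < 2 * (2 * M + B + 1) by lra.
  have /closure_rnorm /(_ _ (divr_gt0 f0 A0)) [_ [u [u1 Wu] <-]] := Kv.
  rewrite ltr_pdivlMr // => h; set t := rnorm (D u - v) in h.
  have t0 : 0 <= t := rnorm_ge0 _.
  have h1 : M - t <= rnorm (D u).
    by have := rnormB (D u) (D u - v); rewrite subKr -/M -/t; lra.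
  have h2 : rnorm (D u) ^+ 2 <= rnorm (D (D u)).
    rewrite -ip_sqr -sD; apply: le_trans (CauchySchwarz_ip _ _) _.
    by rewrite -[leRHS]mulr1 ler_wpM2l ?rnorm_ge0.
  have h3 : rnorm (D (D u)) <= rnorm (D v) + B * t.
    have := rnormD (D v) (D (D u - v)); rewrite (linB lD) subrKC => /le_trans; apply.
    by rewrite -(linB lD) lerD2l hB.
  have h4 : M ^+ 2 - 2 * M * t <= rnorm (D u) ^+ 2.
    have [tM|Mt] := leP t M; first by have := rnorm_ge0 (D u); nra.
    by have := sqr_ge0 (rnorm (D u)); nra.
  have fE : M ^+ 2 = f + rnorm (D v) by rewrite /f subrK.
  nra.
have D2v : D (D v) = (M ^+ 2)%:C *: v.
  apply/eqP; rewrite -subr_eq0; apply/eqP/rnorm_eq0/eqP.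
  rewrite -sqrf_eq0 eq_le sqr_ge0 andbT rnorm_sub rnormZ ger0_norm ?sqr_ge0 //.
  rewrite ipZr sD ip_sqr.
  have h1 := hM _ (inv _ Wv); have h2 := hM _ Wv; rewrite -/M in h2 *.
  have h3 : rnorm (D (D v)) <= M * M ^+ 2.
    by apply: le_trans h1 _; rewrite ler_wpM2l // expr2.
  have := rnorm_ge0 (D (D v)); have : M ^+ 2 * M ^+ 2 <= rnorm (D v) ^+ 2 by rewrite expr2 ler_pM ?sqr_ge0.
  move: h3; set x := rnorm (D (D v)); set y := rnorm (D v) ^+ 2 => h3 hy x0.
  have : x ^+ 2 <= (M * M ^+ 2) ^+ 2 by rewrite ler_pXn2r ?nnegrE ?mulr_ge0 ?sqr_ge0.
  have : M ^+ 2 * (M ^+ 2 * M ^+ 2) <= M ^+ 2 * y by rewrite ler_wpM2l ?sqr_ge0.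
  have -> : (M * M ^+ 2) ^+ 2 = M ^+ 6 by ring.
  have -> : M ^+ 2 * (M ^+ 2 * M ^+ 2) = M ^+ 6 by ring.
  have -> : (M ^+ 2 * M) ^+ 2 = M ^+ 6 by ring.
  by lra.
exists v, M; split=> //.
  by apply/eqP => vz; have := Mp; rewrite /M vz rnorm0 ltxx.
exact: (positive_root_eigen lD D0 Mp D2v).
Qed.

End top_eigenvector.

(** * Eigenbases of odd operators with compact resolvents *)

Variables (H0 H1 : set H) (s : H -> H).
Hypothesis s_grading : grading form H0 H1 s.
Hypothesis H_separable : @separable_space R H.

Lemma s_linear : linear s.
Proof.
have [[_ z0 c0] [_ z1 c1] o sm sy] := s_grading => a u v.
have [u0 [u1 [h0 h1 ->]]] := sm u; have [v0 [v1 [k0 k1 ->]]] := sm v.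
have hA := c0 a _ _ h0 k0; have hB := c1 a _ _ h1 k1.
by rewrite scalerDr addrACA !sy // scalerBr opprD addrACA.
Qed.

Lemma s_invol u : s (s u) = u.
Proof.
have [[_ z0 c0] [_ z1 c1] o sm sy] := s_grading.
have [u0 [u1 [h0 h1 ->]]] := sm u; rewrite sy // (_ : u0 - u1 = u0 + (-1) *: u1).
  have h1' : H1 ((-1) *: u1) by rewrite -[_ *: _]addr0; apply: c1.
  by rewrite sy // scaleN1r opprK.
by rewrite scaleN1r.
Qed.

Lemma s_selfadj : selfadj s.
Proof.
have [_ _ o sm sy] := s_grading => u v.
have o' x y : H0 x -> H1 y -> ip x y = 0 by move=> hx hy; rewrite /ip o.
have [u0 [u1 [h0 h1 ->]]] := sm u; have [v0 [v1 [k0 k1 ->]]] := sm v.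
rewrite !sy // !ipE (o' u0 v1) // (ipC u1 v0) (o' v0 u1) //; ring.
Qed.

Lemma s_isometry u : rnorm (s u) = rnorm u.
Proof.
apply/eqP; rewrite -(@eqrXn2 _ 2) ?rnorm_ge0 // -!ip_sqr.
by rewrite s_selfadj s_invol.
Qed.

Lemma s_bounded : bounded_linear s.
Proof. by split; [exact: s_linear|exists 1 => // u; rewrite mul1r s_isometry]. Qed.

Lemma scale_ii (u : H) : 'i *: ('i *: u) = - u.
Proof. by rewrite scalerA -expr2 sqr_i scaleN1r. Qed.

Lemma ip_iC u v : ip ('i *: u) v = - ip u ('i *: v).
Proof. by rewrite -ip_iM scale_ii ipNl. Qed.

Lemma scale_real_i (r : R) (u : H) : r%:C *: ('i *: u) = 'i *: (r%:C *: u).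
Proof. by rewrite !scalerA mulrC. Qed.

(** The equivalence says that [A] is the maximal diagonal operator with entries
[l] in the basis [e], so that its domain is determined as well. *)
Definition eigenbasis (A : set (H * H)) (e : nat -> H) (l : nat -> R) :=
  total_orthogonal e /\
  forall v w, A (v, w) <-> forall n, ip w (e n) = l n * ip v (e n).

Section linear_operators.
Variable A : set (H * H).
Hypothesis lA : linear_operator A.
Hypothesis A0 : exists p, A p.

Lemma lop0 : A (0, 0).
Proof.
have [[u v] h] := A0; have [_ lin] := lA; have := lin (-1) _ _ _ _ h h.
by rewrite !scaleN1r !addNr.
Qed.

Lemma lopZ a u v : A (u, v) -> A (a *: u, a *: v).
Proof.
by move=> h; have [_ lin] := lA; have := lin a _ _ _ _ h lop0; rewrite !addr0.
Qed.

Lemma lopN u v : A (u, v) -> A (- u, - v).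
Proof. by move=> /(lopZ (-1)); rewrite !scaleN1r. Qed.

Lemma lopD u v u' v' : A (u, v) -> A (u', v') -> A (u + u', v + v').
Proof.
by move=> h h'; have [_ lin] := lA; have := lin 1 _ _ _ _ h h'; rewrite !scale1r.
Qed.

Lemma lopB u v u' v' : A (u, v) -> A (u', v') -> A (u - u', v - v').
Proof. by move=> h /lopN; exact: lopD. Qed.

Lemma lop_fun u v w : A (u, v) -> A (u, w) -> v = w.
Proof. by have [h _] := lA; exact: h. Qed.

End linear_operators.

Section compact_resolvents.
Variable A : set (H * H).
Hypothesis A_RK1 : RK1 form s A.

Lemma RK1_linear : linear_operator A.
Proof. by have [[[h _ _] _ _] _] := A_RK1. Qed.

Lemma RK1_inhabited : exists p, A p.
Proof.
have [[[_ _ d] _ _] _] := A_RK1.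
have [|u [_ [v h]]] := d setT _ openT; first by exists 0.
by exists (u, v).
Qed.

Let lA := RK1_linear.
Let A0 := RK1_inhabited.

Lemma RK1_sym v w v' w' : A (v, w) -> A (v', w') -> ip w v' = ip v w'.
Proof.
have [[_ ad _] _] := A_RK1 => h; rewrite -{1}ad => /(_ _ _ h) /= h'.
by rewrite /ip h'.
Qed.

Lemma RK1_odd v w : A (v, w) -> A (s v, - s w).
Proof.
have [_ od] := A_RK1 => h.
suff : gcomp A (graph s) (v, - s w) by case=> x; rewrite /graph /= => ->.
by rewrite od; exists w.
Qed.

Lemma RK1_resolvent : exists K, [/\ bounded_linear K, totally_bounded_op K,
  forall u, A (K u, u - 'i *: K u) & forall v w, A (v, w) -> K (w + 'i *: v) = v].
Proof.
have [[_ _ [K cK hK]] _] := A_RK1; exists K.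
have [bK tK] : bounded_linear K /\ totally_bounded_op K by apply/compact_opP.
split=> //.
  move=> u; have : graph K (u, K u) by [].
  rewrite -hK => -[v [w]]; rewrite /graph /= => -[h1 e1 uE].
  suff -> : u - 'i *: K u = v by [].
  by rewrite {1}uE e1 addrK.
move=> v w h; have : graph K (w + 'i *: v, v); last by rewrite /graph /= => /esym.
by rewrite -hK; exists w, ('i *: v).
Qed.

(** The adjoint of [K = (A + i)^-1] is [K' = (A - i)^-1], which equals [- s K s]
since [A] is odd; hence [D = K K' = (1 + A^2)^-1] is compact, positive and
injective. It preserves the orthogonal of any set of eigenvectors of [A], so
that it has an eigenvector [v] there, say with eigenvalue [m]. Put [w = A v]; then
[A w = n^2 v] with [n^2 = 1 / m - 1], and one of [n v + w], [n v - w] and [v] is a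
nonzero eigenvector of [A]. Maximality of the diagonal operator follows from
[K (w + i v) = v]. *)
Lemma RK1_eigenbasis : exists e l, eigenbasis A e l.
Proof.
have [K [bK tK KA KI]] := RK1_resolvent.
have [lK _] := bK; have ls := s_linear.
pose K' u := - s (K (s u)).
have K'A u : A (K' u, u + 'i *: K' u).
  have := lopN lA A0 (RK1_odd (KA (s u))).
  rewrite opprK (linB ls) (linZ ls) s_invol /K' scalerN; exact.
have K'I v w : A (v, w) -> K' (w - 'i *: v) = v.
  move=> /RK1_odd/KI; rewrite /K' (linB ls) (linZ ls) => h.
  by rewrite -(linN ls) -(linN lK) opprB addrC h s_invol.
have adj u v : ip (K u) v = ip u (K' v).
  have := RK1_sym (KA u) (K'A v).
  by rewrite ipBl ipDr ip_iC opprK; lra.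
have lK' : linear K'.
  move=> a u v; rewrite /K' (linD ls) (linZ ls) (linD lK) (linZ lK) (linD ls) (linZ ls).
  by rewrite opprD scalerN.
have [_ [M M0 hM]] := bK.
have bK' : bounded_linear K'.
  split=> //; exists M => // u; rewrite /K' rnormN s_isometry.
  by apply: le_trans (hM _) _; rewrite s_isometry.
pose D := K \o K'.
have lD : linear D by exact: linear_comp.
have sD : selfadj D by move=> u v; rewrite /D /= adj [RHS]ipC adj ipC.
have Dp u : 0 <= ip (D u) u by rewrite /D /= adj ip_ge0.
have Dinj u : D u = 0 -> u = 0.
  rewrite /D /= => h; have h' : K' u = 0 by apply: ip_eq0; rewrite -adj h ip0l.
  have := K'A u; rewrite h' scaler0 addr0 => /(lop_fun lA (lop0 lA A0)).
  by move=> <-.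
have cD : compact_op D.
  apply/compact_opP; split; first exact: bounded_linear_comp.
  exact: totally_bounded_compr.
have DA u : exists b, A (D u, b) /\ A (b, u - D u).
  exists (K' u - 'i *: D u); split; first exact: KA.
  have := lopB lA A0 (K'A u) (lopZ lA A0 'i (KA (K' u))).
  rewrite (_ : u + _ - _ = u - D u) // scalerBr scale_ii.
  by apply: ip_inj => x; rewrite /D /= !ipE; ring.
have K'e (l : R) v : A (v, l%:C *: v) -> K' v = (1 + l ^+ 2)^-1%:C *: (l%:C *: v + 'i *: v).
  move=> /K'I h; have l1 : 0 < 1 + l ^+ 2 by have := sqr_ge0 l; lra.
  rewrite -{2 3}h -(linZ lK') -!(linZ lK') -(linD lK') -(linZ lK'); congr K'.
  rewrite (_ : l%:C *: _ + _ = (1 + l ^+ 2)%:C *: v).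
    by apply: ip_inj => x; rewrite !ipE; field; exact: lt0r_neq0.
  by rewrite !scalerBr scale_ii scale_real_i; apply: ip_inj => x; rewrite !ipE; ring.
have De (l : R) v : A (v, l%:C *: v) -> D v = (1 + l ^+ 2)^-1%:C *: v.
  move=> h; rewrite /D /= (K'e l v h) (linZ lK); congr (_ *: _).
  exact: KI.
have [||S Sg [u u0 uS]|e be eg] := @exists_total_orthogonal (fun v => exists l : R, A (v, l%:C *: v)) H_separable.
- by exists 0; rewrite scale0r; exact: lop0.
- move=> r v [l h]; exists l.
  by have := lopZ lA A0 r%:C h; rewrite !scalerA [r%:C * _]mulrC.
- have [|v [m [v0 m0 Dv vS]]] := exists_eigenvector_orthogonal lD sD Dp Dinj cD (S := S) _ u0 uS.
    move=> x hx v Sv; have [l hl] := Sg _ Sv.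
    by rewrite sD (De _ _ hl) ipZr hx // mulr0.
  have [b [h1 h2]] := DA v; rewrite Dv in h1 h2.
  have [w wE] : exists w, w = m^-1%:C *: b by exists (m^-1%:C *: b).
  have hv : A (v, w).
    have := lopZ lA A0 m^-1%:C h1.
    by rewrite scalerA -rmorphM mulVf ?gt_eqF // rmorph1 scale1r -wE.
  have hw : A (w, (m^-1 - 1)%:C *: v).
    have := lopZ lA A0 m^-1%:C h2.
    rewrite scalerBr scalerA -rmorphM mulVf ?gt_eqF // rmorph1 scale1r -wE.
    by rewrite rmorphB rmorph1 scalerBl scale1r.
  have wS x : S x -> ip w x = 0.
    move=> Sx; have [l hl] := Sg _ Sx; rewrite (RK1_sym hv hl) ipZr vS //.
    by rewrite mulr0.
  have n2 : 0 <= m^-1 - 1.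
    have := RK1_sym hv hw; rewrite [RHS]ipZr => h.
    have vp : 0 < ip v v.
      rewrite lt_def ip_ge0 andbT; apply/eqP => /ip_eq0 /eqP; exact/negP.
    by rewrite -(pmulr_lge0 _ vp) -h ip_ge0.
  pose n := Num.sqrt (m^-1 - 1).
  have nE : n ^+ 2 = m^-1 - 1 by rewrite sqr_sqrtr.
  have hvn : A (n%:C *: v, n%:C *: w) by exact: lopZ.
  have hgood (eps : R) : eps ^+ 2 = 1 -> A (n%:C *: v + eps%:C *: w, (eps * n)%:C *: (n%:C *: v + eps%:C *: w)).
    move=> e1; have := lopD lA hvn (lopZ lA A0 eps%:C hw).
    rewrite (_ : n%:C *: w + _ = (eps * n)%:C *: (n%:C *: v + eps%:C *: w)) //.
    apply: ip_inj => x; rewrite !ipE -nE.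
    by rewrite (_ : eps * n * (n * ip v x + eps * ip w x) = eps * (n ^+ 2 * ip v x) + eps ^+ 2 * (n * ip w x)); [rewrite e1; ring|ring].
  have hS (eps : R) x : S x -> ip (n%:C *: v + eps%:C *: w) x = 0.
    by move=> Sx; rewrite !ipE vS // wS // !mulr0 addr0.
  have [p0|p0] := eqVneq (n%:C *: v + 1%:C *: w) 0; last first.
    exists (n%:C *: v + 1%:C *: w); split=> //; last exact: hS.
    by exists (1 * n); apply: hgood; rewrite expr1n.
  have [m0'|m0'] := eqVneq (n%:C *: v + (-1)%:C *: w) 0; last first.
    exists (n%:C *: v + (-1)%:C *: w); split=> //; last exact: hS.
    by exists (-1 * n); apply: hgood; rewrite sqrrN expr1n.
  have w0 : w = 0.
    apply: ip_inj => x; have := congr1 (fun y => ip y x) p0.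
    by have := congr1 (fun y => ip y x) m0'; rewrite !ipE; lra.
  exists v; split=> //; exists 0; rewrite scale0r.
  by rewrite -w0.
have [l hl] := choice eg.
exists e, l; split=> // v w; split=> [h n|h].
  by rewrite (RK1_sym h (hl n)) ipZr.
have wf f n : ip w f = l n * ip v f <-> ip (w - (l n)%:C *: v) f = 0.
  by rewrite ipBl ipZl; split=> [->|/eqP]; rewrite ?subrr // subr_eq0 => /eqP.
(* The coefficients of w on i e n, which occur in K' (e n). *)
have wi n : ip w ('i *: e n) = l n * ip v ('i *: e n).
  rewrite -ipZl; apply: (ip_coef_eq be) => m; rewrite h ipZl.
  have := RK1_sym (lopZ lA A0 'i (hl n)) (hl m).
  rewrite -scale_real_i ipZl ipZr => hh.
  by rewrite -mulrA [ip v _ * _]mulrC mulrA -hh; ring.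
have KE : K (w + 'i *: v) = v.
  apply: (coef_inj be) => n; rewrite adj (K'e _ _ (hl n)).
  have l1 : 0 < 1 + l n ^+ 2 by have := sqr_ge0 (l n); lra.
  rewrite !ipE ip_iM !ip_iC h wi; field; exact: lt0r_neq0.
have := KA (w + 'i *: v); rewrite KE.
by rewrite addrK.
Qed.

End compact_resolvents.

(** * Eigenbases: functional calculus, bounded transform, spectral measure *)

Section moments.
Variable mu : {measure set (measurableTypeR R) -> \bar R}.
Hypothesis mu_fin : (mu setT < +oo)%E.
Hypothesis mu2 : (\int[mu]_t (t ^+ 2)%:E < +oo)%E.

Lemma measurable_sqr (c : R) :
  measurable_fun setT (fun t : measurableTypeR R => ((t - c) ^+ 2)%:E).
Proof.
apply/measurable_EFinP; apply: measurable_funX.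
by apply: measurable_funB => //; exact: measurable_id.
Qed.

Lemma integrable_one : mu.-integrable setT (fun=> 1%:E).
Proof.
apply/integrableP; split; first exact: measurable_cst.
by rewrite integral_cst //= normr1 mul1e.
Qed.

Lemma integrable_sqr : mu.-integrable setT (fun t : measurableTypeR R => (t ^+ 2)%:E).
Proof.
apply/integrableP; split.
  by have := measurable_sqr 0; under eq_fun do rewrite subr0.
rewrite (_ : (\int[mu]_t _)%E = (\int[mu]_t (t ^+ 2)%:E)%E) //.
by apply: eq_integral => t _ /=; rewrite ger0_norm // sqr_ge0.
Qed.

Lemma integrable_id : mu.-integrable setT (fun t : measurableTypeR R => t%:E).
Proof.
have h := integrableD measurableT integrable_one integrable_sqr.
apply: le_integrable h => //; first by apply/measurable_EFinP; exact: measurable_id.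
move=> t _ /=; rewrite lee_fin [leRHS]ger0_norm ?addr_ge0 ?sqr_ge0 //.
rewrite ler_norml; have := sqr_ge0 (t - 1); have := sqr_ge0 (t + 1); nra.
Qed.

Lemma integral_shift (c : R) :
  (\int[mu]_t ((t - c) ^+ 2) = \int[mu]_t (t ^+ 2) - (2 * c) * \int[mu]_t t + c ^+ 2 * fine (mu setT))%R.
Proof.
have i1 : mu.-integrable setT (EFin \o (fun=> 1 : R)) := integrable_one.
have i2 : mu.-integrable setT (EFin \o (fun t : measurableTypeR R => t ^+ 2)) := integrable_sqr.
have i3 : mu.-integrable setT (EFin \o (fun t : measurableTypeR R => t)) := integrable_id.
have i4 : mu.-integrable setT (EFin \o (fun t : measurableTypeR R => 2 * c * t)).
  exact: (integrableZl measurableT (2 * c) i3).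
have i5 : mu.-integrable setT (EFin \o (fun=> c ^+ 2 * 1)).
  exact: (integrableZl measurableT (c ^+ 2) i1).
have i6 : mu.-integrable setT (EFin \o (fun t : measurableTypeR R => t ^+ 2 - 2 * c * t)).
  exact: (integrableB measurableT i2 i4).
transitivity (\int[mu]_t (t ^+ 2 - (2 * c) * t + c ^+ 2 * 1))%R.
  by apply: eq_Rintegral => t _; ring.
rewrite (RintegralD measurableT i6 i5) (RintegralB measurableT i2 i4).
rewrite (RintegralZl _ measurableT i3) (RintegralZl _ measurableT i1).
congr (_ + _ * _).
by rewrite Rintegral_cst //= mul1r.
Qed.

Lemma integrable_shift (c : R) :
  mu.-integrable setT (fun t : measurableTypeR R => ((t - c) ^+ 2)%:E).
Proof.
have i1 : mu.-integrable setT (EFin \o (fun=> 1 : R)) := integrable_one.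
have i2 : mu.-integrable setT (EFin \o (fun t : measurableTypeR R => t ^+ 2)) := integrable_sqr.
have i3 : mu.-integrable setT (EFin \o (fun t : measurableTypeR R => t)) := integrable_id.
have i4 := integrableZl measurableT (2 * c) i3.
have i5 := integrableZl measurableT (c ^+ 2) i1.
apply: eq_integrable (integrableD measurableT (integrableB measurableT i2 i4) i5) => //.
by move=> t _ /=; rewrite -!EFinM -EFinB -EFinD; congr (_%:E); ring.
Qed.

(** The moment conditions say that the variance of [mu] around [c] is zero. *)
Lemma mu_concentrated (c : R) (S : set (measurableTypeR R)) : measurable S -> S c ->
  (\int[mu]_t t = c * fine (mu setT))%R -> (\int[mu]_t (t ^+ 2) = c ^+ 2 * fine (mu setT))%R ->
  mu (~` S) = 0%E.
Proof.
move=> mS Sc h1 h2.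
have h0 : (\int[mu]_t `|((t - c) ^+ 2)%:E| = 0)%E.
  transitivity (\int[mu]_t ((t - c) ^+ 2)%:E)%E.
    by apply: eq_integral => t _ /=; rewrite ger0_norm // sqr_ge0.
  rewrite -[LHS]fineK; last exact: integrable_fin_num (integrable_shift c).
  congr (_%:E); have := integral_shift c; rewrite h1 h2 /Rintegral => ->; ring.
have [ha _] := ae_eq_integral_abs mu measurableT (measurable_sqr c).
have [N [mN N0 hN]] := ha h0.
apply: (subset_measure0 _ mN _ N0); first exact: measurableC.
move=> t St; apply: hN => /=; apply/not_implyP; split=> //.
move=> /eqP; rewrite eqe sqrf_eq0 subr_eq0 => /eqP tc.
by apply: St; rewrite tc.
Qed.

End moments.

Section eigenbasis_theory.
Variables (A : set (H * H)) (e : nat -> H) (l : nat -> R).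
Hypothesis eA : eigenbasis A e l.
Hypothesis lA : linear_operator A.

Let be : total_orthogonal e := proj1 eA.

Lemma eigenP v w : A (v, w) <-> forall n, ip w (e n) = l n * ip v (e n).
Proof. exact: (proj2 eA). Qed.

Lemma eigen0 : A (0, 0).
Proof. by apply/eigenP => n; rewrite ip0l mulr0. Qed.

Lemma eigen_basis n : A (e n, (l n)%:C *: e n).
Proof.
apply/eigenP => m; rewrite ipZl; have [->//|nm] := eqVneq n m.
by have [h _ _] := be; rewrite h // !mulr0.
Qed.

Lemma eigen_coef (r : R) v n : A (v, r%:C *: v) -> ip v (e n) = 0 \/ l n = r.
Proof.
move=> /eigenP /(_ n); rewrite ipZl => /eqP.
by rewrite -subr_eq0 -mulrBl mulf_eq0 subr_eq0 => /orP[/eqP->|/eqP]; [right|left].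
Qed.

(** A multiplication operator acts by [phi r] on every eigenvector for [r], and
not only on those of the basis. *)
Lemma ip_eigen (u v f : H) (phi : R -> R) (r : R) : A (f, r%:C *: f) ->
  (forall n, ip v (e n) = phi (l n) * ip u (e n)) -> ip v f = phi r * ip u f.
Proof.
move=> Af h; rewrite -ipZl; apply: (ip_coef_eq be) => n; rewrite h ipZl.
by have [->|->//] := eigen_coef n Af; rewrite !mulr0.
Qed.

Lemma eigen_basis_i n : A ('i *: e n, (l n)%:C *: ('i *: e n)).
Proof.
rewrite scale_real_i; apply: (lopZ lA) (eigen_basis n).
by exists (0, 0); exact: eigen0.
Qed.

(** [phi A], by its coefficients in the eigenbasis. *)
Definition fcalc (phi : R -> R) (u : H) : H :=
  xget 0 [set v | forall n, ip v (e n) = phi (l n) * ip u (e n)].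

Section functional_calculus.
Variables (phi : R -> R) (M : R).
Hypothesis M0 : 0 <= M.
Hypothesis phiM : forall n, `|phi (l n)| <= M.

Lemma fcalcE u n : ip (fcalc phi u) (e n) = phi (l n) * ip u (e n).
Proof.
rewrite /fcalc; case: xgetP => [//|no].
pose a k := phi (l k) * ip u (e k).
have [||v [hv _ _]] := @comb_cvg e be a (M ^+ 2 * rnorm u ^+ 2).
- by move=> k; rewrite /a -mulrA (coef_unit be).
- move=> N; apply: le_trans (ler_wpM2l (sqr_ge0 M) (bessel be u N)).
  rewrite mulr_sumr; apply: ler_sum => i _; rewrite /a exprMn.
  rewrite ler_wpM2r ?sqr_ge0 // -[leLHS]real_normK ?num_real //.
  by rewrite ler_pXn2r // nnegrE.
- by case: (no v).
Qed.

Lemma fcalc_unique u v : (forall n, ip v (e n) = phi (l n) * ip u (e n)) ->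
  fcalc phi u = v.
Proof. by move=> h; apply: (coef_inj be) => n; rewrite fcalcE h. Qed.

Lemma fcalc_ip_eigen u f r : A (f, r%:C *: f) -> ip (fcalc phi u) f = phi r * ip u f.
Proof. by move=> h; apply: (ip_eigen h) => n; exact: fcalcE. Qed.

(** The basis is orthonormal over the reals only; linearity over the complex
numbers holds because [i e n] is an eigenvector for [l n] too. *)
Lemma fcalc_i u : fcalc phi ('i *: u) = 'i *: fcalc phi u.
Proof.
apply: fcalc_unique => n; rewrite !ip_iC (fcalc_ip_eigen _ (eigen_basis_i n)); ring.
Qed.

Lemma fcalc_linear : linear (fcalc phi).
Proof.
have fD u v : fcalc phi (u + v) = fcalc phi u + fcalc phi v.
  by apply: fcalc_unique => n; rewrite !ipDl !fcalcE mulrDr.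
have fZ (r : R) u : fcalc phi (r%:C *: u) = r%:C *: fcalc phi u.
  by apply: fcalc_unique => n; rewrite !ipZl !fcalcE; ring.
move=> a u v; rewrite fD (complexE a) !scalerDl fD fZ -!scalerA.
by rewrite fcalc_i fZ.
Qed.

Lemma fcalc_bnd : bnd (fcalc phi) M.
Proof.
by move=> u; apply: (coef_bnd be) => // n; rewrite fcalcE normrM ler_wpM2r.
Qed.

Lemma fcalc_bounded : bounded_linear (fcalc phi).
Proof. by split; [exact: fcalc_linear|exists M => //; exact: fcalc_bnd]. Qed.

Lemma fcalc_selfadj : selfadj (fcalc phi).
Proof.
by move=> u v; apply: (ip_coef_eq be) => n; rewrite !fcalcE; ring.
Qed.

End functional_calculus.

(** The scalar bounded transform; [bti A] below is the square root that occurs in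
the definition of the bounded transform of [A]. *)
Definition bt (t : R) : R := t / Num.sqrt (1 + t ^+ 2).
Definition bti (t : R) : R := (Num.sqrt (1 + t ^+ 2))^-1.

Lemma sqrt1_gt0 (t : R) : 0 < Num.sqrt (1 + t ^+ 2).
Proof. by rewrite sqrtr_gt0; have := sqr_ge0 t; lra. Qed.

Lemma bti_sq t : bti t ^+ 2 = (1 + t ^+ 2)^-1.
Proof. by rewrite /bti exprVn sqr_sqrtr //; have := sqr_ge0 t; lra. Qed.

Lemma bti_gt0 t : 0 < bti t.
Proof. by rewrite /bti invr_gt0 sqrt1_gt0. Qed.

Lemma bt_bti t : bt t = t * bti t.
Proof. by []. Qed.

Lemma bt_sq t : 1 - bt t ^+ 2 = (1 + t ^+ 2)^-1.
Proof.
rewrite bt_bti exprMn bti_sq; have h : 0 < 1 + t ^+ 2 by have := sqr_ge0 t; lra.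
by field; exact: lt0r_neq0.
Qed.

Lemma bt_norm t : `|bt t| < 1.
Proof.
rewrite -(@ltr_pXn2r _ 2) ?nnegrE // expr1n real_normK ?num_real //.
have h : 0 < (1 + t ^+ 2)^-1 by rewrite invr_gt0; have := sqr_ge0 t; lra.
by rewrite -(bt_sq t) in h; lra.
Qed.

Lemma bti_norm t : `|bti t| <= 1.
Proof.
rewrite gtr0_norm ?bti_gt0 // /bti invf_le1 ?sqrt1_gt0 //.
rewrite -{1}sqrtr1 ler_wsqrtr //; have := sqr_ge0 t; lra.
Qed.

Hypothesis saA : adjoint form A = A.

Let bt1 n : `|bt (l n)| <= 1.
Proof. exact/ltW/bt_norm. Qed.
Let bti1 n : `|bti (l n)| <= 1.
Proof. exact: bti_norm. Qed.

Lemma bti_sq_coef u w y : A (u, y) -> A (y, w) ->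
  forall n, ip u (e n) = (1 + l n ^+ 2)^-1 * ip (u + w) (e n).
Proof.
move=> /eigenP h1 /eigenP h2 n; rewrite ipDl h2 h1.
have h : 0 < 1 + l n ^+ 2 by have := sqr_ge0 (l n); lra.
by field; exact: lt0r_neq0.
Qed.

Lemma bounded_transform_exists : is_bounded_transform form A (fcalc bt).
Proof.
have cB u n := fcalcE ler01 bti1 u n.
have cF u n := fcalcE ler01 bt1 u n.
exists (fcalc bti); split.
- split.
    apply/selfadjoint_boundedP; split; first exact: (fcalc_bounded ler01 bti1).
    exact: (fcalc_selfadj ler01 bti1).
  move=> u; rewrite selfadj_form_real; [|exact: (fcalc_linear ler01 bti1)|exact: (fcalc_selfadj ler01 bti1)].
  rewrite ler0c; pose c t := Num.sqrt (bti t).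
  have c1 n : `|c (l n)| <= 1.
    rewrite ger0_norm ?sqrtr_ge0 // /c -[leRHS]sqrtr1 ler_wsqrtr //.
    by rewrite (le_trans (ler_norm _)) // bti_norm.
  have -> : ip (fcalc bti u) u = ip (fcalc c u) (fcalc c u).
    apply: (ip_coef_eq be) => n; rewrite cB !(fcalcE ler01 c1).
    rewrite (_ : c (l n) * _ * _ = (c (l n) ^+ 2) * ip u (e n) * ip u (e n)); last by ring.
    by rewrite /c sqr_sqrtr // ltW // bti_gt0.
  exact: ip_ge0.
- rewrite saA; apply/seteqP; split=> -[p q] /=.
    move=> [v [w]]; rewrite /graph /= => -[-> [y h1 h2] ->].
    apply: (coef_inj be) => n; rewrite !cB mulrA -expr2 bti_sq.
    exact: bti_sq_coef h1 h2 n.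
  rewrite /graph /= => qE.
  have qc n : ip q (e n) = (1 + l n ^+ 2)^-1 * ip p (e n).
    by rewrite qE !cB mulrA -expr2 bti_sq.
  exists q, (p - q); split=> //; last by rewrite addrC subrK.
  exists (fcalc bt (fcalc bti p)); apply/eigenP => n.
    by rewrite cF cB qc bt_bti -bti_sq expr2; ring.
  rewrite cF cB ipBl qc bt_bti -bti_sq.
  have h : 0 < 1 + l n ^+ 2 by have := sqr_ge0 (l n); lra.
  rewrite (_ : l n * _ = (l n ^+ 2 * bti (l n) ^+ 2) * ip p (e n)); last by ring.
  rewrite bti_sq; field; exact: lt0r_neq0.
- apply/seteqP; split=> -[p q] /=.
    move=> [w]; rewrite /graph /= => -> /eigenP h.
    by apply: (coef_inj be) => n; rewrite h cF cB bt_bti mulrA.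
  rewrite /graph /= => ->; exists (fcalc bti p) => //.
  by apply/eigenP => n; rewrite cF cB bt_bti mulrA.
Qed.

(** A positive square root of [(1 + A^2)^-1] acts on [e n] by the positive square
root of the eigenvalue, hence the bounded transform is unique. *)
Lemma bounded_transform_coef F : is_bounded_transform form A F ->
  forall u n, ip (F u) (e n) = bt (l n) * ip u (e n).
Proof.
move=> [B [[/selfadjoint_boundedP[[lB _] sB] B0] hB hF]] u n.
have Bp v : 0 <= ip (B v) v.
  by have := B0 v; rewrite selfadj_form_real // ler0c.
have h1 : 0 < 1 + l n ^+ 2 by have := sqr_ge0 (l n); lra.
have Ben : B (e n) = (bti (l n))%:C *: e n.
  apply: (positive_root_eigen lB Bp (bti_gt0 _)); rewrite bti_sq.
  have : graph (B \o B) ((1 + l n ^+ 2)%:C *: e n, e n).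
    rewrite -hB; exists (e n), ((l n ^+ 2)%:C *: e n); split=> //=; last first.
      by rewrite rmorphD rmorph1 scalerDl scale1r.
    exists ((l n)%:C *: e n); rewrite ?saA; first exact: eigen_basis.
    rewrite expr2 rmorphM -scalerA; apply: (lopZ lA) (eigen_basis n).
    by exists (0, 0); exact: eigen0.
  rewrite /graph /= => h; rewrite {2}h !(linZ lB) scalerA -rmorphM mulVf ?gt_eqF //.
  by rewrite rmorph1 scale1r.
have : graph F (u, F u) by [].
rewrite -hF => -[w]; rewrite /graph /= => -> /eigenP ->.
by rewrite sB Ben ipZr bt_bti mulrA.
Qed.

Lemma bounded_transformE u n :
  ip (bounded_transform form A u) (e n) = bt (l n) * ip u (e n).
Proof.
apply: bounded_transform_coef; apply: (@getPex _ [set F | is_bounded_transform form A F]).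
by exists (fcalc bt); exact: bounded_transform_exists.
Qed.

Lemma bounded_transform_fcalc : bounded_transform form A = fcalc bt.
Proof.
apply/funext => u; apply: (coef_inj be) => n.
by rewrite bounded_transformE (fcalcE ler01 bt1).
Qed.

Lemma eigen_sym v w v' w' : A (v, w) -> A (v', w') -> ip w v' = ip v w'.
Proof.
by move=> /eigenP h /eigenP h'; apply: (ip_coef_eq be) => n; rewrite h h'; ring.
Qed.

Lemma parseval_series u :
  (\sum_(0 <= n <oo) ((ip u (e n)) ^+ 2)%:E = (rnorm u ^+ 2)%:E)%E.
Proof.
have p0 n : true -> (0%R <= ((ip u (e n)) ^+ 2)%:E)%E by move=> _; rewrite lee_fin sqr_ge0.
have le1 : (\sum_(0 <= n <oo) ((ip u (e n)) ^+ 2)%:E <= (rnorm u ^+ 2)%:E)%E.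
  apply: lime_le; first by apply: is_cvg_nneseries => *; rewrite lee_fin sqr_ge0.
  by apply: nearW => N; rewrite sumEFin lee_fin big_mkord (bessel be).
have ge0 : (0%R <= \sum_(0 <= n <oo) ((ip u (e n)) ^+ 2)%:E)%E.
  by apply: nneseries_ge0 => *; rewrite lee_fin sqr_ge0.
apply/eqP; rewrite eq_le le1 /=.
have fin : (\sum_(0 <= n <oo) ((ip u (e n)) ^+ 2)%:E \is a fin_num)%E.
  by rewrite ge0_fin_numE // (le_lt_trans le1) // ltry.
rewrite -(fineK fin) lee_fin; apply: (parseval_le be) => N.
rewrite -lee_fin fineK // -(big_mkord xpredT (fun i => ip u (e i) ^+ 2)) -sumEFin.
by apply: nneseries_lim_ge => n _ _; exact: p0.
Qed.

Definition spectral_mass u n : {nonneg R} := NngNum (sqr_ge0 (ip u (e n))).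

(** The measure [S |-> ip (1_S(A) u) u], a series of point masses at the
eigenvalues. *)
Definition spectral_mu (u : H) : {measure set (measurableTypeR R) -> \bar R} :=
  mseries (fun n => mscale (spectral_mass u n) (dirac (l n : measurableTypeR R))) 0.

Lemma integral_spectral_mu u (g : measurableTypeR R -> R) :
  measurable_fun setT g -> (forall t, 0 <= g t) ->
  (\int[spectral_mu u]_t (g t)%:E = \sum_(0 <= n <oo) (g (l n) * ip u (e n) ^+ 2)%:E)%E.
Proof.
move=> mg g0; have mg' : measurable_fun setT (fun t : measurableTypeR R => (g t)%:E).
  exact/measurable_EFinP.
rewrite ge0_integral_measure_series //; last by move=> t _; rewrite lee_fin.
apply: eq_eseriesr => n _.
rewrite ge0_integral_mscale //; last by move=> t _; rewrite lee_fin.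
by rewrite integral_dirac // diracT mul1e /= -EFinM mulrC.
Qed.

Lemma spectral_muE u (S : set (measurableTypeR R)) :
  spectral_mu u S = (\sum_(0 <= n <oo) (\1_S (l n) * ip u (e n) ^+ 2)%:E)%E.
Proof.
apply: eq_eseriesr => n _.
transitivity ((ip u (e n) ^+ 2)%:E * (dirac (l n : measurableTypeR R) S : \bar R))%E => //.
by rewrite diracE -EFinM mulrC indicE.
Qed.

Lemma indic_le1 (S : set R) n : `|\1_S (l n) : R| <= 1.
Proof. by rewrite indicE; case: (_ \in _); rewrite ?normr1 ?normr0. Qed.

(** The first moment of [spectral_mu u] is obtained by polarization from the
second moments around [0] and [-1], since only integrals of nonnegative functions
against a series of measures are computed directly. *)
Lemma spectral_measure_exists : is_spectral_measure form A (fun S => fcalc \1_S).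
Proof.
have cE S u n := fcalcE ler01 (indic_le1 S) u n.
have idem S u : fcalc \1_S (fcalc \1_S u) = fcalc \1_S u.
  apply: (coef_inj be) => n; rewrite !cE indicE.
  by case: (_ \in _); rewrite ?mul1r ?mul0r.
have sE S : selfadj (fcalc \1_S) := fcalc_selfadj ler01 (indic_le1 S).
have mX : measurable_fun setT (fun t : measurableTypeR R => t ^+ 2).
  by apply: measurable_funX; exact: measurable_id.
have i2 u : (\int[spectral_mu u]_t (t ^+ 2)%:E =
    \sum_(0 <= n <oo) ((l n * ip u (e n)) ^+ 2)%:E)%E.
  rewrite (integral_spectral_mu u mX) => [|t]; last exact: sqr_ge0.
  by apply: eq_eseriesr => n _; rewrite exprMn.
have i2A u v : A (u, v) -> (\int[spectral_mu u]_t (t ^+ 2)%:E = (rnorm v ^+ 2)%:E)%E.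
  move=> /eigenP h; rewrite i2 -parseval_series.
  by apply: eq_eseriesr => n _; rewrite h.
have muT u : spectral_mu u setT = (rnorm u ^+ 2)%:E.
  rewrite spectral_muE -parseval_series.
  by apply: eq_eseriesr => n _; rewrite indicE in_setT mul1r.
split.
- move=> S _; apply/projectionP; split=> //.
  exact: (fcalc_bounded ler01 (indic_le1 S)).
- apply/funext => u; apply: (coef_inj be) => n.
  by rewrite cE indicE in_setT mul1r.
- exists spectral_mu; split.
  + move=> u S _; rewrite -/(ip (fcalc \1_S u) u) -idem sE ip_sqr -parseval_series.
    rewrite spectral_muE; apply: eq_eseriesr => n _; rewrite cE exprMn indicE.
    by case: (_ \in _) => /=; congr (_%:E); ring.
  + move=> u; split=> [[v /i2A ->]|]; first exact: ltry.
    rewrite i2 => h; have ge0 : (0%R <= \sum_(0 <= n <oo) ((l n * ip u (e n)) ^+ 2)%:E)%E.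
      by apply: nneseries_ge0 => n _ _; rewrite lee_fin sqr_ge0.
    have fin : (\sum_(0 <= n <oo) ((l n * ip u (e n)) ^+ 2)%:E \is a fin_num)%E.
      by rewrite ge0_fin_numE.
    pose a k := l k * ip u (e k).
    have [||v [hv _ _]] := @comb_cvg e be a (fine (\sum_(0 <= n <oo) ((l n * ip u (e n)) ^+ 2)%:E)%E).
    * by move=> k; rewrite /a -mulrA (coef_unit be).
    * move=> N; rewrite -lee_fin fineK // -(big_mkord xpredT (fun i => a i ^+ 2)) -sumEFin.
      by apply: nneseries_lim_ge => n _ _; rewrite lee_fin sqr_ge0.
    * by exists v; apply/eigenP.
  + move=> u v Auv; rewrite form_ipE.
    have Ai : A ('i *: u, 'i *: v).
      by apply: (lopZ lA) Auv; exists (0, 0); exact: eigen0.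
    have -> : ip v ('i *: u) = 0.
      have := eigen_sym Auv Ai; have := ip_iC u v; rewrite [ip ('i *: u) v]ipC; lra.
    congr Complex; have fmu : (spectral_mu u setT < +oo)%E by rewrite muT ltry.
    have f2 : (\int[spectral_mu u]_t (t ^+ 2)%:E < +oo)%E by rewrite (i2A _ _ Auv) ltry.
    have := integral_shift fmu f2 (-1); rewrite muT /=.
    have -> : (\int[spectral_mu u]_t (t ^+ 2))%R = rnorm v ^+ 2.
      by rewrite /Rintegral (i2A _ _ Auv).
    have -> : (\int[spectral_mu u]_t ((t - -1) ^+ 2))%R = rnorm (u + v) ^+ 2.
      rewrite /Rintegral (integral_spectral_mu u (g := fun t => (t - -1) ^+ 2)).
      - rewrite -[RHS]/(fine (rnorm (u + v) ^+ 2)%:E) -parseval_series; congr fine.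
        apply: eq_eseriesr => n _; move/eigenP: Auv => h; rewrite ipDl h.
        by congr (_%:E); ring.
      - by apply/measurable_EFinP; exact: measurable_sqr.
      - by move=> t; exact: sqr_ge0.
    by rewrite -!ip_sqr !ipE [ip u v]ipC; lra.
  + move=> u v Auv; rewrite form_ipE ip_i ip_sqr /Rintegral.
    by rewrite (i2A _ _ Auv).
Qed.

(** The measure attached to an eigenvector [e n] has the moments of a point mass at
[l n], hence it is one; this determines [E S] on the basis. *)
Lemma spectral_measure_coef E (S : set (measurableTypeR R)) :
  is_spectral_measure form A E -> measurable S ->
  forall u n, ip (E S u) (e n) = \1_S (l n) * ip u (e n).
Proof.
move=> [pE ET [mu [h1 h2 h3 h4]]] mS u n.
have [bE sE iE] := proj1 (projectionP _) (pE S mS).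
have [lE _] := bE.
suff hE : E S (e n) = (\1_S (l n))%:C *: e n by rewrite sE hE ipZr.
have Aen := eigen_basis n.
have muT : mu (e n) setT = (ip (e n) (e n))%:E by rewrite h1 // ET.
have fmu : (mu (e n) setT < +oo)%E by rewrite muT ltry.
have f2 : (\int[mu (e n)]_t (t ^+ 2)%:E < +oo)%E by apply/h2; exists ((l n)%:C *: e n).
have m1 : (\int[mu (e n)]_t t = l n * fine (mu (e n) setT))%R.
  have := h3 _ _ Aen; rewrite muT /= form_ipE => -[<- _].
  by rewrite ipZl.
have m2 : (\int[mu (e n)]_t (t ^+ 2) = l n ^+ 2 * fine (mu (e n) setT))%R.
  have := h4 _ _ Aen; rewrite muT /= form_ipE => -[<- _].
  by rewrite ipZl ipZr; ring.
have conc (T : set (measurableTypeR R)) : measurable T -> T (l n) -> mu (e n) (~` T) = 0%E.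
  by move=> mT Tl; exact: (mu_concentrated fmu f2 mT Tl m1 m2).
have muS : mu (e n) S = (ip (E S (e n)) (e n))%:E by rewrite h1.
have EE : ip (E S (e n)) (E S (e n)) = ip (E S (e n)) (e n) by rewrite -sE iE.
rewrite indicE; case: (boolP (l n \in S)) => [/set_mem Sl|/negP nS].
  have : (mu (e n) S + mu (e n) (~` S) = mu (e n) setT)%E.
    rewrite -measureU //; [by rewrite setUv|exact: measurableC|by rewrite setICr].
  rewrite conc // adde0 muT muS => -[h]; rewrite scale1r.
  apply/eqP; rewrite -subr_eq0; apply/eqP/ip_eq0.
  by rewrite !ipE EE [ip (e n) _]ipC h; ring.
have cS : mu (e n) (~` ~` S) = 0%E.
  by apply: conc; [exact: measurableC|move=> Sl; apply: nS; exact: mem_set].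
rewrite setCK muS in cS; case: cS => cS.
by rewrite scale0r; apply: ip_eq0; rewrite EE cS.
Qed.

Lemma spectral_projectionE (S : set R) : @measurable _ (measurableTypeR R) S ->
  spectral_projection form S A = fcalc \1_S.
Proof.
move=> mS; apply/funext => u; apply: (coef_inj be) => n.
rewrite (fcalcE ler01 (indic_le1 S)); apply: spectral_measure_coef => //.
apply: (@getPex _ [set E | is_spectral_measure form A E]).
by exists (fun S => fcalc \1_S); exact: spectral_measure_exists.
Qed.

End eigenbasis_theory.

(** * Bounded transforms of odd operators with compact resolvents *)

Section RK1_theory.
Variable A : set (H * H).
Hypothesis A_RK1 : RK1 form s A.
Let F := bounded_transform form A.

Lemma RK1_adjoint : adjoint form A = A.
Proof. by have [[_ h _] _] := A_RK1. Qed.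

Let lA := RK1_linear A_RK1.
Let saA := RK1_adjoint.

Lemma RK1_spectral : exists e l, [/\ eigenbasis A e l,
  forall u n, ip (F u) (e n) = bt (l n) * ip u (e n),
  forall S : set R, @measurable _ (measurableTypeR R) S -> forall u n,
    ip (spectral_projection form S A u) (e n) = \1_S (l n) * ip u (e n) &
  forall S : set R, @measurable _ (measurableTypeR R) S ->
    bounded_linear (spectral_projection form S A) /\
    selfadj (spectral_projection form S A)].
Proof.
have [e [l eA]] := RK1_eigenbasis A_RK1; exists e, l; split=> //.
- exact: (bounded_transformE eA lA saA).
- move=> S mS u n; rewrite (spectral_projectionE eA lA mS).
  exact: (fcalcE eA ler01 (indic_le1 l S)).
- move=> S mS; rewrite (spectral_projectionE eA lA mS); split.
    exact: (fcalc_bounded eA lA ler01 (indic_le1 l S)).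
  exact: (fcalc_selfadj eA ler01 (indic_le1 l S)).
Qed.

Lemma bt_bounded : bounded_linear F.
Proof.
have [e [l eA]] := RK1_eigenbasis A_RK1.
rewrite /F (bounded_transform_fcalc eA lA saA).
by apply: (fcalc_bounded eA lA ler01) => n; exact/ltW/bt_norm.
Qed.

Lemma bt_linear : linear F.
Proof. by case: bt_bounded. Qed.

Lemma bt_selfadj : selfadj F.
Proof.
have [e [l eA]] := RK1_eigenbasis A_RK1.
rewrite /F (bounded_transform_fcalc eA lA saA).
by apply: (fcalc_selfadj eA ler01) => n; exact/ltW/bt_norm.
Qed.

Lemma bt_odd u : s (F u) = - F (s u).
Proof.
have [e [l eA]] := RK1_eigenbasis A_RK1.
have [be _] := eA; apply: (coef_inj be) => n.
rewrite s_selfadj ipNl (bounded_transformE eA lA saA).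
have h : A (s (e n), (- l n)%:C *: s (e n)).
  have := RK1_odd A_RK1 (eigen_basis eA n).
  by rewrite (linZ s_linear) rmorphN scaleNr.
have := ip_eigen eA h (bounded_transformE eA lA saA u).
by move=> ->; rewrite s_selfadj /bt sqrrN; ring.
Qed.

Lemma bt_defect_coef e l : eigenbasis A e l -> forall u n,
  ip (defect F u) (e n) = (1 + l n ^+ 2)^-1 * ip u (e n).
Proof.
move=> eA u n; rewrite /defect ipBl !(bounded_transformE eA lA saA) -bt_sq; ring.
Qed.

Lemma bt_contraction u : u != 0 -> rnorm (F u) < rnorm u.
Proof.
have [e [l eA]] := RK1_eigenbasis A_RK1; have [be _] := eA => u0.
have b1 n : `|bti (l n)| <= 1 by exact: bti_norm.
have h : ip u u - ip (F u) (F u) = ip (fcalc e l bti u) (fcalc e l bti u).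
  rewrite bt_selfadj -ipBr -/(defect F u); apply: (ip_coef_eq be) => n.
  rewrite (fcalcE eA ler01 b1) (bt_defect_coef eA) -bti_sq; ring.
have : 0 < ip (fcalc e l bti u) (fcalc e l bti u).
  rewrite lt_def ip_ge0 andbT; apply/eqP => /ip_eq0 h0; move/eqP: u0; apply.
  apply: (coef_inj be) => n; have := fcalcE eA ler01 b1 u n; rewrite h0 !ip0l.
  move=> /esym/eqP; rewrite mulf_eq0 (gt_eqF (bti_gt0 _)) /=; exact/eqP.
rewrite -h !ip_sqr subr_gt0 ltr_pXn2r // ?nnegrE; exact: rnorm_ge0.
Qed.

Lemma bt_bnd1 : bnd F 1.
Proof.
move=> u; rewrite mul1r; have [->|u0] := eqVneq u 0.
  by rewrite (lin0 bt_linear).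
exact/ltW/bt_contraction.
Qed.

(** With [v = K u] and [w = A v] one has [u = w + i v], and both [(1 + A^2)^-1 w] and
[(1 + A^2)^-1 v] are dominated by [v]. *)
Lemma bt_defect_compact : totally_bounded_op (defect F).
Proof.
have [e [l eA]] := RK1_eigenbasis A_RK1; have [be _] := eA.
have [K [[lK _] tK KA _]] := RK1_resolvent A_RK1.
have lD := defect_linear bt_linear.
apply: (totally_bounded_le (M := 2) lK lD) tK => u.
set v := K u; set w := u - 'i *: v.
have Avw : A (v, w) := KA u.
have -> : defect F u = defect F w + 'i *: defect F v.
  by rewrite -(linZ lD) -(linD lD) /w subrK.
apply: le_trans (rnormD _ _) _; rewrite rnorm_iM.
have h1 n : 0 < 1 + l n ^+ 2 by have := sqr_ge0 (l n); lra.
have k1 : rnorm (defect F w) <= 1 * rnorm v.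
  apply: (coef_bnd be) => // n; rewrite mul1r (bt_defect_coef eA).
  have [_ Ac] := eA; rewrite (proj1 (Ac v w) Avw) mulrA normrM ler_piMl //.
  rewrite normrM gtr0_norm ?invr_gt0 // mulrC ler_pdivrMr // mul1r.
  by rewrite ler_norml; have := sqr_ge0 (l n - 1); have := sqr_ge0 (l n + 1); nra.
have k2 : rnorm (defect F v) <= 1 * rnorm v.
  apply: (coef_bnd be) => // n; rewrite mul1r (bt_defect_coef eA) normrM ler_piMl //.
  rewrite gtr0_norm ?invr_gt0 // invf_le1 //; have := sqr_ge0 (l n); lra.
lra.
Qed.

(** If the inverse is bounded by [M], no eigenvalue is smaller than [1 / (M + 1)] in
absolute value. *)
Lemma RK1_invertible_defect : invertible A ->
  exists c, [/\ 0 <= c, c < 1 & bnd (defect F) c].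
Proof.
move=> [K /bounded_opP [lK [M M0 hM]] hK].
have [e [l eA]] := RK1_eigenbasis A_RK1; have [be _] := eA.
have M1 : 0 < M + 1 by lra.
pose m := (M + 1)^-1; have m0 : 0 < m by rewrite invr_gt0.
have m1 : 0 < 1 + m ^+ 2 by have := sqr_ge0 m; lra.
exists (1 + m ^+ 2)^-1; split.
- by rewrite invr_ge0 ltW.
- by rewrite invf_lt1 //; have := exprn_gt0 2 m0; lra.
move=> u; apply: (coef_bnd be) => [|n]; first by rewrite invr_ge0 ltW.
rewrite (bt_defect_coef eA); have [en0|/eqP en0] := eqVneq (e n) 0.
  by rewrite en0 ip0r mulr0 normr0 mulr0.
have np : 0 < rnorm (e n) by rewrite lt_def rnorm_ge0 andbT; apply/eqP => /rnorm_eq0.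
have h1 : 0 < 1 + l n ^+ 2 by have := sqr_ge0 (l n); lra.
rewrite normrM [`|_^-1|]gtr0_norm ?invr_gt0 // ler_wpM2r //.
rewrite lef_pV2 ?posrE // lerD2l.
have : graph K ((l n)%:C *: e n, e n) by rewrite -hK; exact: (eigen_basis eA).
rewrite /graph /= => hn.
have h2 : m <= `|l n|.
  have := hM ((l n)%:C *: e n); rewrite -hn rnormZ mulrA -{1}[rnorm _]mul1r ler_pM2r // => h2.
  rewrite /m -(ler_pM2l M1) mulfV ?gt_eqF //.
  by have := normr_ge0 (l n); nra.
by rewrite -[leRHS]real_normK ?num_real // ler_pXn2r // nnegrE ltW.
Qed.

(** The bound on [(1 + A^2)^-1] keeps the squares of the eigenvalues above
[1 / c - 1], so that the function [1 / t] is bounded on the spectrum. *)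
Lemma RK1_defect_invertible c : 0 < c -> c < 1 -> bnd (defect F) c -> invertible A.
Proof.
move=> c0 c1 hc; have [e [l eA]] := RK1_eigenbasis A_RK1; have [be _] := eA.
pose d := c^-1 - 1; have d0 : 0 < d by rewrite subr_gt0 invf_gt1.
pose phi (t : R) := if d <= t ^+ 2 then t^-1 else 0.
pose M := (Num.sqrt d)^-1.
have M0 : 0 <= M by rewrite invr_ge0 sqrtr_ge0.
have hphi n : `|phi (l n)| <= M.
  rewrite /phi; case: ifP => h; last by rewrite normr0.
  have sd : 0 < Num.sqrt d by rewrite sqrtr_gt0.
  have hl : Num.sqrt d <= `|l n| by rewrite -sqrtr_sqr ler_wsqrtr.
  by rewrite normfV lef_pV2 // posrE // (lt_le_trans sd).
have hl n : e n != 0 -> d <= l n ^+ 2.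
  move=> en0; have np : 0 < rnorm (e n).
    by rewrite lt_def rnorm_ge0 andbT; apply/eqP => /rnorm_eq0/eqP; exact/negP.
  have h1 : 0 < 1 + l n ^+ 2 by have := sqr_ge0 (l n); lra.
  have := hc (e n).
  rewrite (_ : defect F (e n) = (1 + l n ^+ 2)^-1%:C *: e n).
    rewrite rnormZ ler_pM2r // gtr0_norm ?invr_gt0 //.
    by rewrite -[c]invrK lef_pV2 ?posrE ?invr_gt0 // /d; lra.
  apply: (coef_inj be) => m; rewrite (bt_defect_coef eA) ipZl.
  have [->//|nm] := eqVneq n m; have [h _ _] := be; by rewrite h // !mulr0.
exists (fcalc e l phi).
  apply/bounded_opP; exact: (fcalc_bounded eA lA M0 hphi).
apply/seteqP; split=> -[p q] /=; rewrite /graph /=.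
  move=> /(eigenP eA) h; apply: (coef_inj be) => n; rewrite (fcalcE eA M0 hphi) h.
  have [->|en] := eqVneq (e n) 0; first by rewrite ip0r !mulr0.
  rewrite /phi hl // mulrA mulVf ?mul1r //.
  by apply/eqP => l0; have := hl n en; rewrite l0 expr0n /=; lra.
move=> ->; apply/(eigenP eA) => n; rewrite (fcalcE eA M0 hphi).
have [->|en] := eqVneq (e n) 0; first by rewrite ip0r !mulr0.
rewrite /phi hl // mulrA mulfV ?mul1r //.
by apply/eqP => l0; have := hl n en; rewrite l0 expr0n /=; lra.
Qed.

End RK1_theory.

(** * The inverse of the bounded transform *)

Section inverse_transform.
Variable G : H -> H.
Hypothesis lG : linear G.
Hypothesis sG : selfadj G.
Hypothesis oG : forall u, s (G u) = - G (s u).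
Hypothesis G1 : forall u, u != 0 -> rnorm (G u) < rnorm u.
Hypothesis tG : totally_bounded_op (defect G).

Let B := sqrt1B (G \o G).

(** [G (1 - G^2)^(-1/2)], with graph parametrized by the operator
[B = sqrt (1 - G^2)], which commutes with [G]. *)
Definition inverse_transform : set (H * H) := [set p | exists u, p = (B u, G u)].

Let Gb : bnd G 1.
Proof.
move=> u; rewrite mul1r; have [->|/G1/ltW//] := eqVneq u 0.
by rewrite (lin0 lG).
Qed.

Let bG : bounded_linear G.
Proof. by split=> //; exists 1. Qed.

Let lC : linear (G \o G).
Proof. exact: linear_comp. Qed.

Let C1 : bnd (G \o G) 1.
Proof. by rewrite -[1]mulr1; exact: bnd_comp. Qed.

Let sC : selfadj (G \o G).
Proof. by move=> u v /=; rewrite !sG. Qed.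

Let bB : bounded_linear B.
Proof. exact: sqrt1B_bounded. Qed.

Let lB : linear B.
Proof. by case: bB. Qed.

Let sB : selfadj B.
Proof. exact: sqrt1B_selfadj. Qed.

Let BB u : B (B u) = u - G (G u).
Proof. exact: sqrt1B_sq. Qed.

Let GB u : G (B u) = B (G u).
Proof. exact: sqrt1B_comm. Qed.

Let sBc u : s (B u) = B (s u).
Proof.
apply: (sqrt1B_comm lC C1) => [|v /=]; first exact: s_bounded.
by rewrite oG oG (linN lG) opprK.
Qed.

Let Dinj u : defect G u = 0 -> u = 0.
Proof.
move=> h; apply/eqP/negP => /negP /G1; rewrite ltNge; apply/negP; rewrite negbK.
apply: rnorm_le; have := ip0l u; rewrite -h /defect ipBl [ip (G (G u)) u]sG; lra.
Qed.

Let Binj u : B u = 0 -> u = 0.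
Proof. by move=> h; apply: Dinj; rewrite /defect -BB h (lin0 lB). Qed.

Let invP v w : inverse_transform (v, w) <-> G v = B w.
Proof.
split=> [[u [-> ->]]|h]; first by rewrite GB.
exists (B v + G w); congr (_, _).
  by rewrite (linD lB) BB -GB -h subrK.
by rewrite (linD lG) GB h BB subrK.
Qed.

(** [|B u|^2] is the inner product of [(1 - G^2) u] and [u]. *)
Let tB : totally_bounded_op B.
Proof.
apply: (totally_bounded_dom tG) => e e0; exists (e ^+ 2 / 2).
  by rewrite divr_gt0 // exprn_gt0.
move=> u v u1 v1; have lD := defect_linear lG; rewrite -(linB lD) -(linB lB) => h.
have : rnorm (B (u - v)) ^+ 2 <= rnorm (defect G (u - v)) * rnorm (u - v).
  rewrite -ip_sqr sB BB -/(defect G _) ipC; exact: CauchySchwarz_ip.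
have uv := rnormB u v.
rewrite -(@ltr_pXn2r _ 2) ?nnegrE ?rnorm_ge0 ?(ltW e0) //.
have := rnorm_ge0 (defect G (u - v)); have := rnorm_ge0 (u - v); nra.
Qed.

Let invlin : linear_operator inverse_transform.
Proof.
split=> [u v w [x [ux ->]] [y [uy ->]]|a u v u' v' /invP h /invP h'].
  congr G; apply/eqP; rewrite -subr_eq0; apply/eqP/Binj.
  by rewrite (linB lB) -ux -uy subrr.
by apply/invP; rewrite (linD lG) (linZ lG) h h' (linD lB) (linZ lB).
Qed.

Let invadj : adjoint form inverse_transform = inverse_transform.
Proof.
apply/seteqP; split=> -[p q] /=.
  move=> h; apply/invP; apply: ip_inj => w.
  have := h (B w) (G w); rewrite /= => /(_ (ex_intro _ w erefl)) hw.
  by rewrite sG sB ipC [RHS]ipC /ip hw.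
by move=> /invP h _ _ [w [-> ->]] /=; rewrite !form_ipE !sG !sB (linZ lG) (linZ lB) h.
Qed.

Let invclosed : closed inverse_transform.
Proof.
move=> [p q] hc; apply/invP/eqP; rewrite -subr_eq0; apply/eqP/rnorm_small => d d0.
have [_ [M M0 hM]] := bB.
have e0 : 0 < d / (M + 1) by rewrite divr_gt0 //; lra.
have [|[v w] [/invP h [/= hv hw]]] := hc [set x | rnorm (x.1 - p) < d / (M + 1) /\ rnorm (x.2 - q) < d / (M + 1)].
  exists ([set x | rnorm (x - p) < d / (M + 1)], [set x | rnorm (x - q) < d / (M + 1)]) => //=.
    by split; apply/nbhs_rnorm; exists (d / (M + 1)).
rewrite !ltr_pdivlMr in hv hw; try lra.
have -> : G p - B q = B (w - q) - G (v - p).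
  by rewrite (linB lG) (linB lB) h; apply: ip_inj => x; rewrite !ipE; ring.
apply: le_trans (rnormB _ _) _; have := hM (w - q); have := Gb (v - p).
have := rnorm_ge0 (v - p); have := rnorm_ge0 (w - q); nra.
Qed.

(** The domain is the range of [B], which contains the range of [1 - G^2 = B^2]; the
latter contains an orthonormal basis of eigenvectors. *)
Let invdense : dense (gdom inverse_transform).
Proof.
have lD := defect_linear lG.
have DE u : defect G u = B (B u) by rewrite BB.
have sD : selfadj (defect G) by move=> u v; rewrite !DE !sB.
have Dp u : 0 <= ip (defect G u) u by rewrite DE sB ip_ge0.
have cD : compact_op (defect G).
  apply/compact_opP; split=> //; exact: (bounded_linear_sub bounded_linear_id (bounded_linear_comp bG bG)).
have [||S Sg [u u0 uS]|e be eg] := @exists_total_orthogonal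
    (fun v => exists2 m : R, m != 0 & defect G v = m%:C *: v) H_separable.
- by exists 1; rewrite ?oner_eq0 // (lin0 lD) scaler0.
- move=> r v [m m0 h]; exists m => //.
  by rewrite (linZ lD) h !scalerA mulrC.
- have [|v [m [v0 m0 Dv vS]]] := exists_eigenvector_orthogonal lD sD Dp Dinj cD (S := S) _ u0 uS.
    move=> x hx v Sv; have [m m0 hv] := Sg _ Sv.
    by rewrite sD hv ipZr hx // mulr0.
  by exists v; split=> //; exists m => //; rewrite gt_eqF.
have gD u v : gdom inverse_transform u -> gdom inverse_transform v ->
    gdom inverse_transform (u + v).
  move=> [u' /invP hu] [v' /invP hv]; exists (u' + v'); apply/invP.
  by rewrite (linD lG) (linD lB) hu hv.
have ge a i : gdom inverse_transform (a%:C *: e i).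
  have [m m0 hm] := eg i; exists (G ((a / m)%:C *: B (e i))).
  exists ((a / m)%:C *: B (e i)); congr (_, _).
  rewrite (linZ lB) -DE hm scalerA -rmorphM; congr (_%:C *: _).
  by field.
have gc a N : gdom inverse_transform (comb e a N).
  rewrite /comb; elim/big_ind: _ => //.
  by exists 0; apply/invP; rewrite (lin0 lG) (lin0 lB).
move=> O [u Ou] oO; have /nbhs_rnorm [d d0 hd] : nbhs u O by exact: open_nbhs_nbhs.
have [N hN] := comb_coef_cvg be u d0.
by exists (comb e (fun i => ip u (e i)) N); split=> //; apply: hd; exact: hN.
Qed.

(** The resolvent [(A + i)^-1] of [A = inverse_transform] is [B (G - i B)], because
[(G + i B) (G - i B) = G^2 + B^2 = 1]. *)
Lemma inverse_transform_RK1 : RK1 form s inverse_transform.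
Proof.
split; last first.
  apply/seteqP; split=> -[p q] /=.
    move=> [x]; rewrite /graph /= => -> /invP h; exists (- s q); last first.
      by rewrite /graph /= (linN s_linear) s_invol opprK.
    apply/invP; rewrite (linN lB) -sBc -h oG s_invol opprK; exact.
  move=> [x /invP h]; rewrite /graph /= => ->; exists (s p) => //.
  by apply/invP; rewrite (linN lB) -sBc -h oG opprK.
split; first by split.
  exact: invadj.
pose T u := G u - 'i *: B u.
have lT : linear T.
  apply: linear_sub => // a u v; rewrite (linD lB) (linZ lB) scalerDr.
  by rewrite !scalerA mulrC.
have bT : bounded_linear T.
  have [_ [M M0 hM]] := bB.
  split=> //; exists (1 + M) => [|u]; first lra.
  apply: le_trans (rnormB _ _) _; rewrite rnorm_iM mulrDl lerD //; exact: Gb.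
exists (B \o T).
  apply/compact_opP; split; first exact: bounded_linear_comp.
  exact: totally_bounded_compr.
apply/seteqP; split=> -[p q] /=; rewrite /graph /=.
  case=> v [w] /= [[u [qE vE]] wE pE]; subst q v w p; congr B; rewrite /T.
  rewrite (linD lG) (linD lB) (linZ lG) (linZ lB) scalerDr scale_ii BB GB.
  by apply: ip_inj => x; rewrite !ipE; ring.
move=> ->; exists (G (T p)), ('i *: B (T p)); split=> //; first by exists (T p).
rewrite /= /T (linB lG) (linB lB) (linZ lG) (linZ lB) scalerBr scale_ii BB GB.
by apply: ip_inj => x; rewrite !ipE; ring.
Qed.

(** [B] is the positive square root of [(1 + A^2)^-1], and [A B = G]. *)
Lemma inverse_transformK : bounded_transform form inverse_transform = G.
Proof.
have hR := inverse_transform_RK1.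
have [e [l eA]] := RK1_eigenbasis hR; have [be _] := eA.
apply/funext => u; apply: (coef_inj be) => n.
rewrite (bounded_transformE eA invlin invadj).
apply/esym/(bounded_transform_coef eA invlin invadj).
exists B; split.
- split; first exact/selfadjoint_boundedP.
  by move=> v; rewrite selfadj_form_real // ler0c; exact: sqrt1B_ge0.
- rewrite invadj; apply/seteqP; split=> -[p q] /=; rewrite /graph /=.
    case=> v [w] /= [vE [x /invP h1 /invP h2] pE]; subst v p.
    rewrite (linD lB) (linD lB) -h2 -GB -h1 BB; exact/esym/subrK.
  move=> ->; exists (B (B p)), (G (G p)); split=> //; last by rewrite BB subrK.
  exists (G (B p)); first by exists (B p).
  by exists (G p); rewrite GB.
- apply/seteqP; split=> -[p q] /=; rewrite /graph /=.
    case=> x /= xE [y [hxy wE]]; subst x q; congr G.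
    apply/esym/eqP; rewrite -subr_eq0; apply/eqP/Binj.
    by rewrite (linB lB) hxy subrr.
  by move=> ->; exists (B p) => //; exists p.
Qed.

End inverse_transform.

(** * Odd symmetries *)

Lemma bnd_ball (T : H -> H) a : linear T ->
  (forall u, rnorm u <= 1 -> rnorm (T u) <= a) -> bnd T a.
Proof.
move=> lT h; apply: opnorm_bnd => //; apply: ge_ereal_sup => _ /= [u u1 <-].
by rewrite lee_fin h.
Qed.

Lemma bnd_adjoint (T S : H -> H) a : (forall u v, ip (T u) v = ip u (S v)) ->
  bnd T a -> bnd S a.
Proof.
move=> adj h v; have := h (S v); have := CauchySchwarz_ip (T (S v)) v.
rewrite adj ip_sqr; have := rnorm_ge0 (S v); have := rnorm_ge0 v.
have [->//|n0] := eqVneq (rnorm (S v)) 0.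
  move=> v0 _ _ _; have := h v; have := rnorm_ge0 (T v); lra.
move=> v0 s0 h1 h2; have sp : 0 < rnorm (S v) by rewrite lt_def n0.
rewrite -(ler_pM2l sp) -expr2; apply: le_trans h1 _.
by rewrite mulrCA mulrA ler_wpM2r // mulrC.
Qed.

Lemma bnd_close (S T : H -> H) a b : bnd T b -> bnd (op_sub S T) a -> bnd S (a + b).
Proof.
move=> hT hST u; have := rnormD (S u - T u) (T u); rewrite subrK => /le_trans.
by apply; rewrite mulrDl lerD //; exact: hST.
Qed.

Lemma bnd_subC (S T : H -> H) a : bnd (op_sub S T) a -> bnd (op_sub T S) a.
Proof. by move=> h u; rewrite /op_sub rnorm_distC; exact: h. Qed.

(** The symmetries [2 P - 1] of the values [P] of generalized [Cl(1)] spectral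
sections, when [F] is the bounded transform. *)
Definition odd_symmetry (F p : H -> H) :=
  [/\ bounded_linear p, selfadj p, forall u, p (p u) = u,
      forall u, s (p u) = - p (s u) & totally_bounded_op (op_sub p F)].

Lemma symmetry_isometry p u : selfadj p -> (forall u, p (p u) = u) -> rnorm (p u) = rnorm u.
Proof.
by move=> sp pp; apply/eqP; rewrite -(@eqrXn2 _ 2) ?rnorm_ge0 // -!ip_sqr sp pp.
Qed.

Lemma symmetry_bnd p : selfadj p -> (forall u, p (p u) = u) -> bnd p 1.
Proof. by move=> sp pp u; rewrite symmetry_isometry // mul1r. Qed.

Lemma defect_perturbation (F G : H -> H) : bounded_linear F -> bounded_linear G ->
  totally_bounded_op (defect F) -> totally_bounded_op (op_sub G F) ->
  totally_bounded_op (defect G).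
Proof.
move=> bF bG tF tk; have [lF _] := bF; have [lG _] := bG.
have lk : linear (op_sub G F) by exact: linear_sub.
rewrite (_ : defect G = op_sub (defect F) (fun u => (F \o op_sub G F) u + (op_sub G F \o G) u)).
  apply: totally_bounded_sub => //; apply: totally_bounded_add.
    exact: totally_bounded_compl.
  exact: totally_bounded_compr.
apply/funext => u; rewrite /defect /op_sub /= (linB lF).
by apply: ip_inj => w; rewrite !ipE; ring.
Qed.

(** [1 - q^2 = - (p h + h q)] for [h = q - p]. *)
Lemma defect_near_symmetry (p q : H -> H) a : linear p -> selfadj p ->
  (forall u, p (p u) = u) -> linear q -> 0 <= a -> a <= 4^-1 -> bnd (op_sub q p) a ->
  bnd (defect q) (9 / 4 * a).
Proof.
move=> lp sp pp lq a0 a1 h u; have h1 := h u; have h2 := h (q u).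
rewrite (_ : defect q u = - (p (op_sub q p u) + op_sub q p (q u))); last first.
  rewrite /defect /op_sub (linB lp) pp; apply: ip_inj => w; rewrite !ipE; ring.
rewrite rnormN; apply: le_trans (rnormD _ _) _.
rewrite (symmetry_isometry _ sp pp).
have h3 : rnorm (q u) <= (a + 1) * rnorm u.
  exact: (bnd_close (symmetry_bnd sp pp) h).
have h4 := le_trans h2 (ler_wpM2l a0 h3).
have h5 : a * (a + 1) <= 5 / 4 * a by nra.
have := ler_wpM2r (rnorm_ge0 u) h5; lra.
Qed.

(** For [a <= 1 / 4] the defect of [q] is at most [c = 9 a / 4 <= 9 / 16], so that
[sgn q] is defined and at distance at most [c / (1 - c) <= 6 a] from [q]. *)
Lemma op_sgn_odd_symmetry (F p q : H -> H) a : bounded_linear F ->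
  totally_bounded_op (defect F) -> linear p -> selfadj p -> (forall u, p (p u) = u) ->
  0 <= a -> a <= 4^-1 -> bounded_linear q -> selfadj q ->
  (forall u, s (q u) = - q (s u)) -> bnd (op_sub q p) a ->
  totally_bounded_op (op_sub q F) ->
  odd_symmetry F (op_sgn q) /\ bnd (op_sub (op_sgn q) p) (7 * a).
Proof.
move=> bF tF lp sp pp a0 a1 bq sq oq h tq; have [lq _] := bq.
have hd := defect_near_symmetry lp sp pp lq a0 a1 h.
pose c := 9 / 4 * a; have c0 : 0 <= c by rewrite /c; lra.
have c1 : c < 1 by rewrite /c; lra.
split; first split.
- exact: (op_sgn_bounded lq sq c0 c1 hd).
- exact: (op_sgn_selfadj lq sq c0 c1 hd).
- exact: (op_sgn_sq lq sq c0 c1 hd).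
- apply: (op_sgn_anticomm lq sq c0 c1 hd) => //; exact: s_bounded.
- have tD := defect_perturbation bF bq tF tq.
  have := totally_bounded_add (op_sgn_totally_bounded lq sq c0 c1 hd tD) tq.
  congr totally_bounded_op; apply/funext => u; rewrite /op_sub.
  by apply: ip_inj => w; rewrite !ipE; ring.
have h2 := op_sgn_dist lq sq c0 c1 hd.
move=> u; have := rnormD (op_sgn q u - q u) (q u - p u).
rewrite (_ : _ - _ + _ = op_sub (op_sgn q) p u); last first.
  by rewrite /op_sub; apply: ip_inj => w; rewrite !ipE; ring.
move=> /le_trans; apply; have := h2 u; have := h u; rewrite /op_sub.
have : c / (1 - c) <= 6 * a by rewrite ler_pdivrMr ?subr_gt0 // /c; nra.
have := rnorm_ge0 u; nra.
Qed.

(** * Continuous choice of small parameters *)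

Section continuous_gauges.
Variables (X : topologicalType) (I : Type) (J : set I) (T : X -> I -> H -> H).
Variables (good : X -> R -> Prop) (M : R).
Hypothesis T_cont : forall x (eta : R), 0 < eta ->
  \forall y \near x, forall i, J i -> bnd (op_sub (T y i) (T x i)) eta.
Hypothesis good_loc : forall x, exists kap, [/\ 0 < kap, kap <= M &
  forall y, (forall i, J i -> bnd (op_sub (T x i) (T y i)) kap) ->
  forall d, 0 < d -> d <= kap -> good y d].

(** Let [S y] be the set of the [kap - eta] for which some [x] has admissible
radius [kap] and [T y] is at distance at most [eta] from [T x]. Then [sup (S y)]
is positive, and it varies by at most [th] when [T y] varies by at most [th], hence
it is continuous. An element of [S y] greater than [sup (S y) / 2] shows
that this half is admissible at [y]. *)
Lemma continuous_gauge : exists delta : X -> R,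
  continuous delta /\ forall x, [/\ 0 < delta x, delta x <= M & good x (delta x)].
Proof.
pose loc x kap := forall y, (forall i, J i -> bnd (op_sub (T x i) (T y i)) kap) ->
  forall d, 0 < d -> d <= kap -> good y d.
pose S y := [set t | exists x kap eta, [/\ kap <= M, loc x kap, 0 <= eta,
   forall i, J i -> bnd (op_sub (T x i) (T y i)) eta & t = kap - eta]].
have bnd0 x i : J i -> bnd (op_sub (T x i) (T x i)) 0.
  by move=> _ u; rewrite /op_sub subrr rnorm0 mul0r.
have SM y t : S y t -> t <= M by move=> [x [kap [eta [k1 _ e0 _ ->]]]]; lra.
have S0 y : exists2 t, S y t & 0 < t.
  have [kap [k0 kM hk]] := good_loc y; exists kap => //.
  by exists y, kap, 0; split=> //; [exact: bnd0|rewrite subr0].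
have hS y : has_sup (S y).
  by split; [have [t] := S0 y; exists t|exists M => t; exact: SM].
have supM y : sup (S y) <= M.
  by apply: ge_sup => [|t]; [case: (hS y)|exact: SM].
have sup0 y : 0 < sup (S y).
  by have [t St /lt_le_trans] := S0 y; apply; exact: sup_upper_bound.
have lip x y th : (forall i, J i -> bnd (op_sub (T x i) (T y i)) th) -> 0 <= th ->
    sup (S x) - th <= sup (S y).
  move=> hxy th0; rewrite lerBlDr; apply: ge_sup; first by case: (hS x).
  move=> t [z [kap [eta [k1 k2 e0 he ->]]]].
  have : S y (kap - (eta + th)).
    exists z, kap, (eta + th); split=> //; first exact: addr_ge0.
    move=> i Ji u; rewrite (_ : op_sub _ _ u = op_sub (T z i) (T x i) u + op_sub (T x i) (T y i) u).
      by apply: le_trans (rnormD _ _) _; rewrite mulrDl lerD //; [exact: he|exact: hxy].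
    by rewrite /op_sub addrA subrK.
  by move=> /(sup_upper_bound (hS y)); lra.
exists (fun x => sup (S x) / 2); split.
  move=> x; apply/cvgrPdist_lt => eta eta0.
  apply: filterS (T_cont x eta0) => y hy.
  have h1 := lip y x eta hy (ltW eta0).
  have h2 := lip x y eta (fun i Ji => bnd_subC (hy i Ji)) (ltW eta0).
  by rewrite ltr_norml; apply/andP; split; lra.
move=> x; have p := sup0 x; split; [lra|have := supM x; lra|].
have h : 0 < sup (S x) / 2 by lra.
have [t [z [kap [eta [k1 k2 e0 he tE]]]] ht] := sup_adherent h (hS x).
apply: (k2 x _ _ h); last by lra.
by move=> i Ji; apply: bnd_le (he i Ji); lra.
Qed.

End continuous_gauges.

(** * Cut-offs of the defect *)

Section cutoff.
Variable A : set (H * H).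
Hypothesis A_RK1 : RK1 form s A.
Let F := bounded_transform form A.

Definition shifted_defect (F : H -> H) (c : R) (u : H) := defect F u - c%:C *: u.

(** The absolute value [sqrt (1 - (1 - T^2))] of a self-adjoint contraction. *)
Definition op_abs (T : H -> H) := sqrt1B (defect T).

(** [cutoff_fun d] applied to [1 - F^2]. As it is made of absolute values, it
depends norm continuously on [F] and [d]. *)
Definition cutoff (F : H -> H) (d : R) (u : H) :=
  (2 * d)^-1%:C *: (d%:C *: u + op_abs (shifted_defect F d) u - op_abs (shifted_defect F (2 * d)) u).

(** The piecewise linear function that is [0] on [z <= d] and [1] on
[z >= 2 * d]. *)
Definition cutoff_fun (d z : R) : R := (2 * d)^-1 * (d + `|z - d| - `|z - 2 * d|).

Lemma cutoff_fun_low d z : 0 < d -> z <= d -> cutoff_fun d z = 0.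
Proof.
by move=> d0 zd; rewrite /cutoff_fun !ler0_norm; lra.
Qed.

Lemma cutoff_fun_le1 d z : 0 < d -> `|cutoff_fun d z| <= 1.
Proof.
move=> d0; rewrite /cutoff_fun normrM gtr0_norm ?invr_gt0; last lra.
rewrite mulrC ler_pdivrMr; last lra.
have := ler_dist_dist (z - d) (z - 2 * d).
have -> : z - d - (z - 2 * d) = d by ring.
rewrite [`|d|]gtr0_norm // => h; rewrite -addrA; apply: le_trans (ler_normD _ _) _.
by rewrite gtr0_norm //; lra.
Qed.

Lemma cutoff_fun_compl d z : 0 < d -> 0 <= z -> `|(1 - cutoff_fun d z) * z| <= 2 * d.
Proof.
move=> d0 z0; have [zd|dz] := leP (2 * d) z.
  rewrite (_ : cutoff_fun d z = 1); first by rewrite subrr mul0r normr0; lra.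
  by rewrite /cutoff_fun !ger0_norm; try lra; field; lra.
have h0 : 0 <= cutoff_fun d z.
  rewrite /cutoff_fun mulr_ge0 ?invr_ge0 //; first lra.
  by have := ler_normD (z - d) (- d); rewrite normrN [`|d|]gtr0_norm // (_ : z - d - d = z - 2 * d); [lra|ring].
have := cutoff_fun_le1 z d0; rewrite ler_norml => /andP[_ h1].
rewrite normrM [`|z|]ger0_norm // ger0_norm; last lra.
have : (1 - cutoff_fun d z) * z <= 1 * z by rewrite ler_wpM2r //; lra.
lra.
Qed.

Let bF : bounded_linear F := bt_bounded A_RK1.
Let lF : linear F := bt_linear A_RK1.
Let sF : selfadj F := bt_selfadj A_RK1.

Let bD : bounded_linear (defect F).
Proof. exact: (bounded_linear_sub bounded_linear_id (bounded_linear_comp bF bF)). Qed.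

Lemma defect_selfadj (G : H -> H) : selfadj G -> selfadj (defect G).
Proof. by move=> sG u v; rewrite /defect !ipE !sG. Qed.

Lemma defect_contraction (T : H -> H) : selfadj T -> bnd T 1 -> bnd (defect T) 1.
Proof.
move=> sT hT u; rewrite mul1r; apply: rnorm_le.
have := hT (T u); have := hT u; rewrite !mul1r => h1 h2.
rewrite /defect !ipE [ip (T (T u)) u]ipC -[ip u (T (T u))]sT !ip_sqr.
have : rnorm (T (T u)) ^+ 2 <= rnorm (T u) ^+ 2.
  by rewrite ler_pXn2r // nnegrE rnorm_ge0.
have := sqr_ge0 (rnorm (T u)); lra.
Qed.

Lemma shifted_defect_props c : 0 <= c -> c <= 1 ->
  [/\ bounded_linear (shifted_defect F c), selfadj (shifted_defect F c) &
      bnd (shifted_defect F c) 1].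
Proof.
move=> c0 c1; split.
- exact: (bounded_linear_sub bD (bounded_linear_scale c bounded_linear_id)).
- by move=> u v; rewrite /shifted_defect ipBl ipBr ipZl ipZr (defect_selfadj sF).
have [e [l eA]] := RK1_eigenbasis A_RK1; have [be _] := eA => u.
apply: (coef_bnd be) => // n.
rewrite /shifted_defect ipBl ipZl (bt_defect_coef A_RK1 eA).
rewrite -mulrBl normrM ler_wpM2r //.
have h1 : 0 < 1 + l n ^+ 2 by have := sqr_ge0 (l n); lra.
have : (1 + l n ^+ 2)^-1 <= 1 by rewrite invf_le1 //; have := sqr_ge0 (l n); lra.
have : 0 < (1 + l n ^+ 2)^-1 by rewrite invr_gt0.
by rewrite ler_norml => a b; apply/andP; split; lra.
Qed.

Section op_abs_contraction.
Variable T : H -> H.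
Hypothesis bT : bounded_linear T.
Hypothesis sT : selfadj T.
Hypothesis hT : bnd T 1.
Let lT : linear T := proj1 bT.
Let lD := defect_linear lT.
Let D1 := defect_contraction sT hT.
Let sD := defect_selfadj sT.

Lemma op_abs_bounded : bounded_linear (op_abs T).
Proof. exact: sqrt1B_bounded. Qed.

Lemma op_abs_selfadj : selfadj (op_abs T).
Proof. exact: sqrt1B_selfadj. Qed.

Lemma op_abs_eigen e r : T e = r%:C *: e -> op_abs T e = `|r|%:C *: e.
Proof.
move=> h; apply: (sqrt1B_eigen lD D1 sD) => //.
rewrite /defect h (linZ lT) h real_normK ?num_real //.
by apply: ip_inj => w; rewrite !ipE; ring.
Qed.

Lemma op_abs_comm (S : H -> H) : bounded_linear S -> (forall u, S (T u) = T (S u)) ->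
  forall u, S (op_abs T u) = op_abs T (S u).
Proof.
move=> bS h; apply: (sqrt1B_comm lD D1) => // u.
by have [lS _] := bS; rewrite /defect (linB lS) !h.
Qed.

End op_abs_contraction.

Variable d : R.
Hypothesis d0 : 0 < d.
Hypothesis d1 : d <= 2^-1.

Let S1 : [/\ bounded_linear (shifted_defect F d), selfadj (shifted_defect F d) &
      bnd (shifted_defect F d) 1].
Proof. by apply: shifted_defect_props; [exact: ltW|have := d1; lra]. Qed.

Let S2 : [/\ bounded_linear (shifted_defect F (2 * d)), selfadj (shifted_defect F (2 * d)) &
      bnd (shifted_defect F (2 * d)) 1].
Proof. by apply: shifted_defect_props; [have := d0; lra|have := d1; lra]. Qed.

Lemma cutoff_bounded : bounded_linear (cutoff F d).
Proof.
have [b1 s1 n1] := S1; have [b2 s2 n2] := S2.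
apply: bounded_linear_scale; apply: bounded_linear_sub; last exact: op_abs_bounded.
apply: bounded_linear_add; last exact: op_abs_bounded.
exact: (bounded_linear_scale d bounded_linear_id).
Qed.

Lemma cutoff_selfadj : selfadj (cutoff F d).
Proof.
have [b1 s1 n1] := S1; have [b2 s2 n2] := S2 => u v.
rewrite /cutoff ipZl ipZr ipBl ipBr ipDl ipDr ipZl ipZr.
by rewrite (op_abs_selfadj b1 s1 n1) (op_abs_selfadj b2 s2 n2).
Qed.

Lemma cutoff_even u : s (cutoff F d u) = cutoff F d (s u).
Proof.
have [b1 s1 n1] := S1; have [b2 s2 n2] := S2; have ls := s_linear.
have hd v : s (defect F v) = defect F (s v).
  by rewrite /defect (linB ls) !(bt_odd A_RK1) -/F (linN lF) opprK.
have hc c v : s (shifted_defect F c v) = shifted_defect F c (s v).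
  by rewrite /shifted_defect (linB ls) (linZ ls) hd.
rewrite /cutoff (linZ ls) (linB ls) (linD ls) (linZ ls).
by rewrite (op_abs_comm b1 s1 n1 s_bounded (hc _)) (op_abs_comm b2 s2 n2 s_bounded (hc _)).
Qed.

Lemma cutoff_eigen e z : defect F e = z%:C *: e ->
  cutoff F d e = (cutoff_fun d z)%:C *: e.
Proof.
move=> h; have [b1 s1 n1] := S1; have [b2 s2 n2] := S2.
have hc c : shifted_defect F c e = (z - c)%:C *: e.
  by rewrite /shifted_defect h; apply: ip_inj => w; rewrite !ipE; ring.
rewrite /cutoff (op_abs_eigen b1 s1 n1 (hc _)) (op_abs_eigen b2 s2 n2 (hc _)).
by rewrite /cutoff_fun; apply: ip_inj => w; rewrite !ipE; ring.
Qed.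

Lemma bt_defect_eigen e l n : eigenbasis A e l ->
  defect F (e n) = ((1 + l n ^+ 2)^-1)%:C *: e n.
Proof.
move=> eA; have [be _] := eA; apply: (coef_inj be) => m.
rewrite (bt_defect_coef A_RK1 eA) ipZl; have [->//|nm] := eqVneq n m.
by have [h _ _] := be; rewrite h // !mulr0.
Qed.

Lemma cutoff_bnd : bnd (cutoff F d) 1.
Proof.
have [e [l eA]] := RK1_eigenbasis A_RK1; have [be _] := eA => u.
apply: (coef_bnd be) => // n.
rewrite cutoff_selfadj (cutoff_eigen (bt_defect_eigen n eA)) ipZr normrM ler_wpM2r //.
exact: cutoff_fun_le1.
Qed.

Lemma cutoff_compl_bnd : bnd (fun u => u - cutoff F d u) 1.
Proof.
have [e [l eA]] := RK1_eigenbasis A_RK1; have [be _] := eA => u.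
apply: (coef_bnd be) => // n; rewrite ipBl.
rewrite cutoff_selfadj (cutoff_eigen (bt_defect_eigen n eA)) ipZr.
rewrite -{1}[ip u (e n)]mul1r -mulrBl normrM ler_wpM2r //.
set z := (1 + l n ^+ 2)^-1.
have h0 : 0 <= cutoff_fun d z.
  have d0' := d0; rewrite /cutoff_fun mulr_ge0 ?invr_ge0 //; first lra.
  by have := ler_normD (z - d) (- d); rewrite normrN [`|d|]gtr0_norm // (_ : z - d - d = z - 2 * d); [lra|ring].
have := cutoff_fun_le1 z d0; rewrite ler_norml => /andP[_ h1].
by rewrite ger0_norm; lra.
Qed.

Lemma cutoff_compl_defect : bnd (fun u => defect F u - cutoff F d (defect F u)) (2 * d).
Proof.
have [e [l eA]] := RK1_eigenbasis A_RK1; have [be _] := eA => u.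
have d0' := d0; apply: (coef_bnd be) => [|n]; first lra.
have h1 : 0 < 1 + l n ^+ 2 by have := sqr_ge0 (l n); lra.
rewrite ipBl cutoff_selfadj (cutoff_eigen (bt_defect_eigen n eA)) ipZr.
rewrite (bt_defect_coef A_RK1 eA) -{1}[_^-1 * _]mul1r -mulrBl mulrA normrM ler_wpM2r //.
by apply: cutoff_fun_compl => //; rewrite invr_ge0 ltW.
Qed.

End cutoff.

(** * Projections and symmetries *)

Section spectral_sections.
Variable A : set (H * H).
Hypothesis A_RK1 : RK1 form s A.
Let F := bounded_transform form A.
Let bF : bounded_linear F := bt_bounded A_RK1.
Let lF : linear F := bt_linear A_RK1.
Let sF : selfadj F := bt_selfadj A_RK1.
Let bD : bounded_linear (defect F).
Proof. exact: (bounded_linear_sub bounded_linear_id (bounded_linear_comp bF bF)). Qed.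

Definition reflection (P : H -> H) (u : H) := 2%:C *: P u - u.
Definition half_plus (p : H -> H) (u : H) := 2^-1%:C *: (u + p u).

Let E0 := spectral_projection form `[0, +oo[ A.

Lemma measurable_itvR (i : interval R) : @measurable _ (measurableTypeR R) [set` i].
Proof. exact: measurable_itv. Qed.

Lemma E0_bounded : bounded_linear E0.
Proof.
have [e [l [_ _ _ h]]] := RK1_spectral A_RK1.
exact: (proj1 (h _ (measurable_itvR _))).
Qed.

(** On an eigenvector with [b = bt l], the operator is [1 - b] or [- 1 - b] according to
the sign of [l], which is at most [1 - b^2] in absolute value. *)
Lemma spectral_sign_compact :
  totally_bounded_op (fun u => 2%:C *: E0 u - u - F u).
Proof.
have [e [l [eA cF cE _]]] := RK1_spectral A_RK1; have [be _] := eA.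
have lE : linear E0 by case: E0_bounded.
have lT : linear (fun u => 2%:C *: E0 u - u - F u).
  by apply: linear_sub => //; apply: linear_sub => //; exact: linear_scale.
apply: (totally_bounded_le (M := 1) (proj1 bD) lT) (bt_defect_compact A_RK1) => u.
apply: (coef_bnd be) => // n; rewrite mul1r (bt_defect_coef A_RK1 eA).
rewrite !ipBl ipZl cF /E0 cE; last exact: measurable_itvR.
set x := ip u (e n); rewrite (_ : _ - _ = (2 * \1_`[0, +oo[ (l n) - 1 - bt (l n)) * x); last by ring.
rewrite !normrM ler_wpM2r // -bt_sq.
have hb := bt_norm (l n); rewrite ltr_norml in hb; case/andP: hb => hb1 hb2.
rewrite [leRHS]ger0_norm; last by nra.
have sg := sqrt1_gt0 (l n).
rewrite indicE; case: (boolP (l n \in _)) => [/set_mem|/negP hl] /=.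
  rewrite in_itv /= andbT => h.
  have : 0 <= bt (l n) by rewrite /bt divr_ge0 // ltW.
  by move=> h'; rewrite ger0_norm; [nra|lra].
have h : l n < 0.
  by rewrite ltNge; apply/negP => h; apply: hl; apply/mem_set; rewrite /= in_itv /= andbT.
have : bt (l n) <= 0 by rewrite /bt mulr_le0_ge0 ?invr_ge0 // ltW.
by move=> h'; rewrite ler0_norm; [nra|lra].
Qed.

Lemma section_reflection_compact P : linear P -> totally_bounded_op (op_sub P E0) ->
  totally_bounded_op (op_sub (reflection P) F).
Proof.
move=> lP h; have := totally_bounded_add (totally_bounded_scale 2 h) spectral_sign_compact.
congr totally_bounded_op; apply/funext => u; rewrite /op_sub /reflection.
by apply: ip_inj => w; rewrite !ipE; ring.
Qed.

Lemma half_plus_compact p : totally_bounded_op (op_sub p F) ->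
  totally_bounded_op (op_sub (half_plus p) E0).
Proof.
move=> h; have := totally_bounded_scale 2^-1 (totally_bounded_sub h spectral_sign_compact).
congr totally_bounded_op; apply/funext => u; rewrite /op_sub /half_plus.
by apply: ip_inj => w; rewrite !ipE; field.
Qed.

Lemma half_plus_reflection P : half_plus (reflection P) = P.
Proof.
by apply/funext => u; rewrite /half_plus /reflection; apply: ip_inj => w; rewrite !ipE; field.
Qed.

Lemma half_plus_bounded p : bounded_linear p -> bounded_linear (half_plus p).
Proof.
by move=> b; apply: bounded_linear_scale; apply: bounded_linear_add => //; exact: bounded_linear_id.
Qed.

Lemma reflection_bounded P : bounded_linear P -> bounded_linear (reflection P).
Proof.
move=> b; apply: bounded_linear_sub; last exact: bounded_linear_id.
exact: bounded_linear_scale.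
Qed.

Lemma half_plus_projection p : bounded_linear p -> selfadj p -> (forall u, p (p u) = u) ->
  projection form (half_plus p).
Proof.
move=> bp sp pp; apply/projectionP; split; first exact: half_plus_bounded.
  by move=> u v; rewrite /half_plus !ipE sp.
move=> u; rewrite /half_plus (linZ (proj1 bp)) (linD (proj1 bp)) pp.
by apply: ip_inj => w; rewrite !ipE; field.
Qed.

(** [T = P - 1_[0, oo[(A)] kills the eigenvectors with [r <= |l|]. With [phi t = 1 + t^2]
for [|t| < r] and [phi t = 0] elsewhere, a bounded function, this gives
[T = T phi(A) (1 - F^2)], where the last factor is compact. *)
Lemma section_compact (r : R) P : 0 < r -> r_spectral_section form r A P ->
  compact_op (op_sub P E0).
Proof.
move=> r0 [/projectionP[bP sP PP] h1 h2].
have [e [l [eA cF cE hE]]] := RK1_spectral A_RK1; have [be _] := eA.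
have [lP [M M0 hM]] := bP.
have [bE1 sE1] := hE _ (measurable_itvR `[r, +oo[).
have [bE2 sE2] := hE _ (measurable_itvR `]- r, +oo[).
have [bE0 sE0] := hE _ (measurable_itvR `[0, +oo[).
have {}h1 := proj1 (op_leP (proj1 bE1) sE1 lP sP) h1.
have {}h2 := proj1 (op_leP lP sP (proj1 bE2) sE2) h2.
have Een (S : set R) n : @measurable _ (measurableTypeR R) S ->
    spectral_projection form S A (e n) = (\1_S (l n))%:C *: e n.
  move=> mS; apply: (coef_inj be) => m; rewrite cE // ipZl.
  have [->//|nm] := eqVneq n m.
  by have [h _ _] := be; rewrite h // !mulr0.
pose T := op_sub P E0.
have bT : bounded_linear T by exact: bounded_linear_sub.
have [lT [N N0 hN]] := bT.
have sT : selfadj T by move=> u v; rewrite /T /op_sub ipBl ipBr sP /E0 sE0.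
have PE u : ip (P u) (P u) = ip (P u) u by rewrite -sP PP.
have Ten n : r <= `|l n| -> T (e n) = 0.
  rewrite ler_normr => /orP[h|h].
    have : P (e n) = e n.
      apply/eqP; rewrite eq_sym -subr_eq0; apply/eqP/ip_eq0/eqP.
      rewrite eq_le ip_ge0 andbT; have := h1 (e n).
      rewrite Een; last exact: measurable_itvR.
      rewrite indicE mem_set /=; last by rewrite in_itv /= andbT.
      rewrite ipZl mul1r !ipE PE [ip (e n) (P _)]ipC; lra.
    rewrite /T /op_sub => ->; rewrite /E0 Een; last exact: measurable_itvR.
    rewrite indicE mem_set /=; last by rewrite in_itv /= andbT (le_trans (ltW r0)).
    by rewrite scale1r subrr.
  have : P (e n) = 0.
    apply: ip_eq0; apply/eqP; rewrite eq_le ip_ge0 andbT PE.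
    apply: le_trans (h2 _) _; rewrite Een; last exact: measurable_itvR.
    rewrite indicE memNset /=; last by rewrite in_itv /= andbT; apply/negP; rewrite -leNgt; lra.
    by rewrite scale0r ip0l.
  rewrite /T /op_sub => ->; rewrite /E0 Een; last exact: measurable_itvR.
  rewrite indicE memNset /=; last by rewrite in_itv /= andbT; apply/negP; rewrite -ltNge; lra.
  by rewrite scale0r subrr.
pose phi (t : R) := if `|t| < r then 1 + t ^+ 2 else 0.
have M1 : 0 <= 1 + r ^+ 2 by have := sqr_ge0 r; lra.
have hphi n : `|phi (l n)| <= 1 + r ^+ 2.
  rewrite /phi; case: ifP => h; last by rewrite normr0.
  rewrite ger0_norm; last by have := sqr_ge0 (l n); lra.
  by rewrite lerD2l -[leLHS]real_normK ?num_real // ler_pXn2r ?nnegrE // ltW.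
have key u : T u = T (fcalc e l phi (defect F u)).
  apply: ip_inj => w; rewrite !sT; apply: (ip_coef_eq be) => n.
  rewrite (fcalcE eA M1 hphi) (bt_defect_coef A_RK1 eA) /phi.
  case: ifP => [h|/negbT].
    by have h3 : 0 < 1 + l n ^+ 2; [have := sqr_ge0 (l n); lra|rewrite mulrA mulfV ?mul1r // gt_eqF].
  by rewrite -leNgt => h; rewrite sT Ten // ip0r !mulr0.
apply/compact_opP; split=> //.
apply: (totally_bounded_le (M := N * (1 + r ^+ 2)) (proj1 bD) lT) (bt_defect_compact A_RK1) => u.
rewrite -/T key -mulrA; apply: le_trans (hN _) _; rewrite ler_wpM2l //.
exact: (fcalc_bnd eA M1 hphi).
Qed.

(** For [E = 1_[r, oo[(A)] the first hypothesis means [E Q = E], and then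
[E = Q E Q <= Q]. For [E = 1_]-r, oo[(A)] the second one means [E Q = Q], and the
comparison is the Cauchy-Schwarz inequality. *)
Lemma section_of_eigenvectors (r : R) Q : projection form Q ->
  (forall v t, A (v, t%:C *: v) -> r <= t -> Q v = v) ->
  (forall v t, A (v, t%:C *: v) -> t <= - r -> Q v = 0) ->
  r_spectral_section form r A Q.
Proof.
move=> pQ hp hn; split=> //; move/projectionP: pQ => [bQ sQ QQ].
  have [e [l [eA cF cE hE]]] := RK1_spectral A_RK1; have [be _] := eA.
  have [bE1 sE1] := hE _ (measurable_itvR `[r, +oo[).
  apply/(op_leP (proj1 bE1) sE1 (proj1 bQ) sQ) => u.
  set E := spectral_projection _ _ _ in bE1 sE1 *.
  have cEu v n : ip (E v) (e n) = \1_`[r, +oo[ (l n) * ip v (e n).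
    by rewrite /E cE //; exact: measurable_itvR.
  have EE v : E (E v) = E v.
    by apply: (coef_inj be) => n; rewrite !cEu indicE; case: (_ \in _); rewrite ?mul1r ?mul0r.
  have EQ : E (Q u) = E u.
    apply: (coef_inj be) => n; rewrite !cEu indicE.
    case: (boolP (l n \in _)) => [/set_mem|_]; last by rewrite !mul0r.
    by rewrite /= in_itv /= andbT => h; rewrite sQ (hp _ _ (eigen_basis eA n)).
  have -> : ip (E u) u = ip (E (Q u)) (Q u).
    by rewrite -EE sE1 -EQ -sE1 EE EQ.
  have -> : ip (Q u) u = ip (Q u) (Q u) by rewrite -sQ QQ.
  have -> : ip (E (Q u)) (Q u) = ip (E (Q u)) (E (Q u)) by rewrite -sE1 EE.
  rewrite !ip_sqr ler_pXn2r // ?nnegrE ?rnorm_ge0 // -[leRHS]mul1r.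
  apply: (coef_bnd be) => // n; rewrite cEu mul1r normrM ler_piMl //.
  by rewrite indicE; case: (_ \in _); rewrite ?normr1 ?normr0.
have [e [l [eA cF cE hE]]] := RK1_spectral A_RK1; have [be _] := eA.
have [bE1 sE1] := hE _ (measurable_itvR `]- r, +oo[).
apply/(op_leP (proj1 bQ) sQ (proj1 bE1) sE1) => u.
set E := spectral_projection _ _ _ in bE1 sE1 *.
have cEu v n : ip (E v) (e n) = \1_`]- r, +oo[ (l n) * ip v (e n).
  by rewrite /E cE //; exact: measurable_itvR.
have EE v : E (E v) = E v.
  by apply: (coef_inj be) => n; rewrite !cEu indicE; case: (_ \in _); rewrite ?mul1r ?mul0r.
have EQ : E (Q u) = Q u.
  apply: (coef_inj be) => n; rewrite !cEu indicE.
  case: (boolP (l n \in _)) => [_|/negP h]; first by rewrite mul1r.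
  rewrite mul0r sQ (hn _ _ (eigen_basis eA n)) ?ip0r // leNgt; apply/negP => hl.
  by apply: h; apply/mem_set; rewrite /= in_itv /= hl.
have e1 : ip (Q u) u = rnorm (Q u) ^+ 2 by rewrite -ip_sqr -sQ QQ.
have e2 : ip (E u) u = rnorm (E u) ^+ 2 by rewrite -ip_sqr -sE1 EE.
have : ip (Q u) u <= rnorm (Q u) * rnorm (E u).
  by rewrite -{1}EQ sE1; exact: CauchySchwarz_ip.
rewrite e1 e2; have := rnorm_ge0 (Q u); have := rnorm_ge0 (E u).
have := sqr_ge0 (rnorm (Q u) - rnorm (E u)); nra.
Qed.

End spectral_sections.

Lemma bt_eigen A v (t : R) : RK1 form s A -> A (v, t%:C *: v) ->
  bounded_transform form A v = (bt t)%:C *: v.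
Proof.
move=> hA h; have [e [l eA]] := RK1_eigenbasis hA; have [be _] := eA.
apply: (coef_inj be) => n; rewrite ipZl.
rewrite (bounded_transformE eA (RK1_linear hA) (RK1_adjoint hA)).
by have [->|->//] := eigen_coef eA n h; rewrite !mulr0.
Qed.

(** * Compressing compact operators by cut-offs *)

Lemma defect_range_dense A (c : H) (eta : R) : RK1 form s A -> 0 < eta ->
  exists w, rnorm (c - defect (bounded_transform form A) w) < eta.
Proof.
move=> hA eta0; have [e [l eA]] := RK1_eigenbasis hA; have [be _] := eA.
have lD := defect_linear (bt_linear hA).
have [N hN] := comb_coef_cvg be c eta0.
suff [w hw] : exists w, defect (bounded_transform form A) w = comb e (fun i => ip c (e i)) N.
  by exists w; rewrite hw rnorm_distC hN.
rewrite /comb; elim/big_ind: _ => [|u v [u' <-] [v' <-]|i _].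
- by exists 0; rewrite (lin0 lD).
- by exists (u' + v'); rewrite (linD lD).
exists ((ip c (e i) * (1 + l i ^+ 2))%:C *: e i).
rewrite (linZ lD) (bt_defect_eigen hA i eA).
have h1 : 0 < 1 + l i ^+ 2 by have := sqr_ge0 (l i); lra.
by apply: ip_inj => x; rewrite !ipE; field; rewrite gt_eqF.
Qed.

(** By compactness, the values of [k0] on the unit ball are close to finitely many
of them, and each of these is close to some [(1 - F0^2) w] since [1 - F0^2] has
dense range. On a vector of the form [(1 - F^2) w] the complement of the cut-off
is at most [2 d |w|]. The norms of the finitely many [w] are bounded, so all this
survives small perturbations of [F0] and [k0]. *)
Lemma cutoff_uniform A0 (k0 : H -> H) (a : R) : RK1 form s A0 -> linear k0 ->
  totally_bounded_op k0 -> 0 < a ->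
  exists kap, [/\ 0 < kap, kap <= 2^-1 & forall A k, RK1 form s A -> linear k ->
    bnd (op_sub (bounded_transform form A) (bounded_transform form A0)) kap ->
    bnd (op_sub k k0) (2 * kap) -> forall d, 0 < d -> d <= kap ->
    bnd (fun u => k u - cutoff (bounded_transform form A) d (k u)) a].
Proof.
move=> hA0 lk0 tk0 a0; set F0 := bounded_transform form A0.
have a8 : 0 < a / 8 by lra.
have [I [f hf]] := tk0 _ a8.
have hrep (i : I) : exists uw : H * H, (exists2 u, rnorm u <= 1 & f u = i) ->
    [/\ rnorm uw.1 <= 1, f uw.1 = i & rnorm (k0 uw.1 - defect F0 uw.2) < a / 8].
  have [[u u1 fu]|no] := pselect (exists2 u, rnorm u <= 1 & f u = i); last first.
    by exists (0, 0) => /no.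
  by have [w hw] := defect_range_dense (k0 u) hA0 a8; exists (u, w).
have [rep repP] := choice hrep.
pose W := \sum_(i : I) rnorm (rep i).2.
have W0 : 0 <= W by apply: sumr_ge0 => i _; exact: rnorm_ge0.
have hW i : rnorm (rep i).2 <= W.
  by rewrite /W (bigD1 i) //= lerDl sumr_ge0 // => j _; exact: rnorm_ge0.
have W1 : 0 < 8 * (W + 1) by lra.
(* The errors at the end are a / 8 twice, 2 kap, 2 kap W and 2 d W, with sum at most a. *)
exists (Num.min 2^-1 (a / (8 * (W + 1)))); split.
- by rewrite lt_min invr_gt0 ltr0n /= divr_gt0.
- by rewrite ge_min lexx.
set kap := Num.min _ _ => A k hA lk hF hk d d0 dk.
have kap1 : kap <= 2^-1 by rewrite ge_min lexx.
have kap2 : kap * (8 * (W + 1)) <= a by rewrite -ler_pdivlMr // ge_min lexx orbT.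
have kap0 : 0 < kap by lra.
have d1 : d <= 2^-1 by lra.
set F := bounded_transform form A in hF *.
pose N v := v - cutoff F d v.
have lN : linear N.
  by apply: (linear_sub linear_id); case: (cutoff_bounded hA d0 d1).
have N1 := cutoff_compl_bnd hA d0 d1.
have N2 := cutoff_compl_defect hA d0 d1.
apply: (@bnd_ball (N \o k)); first exact: linear_comp.
move=> u u1 /=; pose i := f u.
have [|v1 fv hw] := repP i; first by exists u.
set v := (rep i).1 in v1 fv hw; set w := (rep i).2 in hw.
have ww : rnorm w <= W := hW i.
have -> : N (k u) = N (k u - defect F w) + N (defect F w).
  by rewrite -(linD lN) subrK.
apply: le_trans (rnormD _ _) _.
have h1 := N1 (k u - defect F w); rewrite mul1r -/F -/(N _) in h1.
have h2 := N2 w; rewrite -/F -/(N _) in h2.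
have h3 : rnorm (k u - defect F w) <= rnorm (op_sub k k0 u) + rnorm (k0 u - k0 v)
    + rnorm (k0 v - defect F0 w) + rnorm (defect F0 w - defect F w).
  have -> : k u - defect F w = op_sub k k0 u + (k0 u - k0 v) + (k0 v - defect F0 w) + (defect F0 w - defect F w).
    by rewrite /op_sub; apply: ip_inj => x; rewrite !ipE; ring.
  apply: le_trans (rnormD _ _) _; rewrite lerD2r.
  apply: le_trans (rnormD _ _) _; rewrite lerD2r.
  exact: rnormD.
have h4 : rnorm (op_sub k k0 u) <= 2 * kap.
  by apply: le_trans (hk u) _; rewrite -[leRHS]mulr1 ler_wpM2l //; lra.
have h5 : rnorm (k0 u - k0 v) < a / 8 by apply: hf.
have lF0 : linear F0 := bt_linear hA0.
have h6 : rnorm (defect F0 w - defect F w) <= 2 * kap * W.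
  have -> : defect F0 w - defect F w = - (- F0 (op_sub F F0 w) - op_sub F F0 (F w)).
    rewrite /defect /op_sub (linB lF0); apply: ip_inj => x; rewrite !ipE; ring.
  rewrite rnormN; apply: le_trans (rnormB _ _) _; rewrite rnormN.
  have := bt_bnd1 hA0 (op_sub F F0 w); have := hF (F w); have := hF w.
  have := bt_bnd1 hA w; rewrite !mul1r -/F -/F0 => e1 e2 e3 e4.
  have e5 : kap * rnorm (F w) <= kap * W by rewrite ler_wpM2l ?(ltW kap0) // (le_trans e1).
  have e6 : kap * rnorm w <= kap * W by rewrite ler_wpM2l ?(ltW kap0).
  lra.
have h7 : 2 * d * rnorm w <= 2 * kap * W.
  by rewrite ler_pM ?rnorm_ge0 //; lra.
lra.
Qed.

Section cutoff_continuity.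
Context {Y : Type} (Fil : set_system Y) {FF : Filter Fil}.
Variables (A : Y -> set (H * H)) (A0 : set (H * H)) (d : Y -> R) (d0 : R).
Hypothesis hA : forall z, RK1 form s (A z).
Hypothesis hA0 : RK1 form s A0.
Hypothesis hd : forall z, 0 < d z /\ d z <= 2^-1.
Hypothesis hd0 : 0 < d0 /\ d0 <= 2^-1.
Hypothesis cF : op_cvg Fil (fun z => bounded_transform form (A z)) (bounded_transform form A0).
Hypothesis cd : d z @[z --> Fil] --> d0.

Let F z := bounded_transform form (A z).
Let F0 := bounded_transform form A0.

Lemma op_abs_shifted_cvg (c : Y -> R) (c0 : R) : (forall z, 0 <= c z /\ c z <= 1) ->
  0 <= c0 /\ c0 <= 1 -> c z @[z --> Fil] --> c0 ->
  op_cvg Fil (fun z => op_abs (shifted_defect (F z) (c z))) (op_abs (shifted_defect F0 c0)).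
Proof.
move=> hc hc0 cc; have bF0 := bt_bounded hA0.
have cD : op_cvg Fil (fun z => defect (F z)) (defect F0).
  apply: (op_cvg_sub (S := fun _ => id)); first exact: op_cvg_cst.
  exact: (op_cvg_comp bF0 bF0 cF cF).
have [b s1 n1] := shifted_defect_props hA0 (proj1 hc0) (proj2 hc0).
have cS : op_cvg Fil (fun z => shifted_defect (F z) (c z)) (shifted_defect F0 c0).
  apply: (op_cvg_sub cD).
  exact: (op_cvg_scale bounded_linear_id cc (@op_cvg_cst _ _ FF id)).
apply: sqrt1B_cvg.
- apply: filterE => z; have [bz sz nz] := shifted_defect_props (hA z) (proj1 (hc z)) (proj2 (hc z)).
  by split; [exact: defect_linear (proj1 bz)|exact: defect_contraction].
- exact: defect_linear (proj1 b).
- exact: defect_contraction.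
- apply: (op_cvg_sub (S := fun _ => id)); first exact: op_cvg_cst.
  exact: (op_cvg_comp b b cS cS).
Qed.

Lemma cutoff_cvg : op_cvg Fil (fun z => cutoff (F z) (d z)) (cutoff F0 d0).
Proof.
have [d00 d01] := hd0.
have c2 : (2 * d z) @[z --> Fil] --> 2 * d0 by apply: cvgMr.
have h1 := @op_abs_shifted_cvg d d0.
have h2 := @op_abs_shifted_cvg (fun z => 2 * d z) (2 * d0).
have {}h1 : op_cvg Fil (fun z => op_abs (shifted_defect (F z) (d z))) (op_abs (shifted_defect F0 d0)).
  by apply: h1 => //; [move=> z; have := hd z|]; lra.
have {}h2 : op_cvg Fil (fun z => op_abs (shifted_defect (F z) (2 * d z))) (op_abs (shifted_defect F0 (2 * d0))).
  by apply: h2 => //; [move=> z; have := hd z|]; lra.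
have b1 : bounded_linear (op_abs (shifted_defect F0 d0)).
  have [|b s1 n1] := @shifted_defect_props _ hA0 d0 (ltW d00); first lra.
  exact: op_abs_bounded.
have b2 : bounded_linear (op_abs (shifted_defect F0 (2 * d0))).
  have [||b s1 n1] := @shifted_defect_props _ hA0 (2 * d0); [lra|lra|].
  exact: op_abs_bounded.
apply: op_cvg_scale.
- apply: bounded_linear_sub => //; apply: bounded_linear_add => //.
  exact: (bounded_linear_scale d0 bounded_linear_id).
- by apply: cvgV => //; rewrite gt_eqF // mulr_gt0.
- apply: op_cvg_sub => //; apply: op_cvg_add => //.
  exact: (op_cvg_scale bounded_linear_id cd (@op_cvg_cst _ _ FF id)).
Qed.

End cutoff_continuity.

Section cutoff_symmetry.
Variable A : set (H * H).
Hypothesis hA : RK1 form s A.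
Let F := bounded_transform form A.
Variables (p : H -> H) (d a : R).
Hypothesis pF : odd_symmetry F p.
Hypothesis d0 : 0 < d.
Hypothesis d1 : d <= 2^-1.

(** The operator that replaces [p = F + k] by [F + chi k chi], for the cut-off
[chi]. *)
Definition truncated (F p : H -> H) (d : R) (u : H) :=
  F u + cutoff F d (op_sub p F (cutoff F d u)).

Hypothesis ka : bnd (fun u => op_sub p F u - cutoff F d (op_sub p F u)) a.

Let bF : bounded_linear F := bt_bounded hA.
Let bp : bounded_linear p. Proof. by case: pF. Qed.
Let bk : bounded_linear (op_sub p F). Proof. exact: bounded_linear_sub. Qed.
Let bc : bounded_linear (cutoff F d) := cutoff_bounded hA d0 d1.
Let sk : selfadj (op_sub p F).
Proof.
have [_ sp _ _ _] := pF => u v.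
by rewrite /op_sub ipBl ipBr sp (bt_selfadj hA).
Qed.

Lemma truncated_bounded : bounded_linear (truncated F p d).
Proof.
apply: bounded_linear_add => //.
exact: (bounded_linear_comp bc (bounded_linear_comp bk bc)).
Qed.

Lemma truncated_selfadj : selfadj (truncated F p d).
Proof.
move=> u v; rewrite /truncated ipDl ipDr (bt_selfadj hA).
by rewrite (cutoff_selfadj hA d0 d1) sk (cutoff_selfadj hA d0 d1).
Qed.

Lemma truncated_odd u : s (truncated F p d u) = - truncated F p d (s u).
Proof.
have [_ _ _ op _] := pF; have ls := s_linear.
rewrite /truncated (linD ls) (bt_odd hA) (cutoff_even hA d0 d1).
rewrite opprD; congr (_ + _); rewrite -(linN (proj1 bc)); congr cutoff.
by rewrite /op_sub (linB ls) op (bt_odd hA) (cutoff_even hA d0 d1) opprB addrC opprK.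
Qed.

(** [k - chi k chi = chi (k - k chi) + (k - chi k)], and [k - k chi] is the adjoint of
[k - chi k]. *)
Lemma truncated_near : bnd (op_sub (truncated F p d) p) (2 * a).
Proof.
have adj : bnd (fun u => op_sub p F u - op_sub p F (cutoff F d u)) a.
  apply: (bnd_adjoint _ ka) => u v.
  by rewrite ipBl ipBr sk (cutoff_selfadj hA d0 d1) sk.
move=> u; have ka' := ka; set k := op_sub p F in ka' adj *.
rewrite (_ : op_sub _ _ u = - (cutoff F d (k u - k (cutoff F d u)) + (k u - cutoff F d (k u)))); last first.
  have pu : p u = F u + k u by rewrite /k /op_sub subrKC.
  rewrite (linB (proj1 bc)) [LHS]/op_sub pu /truncated -/k.
  move: (F u) (k u) (cutoff F d (k u)) (cutoff F d (k (cutoff F d u))) => f k' x y.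
  by apply: ip_inj => w; rewrite !ipE; ring.
rewrite rnormN; apply: le_trans (rnormD _ _) _.
have h1 := cutoff_bnd hA d0 d1 (k u - k (cutoff F d u)).
have h2 := adj u; have h3 := ka' u; rewrite mul1r in h1.
have := le_trans h1 h2; lra.
Qed.

Lemma truncated_compact : totally_bounded_op (op_sub (truncated F p d) F).
Proof.
have [_ _ _ _ tp] := pF.
have := totally_bounded_compl bc (totally_bounded_compr (proj1 bk) bc tp).
congr totally_bounded_op; apply/funext => u.
by rewrite /op_sub /truncated /= [RHS]addrC addKr.
Qed.

(** [|t| >= 1 / d] makes [(1 + t^2)^-1] at most [d], where the cut-off vanishes. *)
Lemma truncated_eigen v t : A (v, t%:C *: v) -> d^-1 <= `|t| ->
  truncated F p d v = (bt t)%:C *: v.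
Proof.
move=> h ht; have hF : F v = (bt t)%:C *: v := bt_eigen hA h.
rewrite /truncated hF.
have -> : cutoff F d v = 0.
  have lF : linear F := bt_linear hA.
  have hz : defect F v = ((1 + t ^+ 2)^-1)%:C *: v.
    rewrite /defect hF (linZ lF) hF -bt_sq.
    by apply: ip_inj => x; rewrite !ipE; ring.
  rewrite (cutoff_eigen hA d0 d1 hz) cutoff_fun_low ?scale0r //.
  have d2 : 2 <= d^-1 by rewrite -[2]invrK lef_pV2 // posrE invr_gt0.
  rewrite -[leRHS]invrK lef_pV2 ?posrE ?invr_gt0 //; last by have := sqr_ge0 t; lra.
  rewrite -[t ^+ 2]real_normK ?num_real //; nra.
by rewrite (lin0 (proj1 bk)) (lin0 (proj1 bc)) addr0.
Qed.

End cutoff_symmetry.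

(** * Generalized sections as families of odd symmetries *)

Lemma op_cvg_withinT (Y : topologicalType) (y : Y) (T : Y -> H -> H) T0 :
  op_cvg (within setT (nbhs y)) T T0 <-> op_cvg (nbhs y) T T0.
Proof.
split=> h e e0; have := h e e0; rewrite near_withinE; apply: filterS => z //.
exact.
Qed.

Section families.
Variables (X : topologicalType) (A : X -> set (H * H)).
Hypothesis hA : forall x, RK1 form s (A x).
Hypothesis A_Riesz : Riesz_continuous form setT A.
Let F x := bounded_transform form (A x).

Lemma Riesz_cvg x : op_cvg (nbhs x) F (F x).
Proof.
have lF y : setT y -> linear (F y) by move=> _; exact: bt_linear.
by have := proj1 (norm_continuousP lF) A_Riesz x I => /op_cvg_withinT.
Qed.

Lemma reflection_odd_symmetry P x : generalized_Cl1_spectral_section form s A P ->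
  odd_symmetry (F x) (reflection (P x)).
Proof.
move=> [[[pP _] cP] sP]; have [bP sP' PP] := proj1 (projectionP _) (pP x).
split.
- exact: reflection_bounded.
- by move=> u v; rewrite /reflection !ipE sP'.
- move=> u; rewrite /reflection (linB (proj1 bP)) (linZ (proj1 bP)) PP.
  by apply: ip_inj => w; rewrite !ipE; ring.
- move=> u; have ls := s_linear; have := sP x (s u); rewrite s_invol => h.
  by rewrite /reflection (linB ls) (linZ ls) h; apply: ip_inj => w; rewrite !ipE; ring.
- apply: section_reflection_compact => //; first by case: bP.
  by have /compact_opP[_] := cP x.
Qed.

Lemma reflection_cvg P x : generalized_Cl1_spectral_section form s A P ->
  op_cvg (nbhs x) (fun y => reflection (P y)) (reflection (P x)).
Proof.
move=> [[[pP nP] cP] sP].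
have bP y : bounded_linear (P y) by have [b _ _] := proj1 (projectionP _) (pP y).
have lP y : setT y -> linear (P y) by move=> _; case: (bP y).
have h : op_cvg (nbhs x) P (P x).
  by have := proj1 (norm_continuousP lP) nP x I => /op_cvg_withinT.
apply: op_cvg_sub; last exact: op_cvg_cst.
exact: op_cvg_scale_cst.
Qed.

Lemma half_plus_cvg (Y : Type) (Fil : set_system Y) (FF : Filter Fil) (p : Y -> H -> H) p0 :
  bounded_linear p0 -> op_cvg Fil p p0 ->
  op_cvg Fil (fun y => half_plus (p y)) (half_plus p0).
Proof.
move=> b h; apply: op_cvg_scale_cst.
  by apply: bounded_linear_add => //; exact: bounded_linear_id.
by apply: (op_cvg_add (S := fun _ => id)) => //; exact: op_cvg_cst.
Qed.

Lemma half_plus_section (p : X -> H -> H) : (forall x, odd_symmetry (F x) (p x)) ->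
  (forall x, op_cvg (nbhs x) p (p x)) ->
  generalized_Cl1_spectral_section form s A (fun x => half_plus (p x)).
Proof.
move=> hp cp; split; first split; first split.
- by move=> x; have [b sp pp _ _] := hp x; exact: half_plus_projection.
- apply/norm_continuousP => [y _|y _].
    by have [b _ _ _ _] := hp y; case: (half_plus_bounded b).
  apply/op_cvg_withinT; have [b _ _ _ _] := hp y; exact: half_plus_cvg.
- move=> x; have [b sp pp _ tp] := hp x; apply/compact_opP; split.
    by apply: bounded_linear_sub; [exact: half_plus_bounded|exact: E0_bounded].
  exact: half_plus_compact.
- move=> x u; have [b sp pp op _] := hp x; have ls := s_linear.
  rewrite /half_plus (linZ ls) (linD ls) s_invol op s_invol.
  by apply: ip_inj => w; rewrite !ipE; field.
Qed.

Lemma op_cvg_map (Y Z : Type) (G : set_system Y) (G' : set_system Z) (g : Z -> Y) T T0 :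
  g @ G' `=>` G -> op_cvg G T T0 -> op_cvg G' (fun z => T (g z)) T0.
Proof. by move=> h hT e e0; apply: h (hT e e0). Qed.

(** * Spectral sections close to generalized ones *)

Section close_section.
Variable P : X -> H -> H.
Hypothesis hP : generalized_Cl1_spectral_section form s A P.
Variable a : R.
Hypothesis a0 : 0 < a.
Hypothesis a1 : a <= 8^-1.

Let p x := reflection (P x).
Let hp x : odd_symmetry (F x) (p x) := reflection_odd_symmetry x hP.
Let bp x : bounded_linear (p x). Proof. by case: (hp x). Qed.
Let bF x : bounded_linear (F x) := bt_bounded (hA x).

Lemma cutoff_gauge : exists delta : X -> R, continuous delta /\
  forall x, [/\ 0 < delta x, delta x <= 2^-1 &
    bnd (fun u => op_sub (p x) (F x) u - cutoff (F x) (delta x) (op_sub (p x) (F x) u)) a].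
Proof.
pose T x (b : bool) := if b then F x else p x.
apply: (continuous_gauge (J := setT) (T := T)
  (good := fun x d => bnd (fun u => op_sub (p x) (F x) u - cutoff (F x) d (op_sub (p x) (F x) u)) a)).
  move=> x eta eta0.
  have h1 := @Riesz_cvg x eta eta0; have h2 := reflection_cvg x hP eta0.
  by apply: filterS (filterI h1 h2) => y [h1' h2'] [].
move=> x; have [_ _ _ _ tp] := hp x.
have [kap [k0 k1 hk]] := cutoff_uniform (hA x) (linear_sub (proj1 (bp x)) (proj1 (bF x))) tp a0.
exists kap; split=> // y hy d d0 dk.
apply: (hk _ _ (hA y) (linear_sub (proj1 (bp y)) (proj1 (bF y)))) => //.
  exact: bnd_subC (hy true I).
move=> u; have h1 := hy true I u; have h2 := hy false I u.
rewrite (_ : op_sub _ _ u = op_sub (F x) (F y) u - op_sub (p x) (p y) u).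
  by apply: le_trans (rnormB _ _) _; rewrite -mulrA mulr2n mulrDl mul1r lerD.
by rewrite /op_sub; apply: ip_inj => w; rewrite !ipE; ring.
Qed.

Variable delta : X -> R.
Hypothesis cdelta : continuous delta.
Hypothesis hdelta : forall x, [/\ 0 < delta x, delta x <= 2^-1 &
    bnd (fun u => op_sub (p x) (F x) u - cutoff (F x) (delta x) (op_sub (p x) (F x) u)) a].

Let q x := truncated (F x) (p x) (delta x).

(** The segment from the truncation [q x] of [p x], at [t = 0], to [p x], at [t = 1]. *)
Definition path (x : X) (t : R) (u : H) : H := (1 - t)%:C *: q x u + t%:C *: p x u.

Let delta0 x : 0 < delta x. Proof. by case: (hdelta x). Qed.
Let delta1 x : delta x <= 2^-1. Proof. by case: (hdelta x). Qed.
Let bq x : bounded_linear (q x).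
Proof. exact: (truncated_bounded (hA x) (hp x) (delta0 x) (delta1 x)). Qed.

Lemma path_bounded x t : bounded_linear (path x t).
Proof. by apply: bounded_linear_add; apply: bounded_linear_scale; [exact: bq|exact: bp]. Qed.

Lemma path_selfadj x t : selfadj (path x t).
Proof.
have [_ sp _ _ _] := hp x.
move=> u v; rewrite /path !ipDl !ipDr !ipZl !ipZr sp.
by rewrite (truncated_selfadj (hA x) (hp x) (delta0 x) (delta1 x)).
Qed.

Lemma path_odd x t u : s (path x t u) = - path x t (s u).
Proof.
have [_ _ _ op _] := hp x; have ls := s_linear.
rewrite /path (linD ls) !(linZ ls) op (truncated_odd (hA x) (hp x) (delta0 x) (delta1 x)).
by rewrite !scalerN opprD.
Qed.

Lemma path_near x t : 0 <= t -> t <= 1 -> bnd (op_sub (path x t) (p x)) (2 * a).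
Proof.
move=> t0 t1 u; have a0' := a0; have [_ _ ka] := hdelta x.
have h := truncated_near (hA x) (hp x) (delta0 x) (delta1 x) ka u.
rewrite (_ : op_sub _ _ u = (1 - t)%:C *: op_sub (q x) (p x) u); last first.
  by rewrite /path /op_sub; move: (q x u) (p x u) => y z; apply: ip_inj => w; rewrite !ipE; ring.
rewrite rnormZ ger0_norm ?subr_ge0 //.
have : (1 - t) * rnorm (op_sub (q x) (p x) u) <= 1 * rnorm (op_sub (q x) (p x) u).
  by rewrite ler_wpM2r ?rnorm_ge0 //; lra.
rewrite mul1r => /le_trans; exact.
Qed.

Lemma path_compact x t : totally_bounded_op (op_sub (path x t) (F x)).
Proof.
have [_ _ _ _ tp] := hp x.
have tq := truncated_compact (hA x) (hp x) (delta0 x) (delta1 x).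
have := totally_bounded_add (totally_bounded_scale (1 - t) tq) (totally_bounded_scale t tp).
congr totally_bounded_op; apply/funext => u; rewrite /path /op_sub -/(F x) -/(q x).
by move: (q x u) (p x u) (F x u) => y z w; apply: ip_inj => v; rewrite !ipE; ring.
Qed.

Lemma path_sgn x t : 0 <= t -> t <= 1 ->
  odd_symmetry (F x) (op_sgn (path x t)) /\ bnd (op_sub (op_sgn (path x t)) (p x)) (7 * (2 * a)).
Proof.
move=> t0 t1; have [bp' sp pp op tp] := hp x; have a0' := a0; have a1' := a1.
apply: (op_sgn_odd_symmetry (p := p x)) => //; try lra.
- exact: bt_defect_compact.
- by case: bp'.
- exact: path_bounded.
- exact: path_selfadj.
- exact: path_odd.
- exact: path_near.
- exact: path_compact.
Qed.

Lemma path_cvg (Y : Type) (Fil : set_system Y) (FF : Filter Fil) (xx : Y -> X) (tt : Y -> R) x (t : R) :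
  xx @ Fil `=>` nbhs x -> tt z @[z --> Fil] --> t -> 0 <= t -> t <= 1 ->
  op_cvg Fil (fun z => op_sgn (path (xx z) (tt z))) (op_sgn (path x t)).
Proof.
move=> hx ht t0 t1; have a0' := a0; have a1' := a1.
have [bp' sp pp op tp] := hp x.
have cF : op_cvg Fil (fun z => F (xx z)) (F x) := op_cvg_map hx (@Riesz_cvg x).
have cp : op_cvg Fil (fun z => p (xx z)) (p x) := op_cvg_map hx (@reflection_cvg P x hP).
have cd : delta (xx z) @[z --> Fil] --> delta x.
  by move=> U /cdelta; exact: hx.
have cc := cutoff_cvg (fun z => hA (xx z)) (hA x) (fun z => conj (delta0 (xx z)) (delta1 (xx z)))
   (conj (delta0 x) (delta1 x)) cF cd.
have bc := cutoff_bounded (hA x) (delta0 x) (delta1 x).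
have bk : bounded_linear (op_sub (p x) (F x)) by exact: bounded_linear_sub.
have ck : op_cvg Fil (fun z => op_sub (p (xx z)) (F (xx z))) (op_sub (p x) (F x)).
  exact: (op_cvg_sub cp cF).
have cq : op_cvg Fil (fun z => q (xx z)) (q x).
  have cc' := cc FF; pose C z := cutoff (F (xx z)) (delta (xx z)).
  have ckc : op_cvg Fil (fun z => op_sub (p (xx z)) (F (xx z)) \o C z)
      (op_sub (p x) (F x) \o cutoff (F x) (delta x)) by exact: op_cvg_comp.
  have cckc : op_cvg Fil (fun z => C z \o (op_sub (p (xx z)) (F (xx z)) \o C z))
      (cutoff (F x) (delta x) \o (op_sub (p x) (F x) \o cutoff (F x) (delta x))).
    by apply: op_cvg_comp => //; exact: bounded_linear_comp.
  exact: (op_cvg_add cF cckc).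
have cr : op_cvg Fil (fun z => path (xx z) (tt z)) (path x t).
  apply: op_cvg_add; apply: op_cvg_scale => //.
  by apply: cvgB => //; exact: cvg_cst.
have hn := path_near x t0 t1.
apply: (op_sgn_cvg (c := 9 / 4 * (2 * a)) _ _ _ _ _ _ cr); try lra.
- by apply: filterE => z; split; [case: (path_bounded (xx z) (tt z))|exact: path_selfadj].
- by case: (path_bounded x t).
- exact: path_selfadj.
- by apply: (defect_near_symmetry (proj1 bp') sp pp (proj1 (path_bounded x t))) => //; lra.
Qed.

Definition close_section (z : X * R) := half_plus (op_sgn (path z.1 z.2)).

Lemma close_section_Cl1 : Cl1_spectral_section form s A (fun x => close_section (x, 0)).
Proof.
have hs x := path_sgn x (lexx 0) ler01.
have hg : generalized_Cl1_spectral_section form s A (fun x => close_section (x, 0)).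
  apply: half_plus_section => [x|x]; first by case: (hs x).
  by apply: path_cvg => //; exact: cvg_cst.
split; last by case: hg.
split; first by case: hg => [[]].
exists (fun x => (delta x)^-1); split.
- move=> x; apply: cvgV; last exact: cdelta.
  by rewrite gt_eqF.
- by move=> x; rewrite invr_gt0.
move=> x; have [[bs ss ssq _ _] _] := hs x; have [bp' sp pp op tp] := hp x.
have a0' := a0; have a1' := a1.
have lr := proj1 (path_bounded x 0).
have hd : bnd (defect (path x 0)) (9 / 4 * (2 * a)).
  by apply: (defect_near_symmetry (proj1 bp') sp pp lr); [lra|lra|exact: path_near].
have c0 : 0 <= 9 / 4 * (2 * a) by lra.
have c1 : 9 / 4 * (2 * a) < 1 by lra.
have dx : 0 < (delta x)^-1 by rewrite invr_gt0.
have rE v t : A x (v, t%:C *: v) -> (delta x)^-1 <= `|t| -> path x 0 v = (bt t)%:C *: v.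
  move=> h ht; rewrite /path subr0 scale0r addr0 scale1r.
  exact: (truncated_eigen (hA x) (hp x) (delta0 x) (delta1 x) h ht).
apply: section_of_eigenvectors => //; first exact: half_plus_projection.
- move=> v t h ht; have t0 : 0 < t by lra.
  have bt0 : 0 < bt t by rewrite /bt divr_gt0 // sqrt1_gt0.
  rewrite /close_section /half_plus /= (op_sgn_eigen lr (path_selfadj x 0) c0 c1 hd bt0 (expr1n _ 2)).
    by apply: ip_inj => w; rewrite !ipE; field.
  by rewrite mul1r; apply: rE => //; rewrite ger0_norm // ltW.
move=> v t h ht; have t0 : t < 0 by lra.
have bt0 : 0 < - bt t by rewrite /bt -mulNr divr_gt0 ?oppr_gt0 // sqrt1_gt0.
have e1 : (-1 : R) ^+ 2 = 1 by rewrite sqrrN expr1n.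
rewrite /close_section /half_plus /= (op_sgn_eigen lr (path_selfadj x 0) c0 c1 hd bt0 e1).
  by apply: ip_inj => w; rewrite !ipE; field.
by rewrite mulN1r opprK; apply: rE => //; rewrite ler0_norm ?(ltW t0) //; lra.
Qed.

Lemma close_section_dist x : bnd (op_sub (close_section (x, 0)) (P x)) (7 * a).
Proof.
move=> u; have [_ h] := path_sgn x (lexx 0) ler01.
rewrite -(half_plus_reflection (P x)) -/(p x).
rewrite (_ : op_sub _ _ u = 2^-1%:C *: op_sub (op_sgn (path x 0)) (p x) u); last first.
  rewrite /op_sub /close_section /half_plus /=; move: (op_sgn _ u) (p x u) => y z.
  by apply: ip_inj => w; rewrite !ipE; field.
by rewrite rnormZ ger0_norm ?invr_ge0 //; have := h u; lra.
Qed.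

Lemma close_section_homotopy :
  homotopic_generalized_Cl1 form s A (fun x => close_section (x, 0)) P.
Proof.
exists close_section; split=> // [|t /andP[t0 t1]|x].
- have cyl (y : X * R) : unit_cylinder y -> 0 <= y.2 /\ y.2 <= 1.
    by move=> [_ /=]; rewrite in_itv /= => /andP[].
  apply/norm_continuousP => [y /cyl[t0 t1]|[x t] hy].
    by have [[b _ _ _ _] _] := path_sgn y.1 t0 t1; case: (half_plus_bounded b).
  have [/= t0 t1] := cyl _ hy; have [[b _ _ _ _] _] := path_sgn x t0 t1.
  apply: half_plus_cvg => //; apply: path_cvg => //.
    apply: cvg_trans (cvg_fst (F := nbhs x) (G := nbhs t)); apply: cvg_app; exact: cvg_within.
  apply: cvg_trans (cvg_snd (F := nbhs x) (G := nbhs t)); apply: cvg_app; exact: cvg_within.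
- apply: half_plus_section => [x|x]; first by case: (path_sgn x t0 t1).
  by apply: path_cvg => //; exact: cvg_cst.
- rewrite /close_section /=.
  have -> : path x 1 = p x.
    by apply/funext => u; rewrite /path subrr scale0r add0r scale1r.
  have [b _ pp _ _] := hp x.
  by rewrite (op_sgn_fix (proj1 b) pp) half_plus_reflection.
Qed.

End close_section.

Lemma exists_close_section P (eps : R) :
  generalized_Cl1_spectral_section form s A P -> 0 < eps ->
  exists Q, [/\ Cl1_spectral_section form s A Q, (sup_dist Q P < eps%:E)%E &
    homotopic_generalized_Cl1 form s A Q P].
Proof.
(* The distance to P is at most 7 a <= eps / 2. *)
move=> hP eps0; pose a := Num.min 8^-1 (eps / 14).
have a0 : 0 < a by rewrite lt_min invr_gt0 ltr0n /= divr_gt0.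
have a1 : a <= 8^-1 by rewrite ge_min lexx.
have a2 : a <= eps / 14 by rewrite ge_min lexx orbT.
have [delta [cd hd]] := cutoff_gauge hP a0.
exists (fun x => close_section P delta (x, 0)); split.
- exact: (close_section_Cl1 hP a0 a1 cd hd).
- apply: (@le_lt_trans _ _ (7 * a)%:E); last by rewrite lte_fin; lra.
  apply: ge_ereal_sup => _ /= [x _ <-].
  by apply: bnd_opnorm; [lra|exact: (close_section_dist hP a0 a1 hd)].
- exact: (close_section_homotopy hP a0 a1 cd hd).
Qed.

(** * From generalized sections to invertible families *)

Section deformation.
Variable P : X -> H -> H.
Hypothesis hP : generalized_Cl1_spectral_section form s A P.

Let p x := reflection (P x).
Let hp x : odd_symmetry (F x) (p x) := reflection_odd_symmetry x hP.
Let bp x : bounded_linear (p x). Proof. by case: (hp x). Qed.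
Let bF x : bounded_linear (F x) := bt_bounded (hA x).

(** The segment from [F x] in the direction of the symmetry [p x], stopped at [7 / 8] of
the way: [p x] itself has no inverse transform since its defect vanishes. *)
Definition mixture (x : X) (t : R) (u : H) : H :=
  (1 - 7 / 8 * t)%:C *: F x u + (7 / 8 * t)%:C *: p x u.

Lemma mixture_bounded x t : bounded_linear (mixture x t).
Proof. by apply: bounded_linear_add; apply: bounded_linear_scale; [exact: bF|exact: bp]. Qed.

Lemma mixture_selfadj x t : selfadj (mixture x t).
Proof.
have [_ sp _ _ _] := hp x.
by move=> u v; rewrite /mixture !ipDl !ipDr !ipZl !ipZr sp (bt_selfadj (hA x)).
Qed.

Lemma mixture_odd x t u : s (mixture x t u) = - mixture x t (s u).
Proof.
have [_ _ _ op _] := hp x; have ls := s_linear.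
by rewrite /mixture (linD ls) !(linZ ls) op (bt_odd (hA x)) !scalerN opprD.
Qed.

(** [F x] is a strict contraction and [p x] an isometry. *)
Lemma mixture_contraction x t u : 0 <= t -> t <= 1 -> u != 0 ->
  rnorm (mixture x t u) < rnorm u.
Proof.
move=> t0 t1 u0; have [_ sp pp _ _] := hp x.
have hF : rnorm (F x u) < rnorm u := bt_contraction (hA x) u0.
apply: le_lt_trans (rnormD _ _) _; rewrite !rnormZ (symmetry_isometry u sp pp).
rewrite !ger0_norm; [|lra|lra].
have : (1 - 7 / 8 * t) * rnorm (F x u) < (1 - 7 / 8 * t) * rnorm u.
  by rewrite ltr_pM2l //; lra.
lra.
Qed.

Lemma mixture_compact x t : totally_bounded_op (defect (mixture x t)).
Proof.
apply: (defect_perturbation (bF x) (mixture_bounded x t) (bt_defect_compact (hA x))).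
have [_ _ _ _ tp] := hp x; have := totally_bounded_scale (7 / 8 * t) tp.
congr totally_bounded_op; apply/funext => u; rewrite /mixture /op_sub -/(F x).
by move: (p x u) (F x u) => y z; apply: ip_inj => v; rewrite !ipE; ring.
Qed.

Lemma mixture0 x : mixture x 0 = F x.
Proof. by apply/funext => u; rewrite /mixture mulr0 subr0 scale1r scale0r addr0. Qed.

Lemma mixture1_defect x : bnd (defect (mixture x 1)) (9 / 16).
Proof.
have [[lp _] sp pp _ _] := hp x.
(* At t = 1 the distance to p x is at most (1 - 7 / 8) 2 = 1 / 4. *)
have -> : 9 / 16 = 9 / 4 * 4^-1 :> R by field.
apply: (defect_near_symmetry lp sp pp (proj1 (mixture_bounded x 1))) => //.
move=> u; rewrite (_ : op_sub _ _ u = 8^-1%:C *: (F x u - p x u)); last first.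
  rewrite /mixture /op_sub; move: (p x u) (F x u) => y z.
  by apply: ip_inj => v; rewrite !ipE; field.
rewrite rnormZ ger0_norm ?invr_ge0 //.
have := rnormB (F x u) (p x u); rewrite (symmetry_isometry u sp pp).
have := bt_bnd1 (hA x) u; rewrite mul1r -/(F x); lra.
Qed.

Lemma mixture_cvg (Y : Type) (Fil : set_system Y) (FF : Filter Fil) (xx : Y -> X) (tt : Y -> R) x (t : R) :
  xx @ Fil `=>` nbhs x -> tt z @[z --> Fil] --> t ->
  op_cvg Fil (fun z => mixture (xx z) (tt z)) (mixture x t).
Proof.
move=> hx ht.
have cF : op_cvg Fil (fun z => F (xx z)) (F x) := op_cvg_map hx (@Riesz_cvg x).
have cp : op_cvg Fil (fun z => p (xx z)) (p x) := op_cvg_map hx (@reflection_cvg P x hP).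
have c7 : (7 / 8 * tt z) @[z --> Fil] --> 7 / 8 * t by apply: cvgMr.
apply: op_cvg_add; apply: op_cvg_scale => //.
by apply: cvgB => //; exact: cvg_cst.
Qed.

(** The first case gives [A x] itself at [t = 0], instead of the inverse transform of
[F x]. *)
Definition deformation (z : X * R) : set (H * H) :=
  if z.2 == 0 then A z.1 else inverse_transform (mixture z.1 z.2).

Lemma deformation_RK1 z : unit_cylinder z -> RK1 form s (deformation z).
Proof.
move=> [_ /=]; rewrite in_itv /= /deformation => /andP[t0 t1]; case: eqP => // _.
apply: inverse_transform_RK1.
- by case: (mixture_bounded z.1 z.2).
- exact: mixture_selfadj.
- exact: mixture_odd.
- by move=> u u0; exact: mixture_contraction.
- exact: mixture_compact.
Qed.

Lemma deformation_transform z : unit_cylinder z ->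
  bounded_transform form (deformation z) = mixture z.1 z.2.
Proof.
move=> [_ /=]; rewrite in_itv /= /deformation => /andP[t0 t1]; case: eqP => [->|_].
  by rewrite mixture0.
apply: inverse_transformK.
- by case: (mixture_bounded z.1 z.2).
- exact: mixture_selfadj.
- exact: mixture_odd.
- by move=> u u0; exact: mixture_contraction.
- exact: mixture_compact.
Qed.

Lemma section_homotopic_invertible :
  exists2 B, RK1_homotopic form s A B & forall x, invertible (B x).
Proof.
have cyl1 x : unit_cylinder (x, 1 : R).
  by split=> //=; rewrite in_itv /= ler01 lexx.
exists (fun x => deformation (x, 1)).
  exists deformation; split=> //; first exact: deformation_RK1.
    apply/norm_continuousP => [y hy|[x t] hy].
      by rewrite (deformation_transform hy); case: (mixture_bounded y.1 y.2).
    rewrite (deformation_transform hy).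
    apply: (@op_cvg_near _ _ _ (fun z => mixture z.1 z.2)).
      by rewrite near_withinE; apply: filterE => z /deformation_transform.
    apply: mixture_cvg.
      apply: cvg_trans (cvg_fst (F := nbhs x) (G := nbhs t)); apply: cvg_app; exact: cvg_within.
    apply: cvg_trans (cvg_snd (F := nbhs x) (G := nbhs t)); apply: cvg_app; exact: cvg_within.
  by move=> x; rewrite /deformation /= eqxx.
move=> x; have hd := mixture1_defect x; rewrite -(deformation_transform (cyl1 _ x)) in hd.
have c0 : 0 < 9 / 16 :> R by lra.
have c1 : 9 / 16 < 1 :> R by lra.
exact: (RK1_defect_invertible (deformation_RK1 (cyl1 _ x)) c0 c1 hd).
Qed.

End deformation.

(** * From invertible families to generalized sections *)

Section transport.
Variable h : X * R -> set (H * H).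
Hypothesis h_RK1 : forall z, unit_cylinder z -> RK1 form s (h z).
Hypothesis h_Riesz : Riesz_continuous form unit_cylinder h.
Hypothesis h_start : forall x, h (x, 0) = A x.
Hypothesis h_end : forall x, invertible (h (x, 1)).

Let G x t := bounded_transform form (h (x, t)).

Let cyl (x : X) (t : R) : 0 <= t -> t <= 1 -> unit_cylinder (x, t).
Proof. by move=> t0 t1; split=> //=; rewrite in_itv /= t0 t1. Qed.

Let bG x t : 0 <= t -> t <= 1 -> bounded_linear (G x t).
Proof. by move=> t0 t1; apply: bt_bounded; apply/h_RK1/cyl. Qed.

Lemma homotopy_near x (t eta : R) : 0 <= t -> t <= 1 -> 0 < eta ->
  \forall y \near x & t' \near t, 0 <= t' -> t' <= 1 -> bnd (op_sub (G y t') (G x t)) eta.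
Proof.
move=> t0 t1 eta0.
have lG z : unit_cylinder z -> linear (bounded_transform form (h z)).
  by move=> /h_RK1 hz; exact: bt_linear.
have := proj1 (norm_continuousP lG) h_Riesz (x, t) (cyl x t0 t1) eta eta0.
rewrite near_withinE; apply: filterS => -[y t'] /= hy t'0 t'1.
by apply: hy; exact: cyl.
Qed.

(** By compactness of the interval, continuity in [x] is uniform in [t]. *)
Lemma homotopy_tube x (eta : R) : 0 < eta ->
  \forall y \near x, forall t, `[0, 1]%classic t -> bnd (op_sub (G y t) (G x t)) eta.
Proof.
move=> eta0; have e2 : 0 < eta / 2 by lra.
have /compact_near_coveringP cov := @segment_compact R 0 1.
have : \forall y \near x, `[0, 1] `<=`
    (fun t => 0 <= t -> t <= 1 -> bnd (op_sub (G y t) (G x t)) eta).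
  2: by apply: filterS => y hy t ht; apply: hy => //; move: ht; rewrite /= in_itv => /andP[].
apply: cov => t.
rewrite /= in_itv /= => /andP[t0 t1].
have [[U V] [/= nU nV] UV] := homotopy_near x t0 t1 e2.
exists (V, U) => //= -[t' y] [/= Vt' Uy].
move=> t'0 t'1 u.
have h1 := UV (y, t') (conj Uy Vt') t'0 t'1 u.
have h2 := UV (x, t') (conj (nbhs_singleton nU) Vt') t'0 t'1 u.
rewrite (_ : op_sub _ _ u = op_sub (G y t') (G x t) u - op_sub (G x t') (G x t) u).
  by apply: le_trans (rnormB _ _) _; move: h1 h2 => /=; lra.
rewrite /op_sub; move: (G x t u) (G y t' u) (G x t' u) => a b c.
by apply: ip_inj => w; rewrite !ipE; ring.
Qed.

Lemma homotopy_uniform x (eta : R) : 0 < eta -> exists2 d : R, 0 < d &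
  forall t t', 0 <= t -> t <= 1 -> 0 <= t' -> t' <= 1 -> `|t - t'| <= d ->
  bnd (op_sub (G x t) (G x t')) eta.
Proof.
move=> eta0; have e2 : 0 < eta / 2 by lra.
have /compact_near_coveringP cov := @segment_compact R 0 1.
have : \forall d \near (0 : R)^'+, `[0, 1] `<=` (fun t => 0 <= t -> t <= 1 -> forall t', 0 <= t' -> t' <= 1 ->
    `|t - t'| <= d -> bnd (op_sub (G x t) (G x t')) eta).
  apply: cov => t; rewrite /= in_itv /= => /andP[t0 t1].
  have [[U V] [/= nU /nbhs_ballP[r /= r0 rV]] UV] := homotopy_near x t0 t1 e2.
  have r2 : 0 < r / 2 by lra.
  exists (ball t (r / 2), [set d | d < r / 2]) => /=.
    by split; [exact: nbhsx_ballx|exact: nbhs_right_lt].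
  move=> [t1' d] [/= tt1 dr] t1'0 t1'1 t' t'0 t'1 ht' u.
  have Vt1 : V t1' by apply: rV; rewrite /= /ball /= in tt1 *; lra.
  have Vt' : V t'.
    apply: rV; rewrite /= /ball /= in tt1 *.
    have := ler_distD t1' t t'; lra.
  have h1 := UV (x, t1') (conj (nbhs_singleton nU) Vt1) t1'0 t1'1 u.
  have h2 := UV (x, t') (conj (nbhs_singleton nU) Vt') t'0 t'1 u.
  rewrite (_ : op_sub _ _ u = op_sub (G x t1') (G x t) u - op_sub (G x t') (G x t) u).
    by apply: le_trans (rnormB _ _) _; move: h1 h2 => /=; lra.
  rewrite /op_sub; move: (G x t u) (G x t1' u) (G x t' u) => a b c.
  by apply: ip_inj => w; rewrite !ipE; ring.
move=> hd; have hpos : \forall d \near (0 : R)^'+, 0 < d by exact: nbhs_right_gt.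
have [d [d0 hd']] := filter_ex (filterI hpos hd).
exists d => // t t' t0 t1; apply: hd' => //.
by rewrite /= in_itv /= t0 t1.
Qed.

(** Continuous step lengths for which the transforms move by at most [1 / 4], the
distance up to which the sign of an operator near a symmetry is controlled. *)
Lemma homotopy_gauge : exists delta : X -> R, continuous delta /\
  forall x, [/\ 0 < delta x, delta x <= 1 &
    forall t t', 0 <= t -> t <= 1 -> 0 <= t' -> t' <= 1 -> `|t - t'| <= delta x ->
    bnd (op_sub (G x t) (G x t')) 4^-1].
Proof.
apply: (continuous_gauge (J := `[0, 1]%classic) (T := G) (good := fun x d =>
  forall t t', 0 <= t -> t <= 1 -> 0 <= t' -> t' <= 1 -> `|t - t'| <= d ->
  bnd (op_sub (G x t) (G x t')) 4^-1)).
  by move=> x eta; exact: homotopy_tube.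
(* A distance between two values at y is at most the distance at x plus twice
   the distance between the families: three terms 1 / 12. *)
move=> x; have e0 : 0 < 12^-1 :> R by rewrite invr_gt0.
have [d d0 hd] := homotopy_uniform x e0.
exists (Num.min d 12^-1); split.
- by rewrite lt_min d0.
- by rewrite ge_min; apply/orP; right; lra.
move=> y hy d' d'0; rewrite le_min => /andP[d'd _] t t' t0 t1 t'0 t'1 tt' u.
have ht : bnd (op_sub (G x t) (G y t)) 12^-1.
  by apply: bnd_le (hy t _); rewrite ?ge_min ?lexx ?orbT //= in_itv /= t0 t1.
have ht' : bnd (op_sub (G x t') (G y t')) 12^-1.
  by apply: bnd_le (hy t' _); rewrite ?ge_min ?lexx ?orbT //= in_itv /= t'0 t'1.
have hx := hd _ _ t0 t1 t'0 t'1 (le_trans tt' d'd) u.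
rewrite (_ : op_sub (G y t) (G y t') u = (op_sub (G x t) (G x t') u - op_sub (G x t) (G y t) u)
   + op_sub (G x t') (G y t') u); last first.
  rewrite /op_sub; move: (G x t u) (G y t u) (G x t' u) (G y t' u) => a b c e.
  by apply: ip_inj => w; rewrite !ipE; ring.
have n1 := rnormD (op_sub (G x t) (G x t') u - op_sub (G x t) (G y t) u) (op_sub (G x t') (G y t') u).
have n2 := rnormB (op_sub (G x t) (G x t') u) (op_sub (G x t) (G y t) u).
have := ht u; have := ht' u; lra.
Qed.

Variable delta : X -> R.
Hypothesis cdelta : continuous delta.
Hypothesis delta0 : forall x, 0 < delta x.
Hypothesis hdelta : forall x t t', 0 <= t -> t <= 1 -> 0 <= t' -> t' <= 1 ->
  `|t - t'| <= delta x -> bnd (op_sub (G x t) (G x t')) 4^-1.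

Let time (k : nat) x : R := Num.max (1 - k%:R * delta x) 0.

Let time0 k x : 0 <= time k x. Proof. by rewrite le_max lexx orbT. Qed.

Let time1 k x : time k x <= 1.
Proof.
have : 0 <= k%:R * delta x by rewrite mulr_ge0 // ltW.
by rewrite ge_max ler01 andbT; lra.
Qed.

Let time_step k x : `|time k.+1 x - time k x| <= delta x.
Proof.
have d0 := delta0 x; rewrite /time -natr1 mulrDl mul1r.
by case: (leP (1 - k%:R * delta x) 0); case: (leP (1 - (k%:R * delta x + delta x)) 0) => *;
  rewrite ler_norml; lra.
Qed.

Lemma time_cvg k : continuous (time k).
Proof.
move=> x; apply: (@continuous_max _ _ (fun y => 1 - k%:R * delta y) (fun => 0)).
  by apply: cvgB; [exact: cvg_cst|apply: cvgMr; exact: cdelta].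
exact: cvg_cst.
Qed.

Let time_end k x : 1 <= k%:R * delta x -> time k x = 0.
Proof. by move=> k1; apply/max_idPr; lra. Qed.

(** The symmetry obtained after [k] steps from [t = 1] towards [t = 0]. *)
Fixpoint transported (k : nat) (x : X) : H -> H :=
  if k is k'.+1 then
    op_sgn (fun u => transported k' x u + op_sub (G x (time k x)) (G x (time k' x)) u)
  else op_sgn (G x 1).

Let step k x u := transported k x u + op_sub (G x (time k.+1 x)) (G x (time k x)) u.

Lemma G_defect x : exists c, [/\ 0 <= c, c < 1 & bnd (defect (G x 1)) c].
Proof. by apply: RK1_invertible_defect => //; apply/h_RK1/cyl. Qed.

Let step_near k x : bnd (op_sub (step k x) (transported k x)) 4^-1.
Proof.
move=> u; rewrite (_ : op_sub _ _ u = op_sub (G x (time k.+1 x)) (G x (time k x)) u).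
  by apply: hdelta.
rewrite /step /op_sub; move: (transported k x u) (G x _ u) (G x _ u) => a b c.
by apply: ip_inj => w; rewrite !ipE; ring.
Qed.

Let step_bounded k x : bounded_linear (transported k x) -> bounded_linear (step k x).
Proof.
move=> b; apply: bounded_linear_add => //; apply: bounded_linear_sub; exact: bG.
Qed.

Let step_selfadj k x : selfadj (transported k x) -> selfadj (step k x).
Proof.
have sG t : 0 <= t -> t <= 1 -> selfadj (G x t).
  by move=> t0 t1; apply: bt_selfadj; apply/h_RK1/cyl.
move=> sp u v; rewrite /step /op_sub ipDl ipDr ipBl ipBr sp.
by rewrite (sG (time k.+1 x)) ?(sG (time k x)).
Qed.

Lemma transported_symmetry k x : odd_symmetry (G x (time k x)) (transported k x).
Proof.
elim: k => [|k ih].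
  have time1' : time 0 x = 1 by rewrite /time mul0r subr0; apply/max_idPl.
  have h1 : RK1 form s (h (x, 1)) by exact/h_RK1/cyl.
  rewrite time1'; have [c [c0 c1 hc]] := G_defect x.
  have lG : linear (G x 1) := bt_linear h1.
  have sG : selfadj (G x 1) := bt_selfadj h1.
  split.
  - exact: (op_sgn_bounded lG sG c0 c1 hc).
  - exact: (op_sgn_selfadj lG sG c0 c1 hc).
  - exact: (op_sgn_sq lG sG c0 c1 hc).
  - exact: (op_sgn_anticomm lG sG c0 c1 hc s_bounded (bt_odd h1)).
  - exact: (op_sgn_totally_bounded lG sG c0 c1 hc (bt_defect_compact h1)).
have [bp sp pp op tp] := ih.
have hk : RK1 form s (h (x, time k.+1 x)) by exact/h_RK1/cyl.
have hk' : RK1 form s (h (x, time k x)) by exact/h_RK1/cyl.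
have e4 : 0 <= 4^-1 :> R by rewrite invr_ge0.
have ls := s_linear.
have oG t u : 0 <= t -> t <= 1 -> s (G x t u) = - G x t (s u).
  by move=> t0 t1; apply: bt_odd; apply/h_RK1/cyl.
have os u : s (step k x u) = - step k x (s u).
  rewrite /step (linD ls) op /op_sub (linB ls) !oG //.
  move: (transported k x _) (G x _ _) (G x _ _) => a b c.
  by apply: ip_inj => w; rewrite !ipE; ring.
have ts : totally_bounded_op (op_sub (step k x) (G x (time k.+1 x))).
  move: tp; congr totally_bounded_op; apply/funext => u; rewrite /step /op_sub.
  move: (transported k x u) (G x _ u) (G x _ u) => a b c.
  by apply: ip_inj => w; rewrite !ipE; ring.
by have [] := op_sgn_odd_symmetry (bt_bounded hk) (bt_defect_compact hk) (proj1 bp) sp pp e4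
  (lexx _) (step_bounded bp) (step_selfadj sp) os (step_near k x) ts.
Qed.

Lemma homotopy_cvg (tau : X -> R) x : continuous tau -> (forall y, 0 <= tau y) ->
  (forall y, tau y <= 1) -> op_cvg (nbhs x) (fun y => G y (tau y)) (G x (tau x)).
Proof.
move=> ctau tau0 tau1 e e0.
have [[U V] [/= nU nV] UV] := homotopy_near x (tau0 x) (tau1 x) e0.
apply: filterS (filterI nU (ctau x V nV)) => y [Uy Vy].
by apply: (UV (y, tau y)) => /=.
Qed.

Lemma transported_cvg k x : op_cvg (nbhs x) (transported k) (transported k x).
Proof.
elim: k => [|k ih].
  have h1 y : RK1 form s (h (y, 1)) by exact/h_RK1/cyl.
  have [c [c0 c1 hc]] := G_defect x.
  apply: (op_sgn_cvg (c := c) _ (bt_linear (h1 x)) (bt_selfadj (h1 x)) c0 c1 hc).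
    by apply: filterE => y; split; [exact: bt_linear|exact: bt_selfadj].
  by apply: (homotopy_cvg (tau := fun=> 1)) => // y; exact: cvg_cst.
have [bp sp pp op tp] := transported_symmetry k x.
have e4 : 0 <= 4^-1 :> R by rewrite invr_ge0.
have hd : bnd (defect (step k x)) (9 / 4 * 4^-1).
  by apply: (defect_near_symmetry (proj1 bp) sp pp (proj1 (step_bounded bp))).
apply: (op_sgn_cvg (c := 9 / 4 * 4^-1) _ (proj1 (step_bounded bp)) (step_selfadj sp) _ _ hd).
- apply: filterE => y; have [b sy _ _ _] := transported_symmetry k y.
  by split; [case: (step_bounded b)|exact: step_selfadj].
- lra.
- lra.
apply: op_cvg_add => //; apply: op_cvg_sub.
  by apply: homotopy_cvg => //; exact: time_cvg.
by apply: homotopy_cvg => //; exact: time_cvg.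
Qed.

(** When the time is [0], a step takes the sign of a symmetry. *)
Lemma transported_stable k l x : 1 <= k%:R * delta x -> 1 <= l%:R * delta x ->
  transported k x = transported l x.
Proof.
have stab m j : 1 <= m%:R * delta x -> transported (m + j) x = transported m x.
  move=> hm; elim: j => [|j ih]; first by rewrite addn0.
  have hj : 1 <= (m + j)%:R * delta x.
    by apply: le_trans hm _; rewrite ler_wpM2r ?ler_nat ?leq_addr // ltW.
  have hj' : 1 <= (m + j).+1%:R * delta x.
    by apply: le_trans hj _; rewrite ler_wpM2r ?ler_nat // ltW.
  have [[lp _] _ pp _ _] := transported_symmetry (m + j) x.
  rewrite addnS /= (time_end hj) (time_end hj') -[RHS]ih -[RHS](op_sgn_fix lp pp).
  by congr op_sgn; apply/funext => u; rewrite /op_sub subrr addr0.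
move=> hk hl; rewrite -(stab k l hk) addnC; exact: stab.
Qed.

Let stop x := Num.bound (delta x)^-1.

(** The number of steps [stop x] is not continuous, but near [x] it may be replaced
by a constant, namely a number of steps that suffices for the step length
[delta x / 2]. *)
Lemma transported_section :
  generalized_Cl1_spectral_section form s A (fun x => half_plus (transported (stop x) x)).
Proof.
have bound1 (m : nat) (d : R) : 0 < d -> d^-1 <= m%:R -> 1 <= m%:R * d.
  by move=> d0 hm; rewrite -ler_pdivrMr // div1r.
have stop1 x : 1 <= (stop x)%:R * delta x.
  by apply: bound1 => //; apply/ltW/archi_boundP; rewrite invr_ge0 ltW.
apply: half_plus_section => [x|x].
  have := transported_symmetry (stop x) x.
  by rewrite (time_end (stop1 x)) /G h_start.
pose m := Num.bound (delta x / 2)^-1.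
have d2 : 0 < delta x / 2 by rewrite divr_gt0.
have hm : (delta x / 2)^-1 <= m%:R by apply/ltW/archi_boundP; rewrite invr_ge0 ltW.
have mx y : delta x / 2 <= delta y -> 1 <= m%:R * delta y.
  move=> hy; apply: le_trans (bound1 _ _ d2 hm) _; rewrite ler_wpM2l //.
have near_m : \forall y \near x, transported m y = transported (stop y) y.
  have : \forall y \near x, delta x / 2 < delta y.
    have lt2 : delta x / 2 < delta x by have := delta0 x; lra.
    exact: (cvgr_gt (delta x) (@cdelta x) _ lt2).
  by apply: filterS => y /ltW/mx hy; exact: transported_stable.
have -> : transported (stop x) x = transported m x.
  by apply: transported_stable => //; apply: mx; have := delta0 x; lra.
exact: (op_cvg_near near_m (transported_cvg m x)).
Qed.

End transport.

Lemma homotopic_invertible_section B : RK1_homotopic form s A B ->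
  (forall x, invertible (B x)) ->
  exists P, generalized_Cl1_spectral_section form s A P.
Proof.
move=> [h [h1 h2 h3 h4]] hB.
have hi x : invertible (h (x, 1)) by rewrite h4.
have [delta [cd hd]] := homotopy_gauge h1 h2.
have d0 x : 0 < delta x by case: (hd x).
have d1 x := let: And3 _ _ h := hd x in h.
by eexists; exact: (transported_section h1 h2 h3 hi cd d0 d1).
Qed.

Lemma section_generalized P : Cl1_spectral_section form s A P ->
  generalized_Cl1_spectral_section form s A P.
Proof.
move=> [[fP [r [_ r0 hr]]] sP]; split=> //; split=> // x.
exact: section_compact (hr x).
Qed.

End families.

End hilbert.

(** * The theorem *)

Theorem theorem6p6 (R : realType) (H : completeNormedModType R[i])
    (form : {dot H for conjC}) (H0 H1 : set H) (s : H -> H)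
    (form_norm : induces_norm form) (H_separable : @separable_space R H)
    (s_grading : grading form H0 H1 s)
    (H0_inf : infinite_dimensional H0) (H1_inf : infinite_dimensional H1)
    (X : topologicalType) (A : X -> set (H * H))
    (A_RK1 : forall x, RK1 form s (A x))
    (A_Riesz : Riesz_continuous form setT A) :
  [/\ (exists P, Cl1_spectral_section form s A P) <->
        (exists P, generalized_Cl1_spectral_section form s A P),
      (exists P, generalized_Cl1_spectral_section form s A P) <->
        (exists2 B : X -> set (H * H), RK1_homotopic form s A B &
           forall x, invertible (B x)) &
      forall P (e : R), generalized_Cl1_spectral_section form s A P -> 0 < e ->
        exists Q, [/\ Cl1_spectral_section form s A Q,
          (sup_dist Q P < e%:E)%E &
          homotopic_generalized_Cl1 form s A Q P]].
Proof.
have close P (e : R) := @exists_close_section R H form form_norm H0 H1 s s_grading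
  H_separable X A A_RK1 A_Riesz P e.
split=> //; split=> [[P hP]|].
- exists P; exact: (section_generalized form_norm s_grading H_separable A_RK1 hP).
- by case=> P hP; have [Q [hQ _ _]] := close P 1 hP ltr01; exists Q.
- exact: (section_homotopic_invertible form_norm s_grading H_separable A_RK1 A_Riesz hP).
- case=> B hB iB.
  exact: (homotopic_invertible_section form_norm s_grading H_separable A_RK1 hB iB).
Qed.
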